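(* Let $\mathfrak{m}$ be a nilpotent ideal of $\mathfrak{b}$. The intersection of any two non-empty $B$-stable subsets of $\mathfrak{m}^{\bullet}$ that are closed in $\mathfrak{m}^{\bullet}$ (Zariski topology) is non-empty.
   Context: Let $\mathfrak{g}$ be a complex finite-dimensional semisimple Lie algebra, $G$ its adjoint group, $\mathfrak{b}=\mathfrak{h}\oplus\mathfrak{n}$ a Borel subalgebra with Cartan subalgebra $\mathfrak{h}$ and nilradical $\mathfrak{n}$, $B\subset G$ the Borel subgroup with Lie algebra $\mathfrak{b}$ acting by the adjoint action. A nilpotent ideal of $\mathfrak{b}$ is an ideal of $\mathfrak{b}$ contained in $\mathfrak{n}$. For such $\mathfrak{m}$, $\mathfrak{m}^{\bullet}$ is the set of $X\in\mathfrak{n}$ such that $\mathfrak{m}$ is the smallest ideal of $\mathfrak{b}$ containing $X$; it is an open $B$-stable subset of $\mathfrak{m}$. *)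

(* Defs.v *)
From HB Require Import structures.
From mathcomp Require Import all_boot all_order all_algebra.
From mathcomp Require Import reals.
From mathcomp.real_closed Require Import complex.
From mathcomp Require mpoly.

Set Implicit Arguments.
Unset Strict Implicit.
Unset Printing Implicit Defensive.

Import GRing.Theory.
Local Open Scope ring_scope.

(* A finite-dimensional Lie algebra over F is F^N ('rV[F]_N) with a bracket
   given by structure constants  c i j = [e_i, e_j].  Subspaces of g are
   represented (mxalgebra style) by the row spaces of square matrices 'M_N. *)
Section LieDefs.
Variables (F : fieldType) (N : nat).

Definition struct_const := 'I_N -> 'I_N -> 'rV[F]_N.

Variable c : struct_const.

Definition lbr (x y : 'rV[F]_N) : 'rV[F]_N :=
  \sum_(i < N) \sum_(j < N) (x 0 i * y 0 j) *: c i j.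

Definition is_lie_algebra : Prop :=
  (forall x, lbr x x = 0) /\
  (forall x y z, lbr x (lbr y z) + lbr y (lbr z x) + lbr z (lbr x y) = 0).

Definition brmx (A B : 'M[F]_N) : 'M[F]_N :=
  (\sum_(i < N) \sum_(j < N) <<lbr (row i A) (row j B)>>)%MS.

Definition subalg (A : 'M[F]_N) : Prop := (brmx A A <= A)%MS.

Definition ideal_of (I A : 'M[F]_N) : Prop :=
  (I <= A)%MS /\ (brmx A I <= I)%MS.

Definition derived_series (A : 'M[F]_N) (k : nat) : 'M[F]_N :=
  iter k (fun D => brmx D D) A.
Definition solvable_alg (A : 'M[F]_N) : Prop :=
  exists k, (derived_series A k <= (0 : 'M[F]_N))%MS.

Definition lower_central (A : 'M[F]_N) (k : nat) : 'M[F]_N :=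
  iter k (fun D => brmx A D) A.
Definition nilpotent_alg (A : 'M[F]_N) : Prop :=
  exists k, (lower_central A k <= (0 : 'M[F]_N))%MS.

Definition semisimple : Prop :=
  forall I, ideal_of I 1%:M -> solvable_alg I -> (I <= (0 : 'M[F]_N))%MS.

Definition borel_subalg (b : 'M[F]_N) : Prop :=
  subalg b /\ solvable_alg b /\
  forall b', subalg b' -> solvable_alg b' -> (b <= b')%MS -> (b' <= b)%MS.

Definition cartan_subalg (h : 'M[F]_N) : Prop :=
  subalg h /\ nilpotent_alg h /\
  forall x : 'rV[F]_N, (brmx <<x>>%MS h <= h)%MS -> (x <= h)%MS.

Definition nilradical (b n : 'M[F]_N) : Prop :=
  ideal_of n b /\ nilpotent_alg n /\
  forall I, ideal_of I b -> nilpotent_alg I -> (I <= n)%MS.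

(* ad x, acting on row vectors on the right: v *m ad x = [x, v] *)
Definition ad (x : 'rV[F]_N) : 'M[F]_N :=
  \matrix_(i, j) (lbr x (delta_mx 0 i)) 0 j.

(* exp (ad x) for ad-nilpotent x (then (ad x)^N = 0, so the sum is exact) *)
Definition exp_ad (x : 'rV[F]_N) : 'M[F]_N :=
  \sum_(k < N.+1) (k`!%:R)^-1 *: (ad x ^+ k).

(* elements of the maximal torus T of the adjoint group attached to h:
   Lie algebra automorphisms of g fixing h pointwise *)
Definition torus_elt (h t : 'M[F]_N) : Prop :=
  t \in unitmx /\
  (forall x y, lbr (x *m t) (y *m t) = lbr x y *m t) /\
  (forall x : 'rV[F]_N, (x <= h)%MS -> x *m t = x).

(* The Borel subgroup B = T U of the adjoint group G, U = exp(ad n),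
   acting on g = 'rV_N by  x |-> x *m g. *)
Inductive in_borel_grp (h n : 'M[F]_N) : 'M[F]_N -> Prop :=
| BG_torus t : torus_elt h t -> in_borel_grp h n t
| BG_unip x : (x <= n)%MS -> in_borel_grp h n (exp_ad x)
| BG_mul g1 g2 : in_borel_grp h n g1 -> in_borel_grp h n g2 ->
                 in_borel_grp h n (g1 *m g2)
| BG_inv g1 : in_borel_grp h n g1 -> in_borel_grp h n (invmx g1).

Definition B_stable (h n : 'M[F]_N) (S : 'rV[F]_N -> Prop) : Prop :=
  forall g1 x, in_borel_grp h n g1 -> S x -> S (x *m g1).

Definition mbullet (b n m : 'M[F]_N) (X : 'rV[F]_N) : Prop :=
  (X <= n)%MS /\ (X <= m)%MS /\
  forall I, ideal_of I b -> (X <= I)%MS -> (m <= I)%MS.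

Definition poly_eval (p : mpoly.mpoly N F) (x : 'rV[F]_N) : F :=
  mpoly.meval (fun i => x 0 i) p.

Definition zariski_closed_in (T S : 'rV[F]_N -> Prop) : Prop :=
  exists P : mpoly.mpoly N F -> Prop,
    forall x, S x <-> (T x /\ forall p, P p -> poly_eval p x = 0).

End LieDefs.

(* Main.v *)
(** Let [I] be the set of roots of [m] and [A] the set of its minimal elements
(no positive root can be subtracted inside [I]).  Then [m^bullet] is the set of
[x] in [m] all of whose [A]-components are nonzero, and both closed stable sets
turn out to contain an element of the sum of the root spaces of [A]; since [A]
is linearly independent, the torus acts transitively on the elements of
[m^bullet] in this sum.

To contract [x = e + y], [e] being the [A]-part, to [e], one needs a one-parameter
subgroup of weight zero on [A].  By Gordan's alternative and a cancellation
argument on sums of roots there is a grading [deg], positive on the positive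
roots, with constant value [nu] on [A].  Let [(e, h0, f)] be an sl2-triple with
[f] in the sum of the opposite root spaces, and put
[lam = 2 deg - nu h0], which vanishes on [A].  The components of [y] with
[lam <= 0] are removed by [exp (ad u)], by increasing [deg]: they lie in
[[n, e]], for otherwise some vector killed by [e] would have a negative
eigenvalue under [h0].  The torus element [z ^ lam] then tends to the projection
to [e] as [z] tends to 0, which for a Zariski closed set is an argument about
polynomials in [z]. *)
Require Import Defs.
From mathcomp Require Import all_boot all_order all_algebra.
From mathcomp Require Import boolp reals.
From mathcomp.real_closed Require Import complex.
From mathcomp Require mpoly.
From mathcomp Require Import zify ring lra.

Set Implicit Arguments.
Unset Strict Implicit.
Unset Printing Implicit Defensive.

Import Order.TTheory GRing.Theory Num.Theory.
Local Open Scope ring_scope.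

(** * Weakly closed sets of nilpotent matrices *)

Section Jacobson.
Variables (K : fieldType) (n : nat).
Implicit Types (T : 'M[K]_n -> Prop) (v : 'rV[K]_n) (l : seq 'M[K]_n).

(** The torus alone cannot contract [x] to [e]: if [A] consists of the simple roots, weight zero on
    [A] forces weight zero on every root. The unipotent part of [B] has to remove what the torus
    cannot shrink.

    Constancy of [deg] on [A] is used twice. Bracketing with [e] is homogeneous for [deg], so the
    elimination can proceed degree by degree. Moreover a root of positive degree with [lam <= 0] has
    eigenvalue [(2 deg - lam) / nu > 0] under [h0]; on the dual root this is the negative eigenvalue
    that sl2 forbids for a vector killed by [e].

    The structure theory of the roots is built from the definitions. Nilpotency arguments rest on
    Jacobson's theorem, which applies to sets of homogeneous elements that are not subspaces. Traces
    over root strings replace the integrality of Cartan numbers: rational values are enough, and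
    denominators are cleared whenever a torus element requires integral exponents. *)

Fixpoint killed T k v : Prop :=
  if k is k'.+1 then forall t, T t -> killed T k' (v *m t) else v = 0.

Lemma killed0 T k : killed T k 0.
Proof. by elim: k => //= k IH t _; rewrite mul0mx. Qed.

Lemma killedZD T k a v w : killed T k v -> killed T k w -> killed T k (a *: v + w).
Proof.
elim: k v w => [|k IH] v w /=; first by move=> -> ->; rewrite scaler0 addr0.
by move=> hv hw t Tt; rewrite mulmxDl -scalemxAl; apply: IH; [apply: hv|apply: hw].
Qed.

Lemma killedD T k v w : killed T k v -> killed T k w -> killed T k (v + w).
Proof. by move=> hv hw; rewrite -[v]scale1r; apply: killedZD. Qed.

Lemma killedZ T k a v : killed T k v -> killed T k (a *: v).
Proof. by move=> hv; rewrite -[_ *: _]addr0; apply/killedZD/killed0. Qed.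

Lemma killedS T k v : killed T k v -> killed T k.+1 v.
Proof.
elim: k v => [|k IH] v; first by move=> /= -> t _; rewrite mul0mx.
by move=> hv t Tt; apply/IH/hv.
Qed.

Lemma killed_le T k k' v : (k <= k')%N -> killed T k v -> killed T k' v.
Proof.
by move=> /subnK <-; elim: (k' - k)%N => // j IH /IH; apply: killedS.
Qed.

Lemma killed_sub T T' k v :
  (forall t, T' t -> T t) -> killed T k v -> killed T' k v.
Proof. by move=> sT; elim: k v => //= k IH v hv t /sT Tt; apply/IH/hv. Qed.

(** Apply elements of [T] as long as the result is nonzero; this stops after fewer than [k] steps.
    Recording [w] as a product applied to [v] lets a caller show that [w] stays in a subspace stable
    under [T]. *)
Lemma killed_neq0 T k v : v != 0 -> killed T k v ->
  exists2 w, w != 0 & (exists2 s : seq 'M_n,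
     (forall t, t \in s -> T t) & w = foldl (fun x t => x *m t) v s) /\
     forall t, T t -> w *m t = 0.
Proof.
elim: k v => [|k IH] v v0 /=; first by move=> v00; rewrite v00 eqxx in v0.
move=> hv; case: (pselect (exists2 t, T t & v *m t != 0)) => [[t Tt vt0]|h].
  have [w w0 [[s sT wE] wk]] := IH _ vt0 (hv t Tt).
  exists w => //; split=> //; exists (t :: s) => // u.
  by rewrite inE => /orP[/eqP ->|/sT].
exists v => //; split; first by exists [::].
move=> t Tt; apply/eqP; apply: contra_notT h => vt0; by exists t.
Qed.

Inductive lspan T : 'M[K]_n -> Prop :=
| Lspan_in t : T t -> lspan T t
| Lspan0 : lspan T 0
| LspanZD a s t : lspan T s -> lspan T t -> lspan T (a *: s + t).

Lemma lspan_sum T (I : Type) (r : seq I) (P : pred I) (F : I -> 'M[K]_n) :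
  (forall i, P i -> lspan T (F i)) -> lspan T (\sum_(i <- r | P i) F i).
Proof.
move=> h; elim/big_ind: _ => //; first exact: Lspan0.
by move=> x y hx hy; rewrite -[x]scale1r; apply: LspanZD.
Qed.

Lemma lspan_trans T T' t :
  (forall s, T s -> lspan T' s) -> lspan T t -> lspan T' t.
Proof. by move=> h; elim=> [s /h||a x y _ hx _ hy] //; [apply: Lspan0|apply: LspanZD]. Qed.

Lemma killed_span_mul T k v s : killed T k.+1 v -> lspan T s -> killed T k (v *m s).
Proof.
move=> hv; elim=> [t|| a x y _ hx _ hy]; first exact: hv.
  by rewrite mulmx0; apply: killed0.
by rewrite mulmxDr -scalemxAr; apply: killedZD.
Qed.

Lemma killed_span T k v : killed T k v -> killed (lspan T) k v.
Proof.
by elim: k v => //= k IH v hv s ss; apply/IH/killed_span_mul.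
Qed.

(** Flattened matrices give the span a rank, which is the measure in the maximality argument
    below. *)
Lemma lspan_mxvec l t :
  (mxvec t <= \sum_(s <- l) <<mxvec s>>)%MS -> lspan (fun s => s \in l) t.
Proof.
elim: l t => [|s l IH] t; first by rewrite big_nil submx0 mxvec_eq0 => /eqP ->; apply: Lspan0.
rewrite big_cons => /sub_addsmxP[[u1 u2] /= tE].
have /submxP[a aE]: (u1 *m <<mxvec s>> <= mxvec s)%MS.
  by rewrite (submx_trans (submxMl _ _)) // genmxE.
have -> : t = (a 0 0) *: s + vec_mx (u2 *m (\sum_(s0 <- l) <<mxvec s0>>)%MS).
  apply: (can_inj mxvecK); rewrite linearD linearZ /= vec_mxK tE aE; congr (_ + _).
  by rewrite {1}[a]mx11_scalar mul_scalar_mx.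
apply: LspanZD; first by apply: Lspan_in; rewrite inE eqxx.
have := IH (vec_mx (u2 *m (\sum_(s0 <- l) <<mxvec s0>>)%MS)).
rewrite vec_mxK submxMl => /(_ isT); elim=> [x xl||a' x y _ hx _ hy].
- by apply: Lspan_in; rewrite inE xl orbT.
- exact: Lspan0.
- exact: LspanZD.
Qed.

Section Step.
Variables (l : seq 'M[K]_n) (k0 : nat).
Hypothesis kil : forall v, killed (fun s => s \in l) k0 v.
Let T := fun s => s \in l.

Lemma killed_stable s k v : (forall t, T t -> lspan T (s *m t - t *m s)) ->
  killed T k v -> killed T k (v *m s).
Proof.
move=> hs; elim: k v => [|k IH] v hv; first by rewrite /= hv mul0mx.
move=> t Tt; have -> : v *m s *m t = v *m t *m s + v *m (s *m t - t *m s).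
  by rewrite mulmxBr !mulmxA addrC subrK.
apply: killedD; first exact/IH/hv.
exact/killed_span_mul/hs.
Qed.

(** Each layer of the flag defined by [killed] is stable under [s], and the powers of [s] refine it
    into [r] layers; hence the bound [k0 * r]. *)
Lemma killed_extend s r : s ^+ r = 0 ->
  (forall t, T t -> lspan T (s *m t - t *m s)) ->
  forall v, killed (fun x => x \in s :: l) (k0 * r) v.
Proof.
move=> sr hs v; move: (kil v); move: (k0) v.
elim=> [|k IH] v hv; first by rewrite /= in hv *.
have st i : killed T k.+1 (v *m s ^+ i).
  elim: i => [|i IHi]; first by rewrite expr0 mulmx1.
  by rewrite exprSr mulmxA; apply: killed_stable.
suff: forall m, (m <= r)%N -> killed (fun x => x \in s :: l) (m + k * r) (v *m s ^+ (r - m)).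
  by move=> /(_ r (leqnn _)); rewrite subnn expr0 mulmx1 mulSn.
elim=> [|m IHm] mr; first by rewrite subn0 sr mulmx0; apply: killed0.
rewrite addSn => t; rewrite inE => /orP[/eqP->|tl].
  have := IHm (ltnW mr); rewrite -mulmxA.
  have -> : (r - m = (r - m.+1).+1)%N by lia.
  by rewrite exprSr mulmxE.
apply: (@killed_le _ (k * r)); first by rewrite leq_addl.
exact/IH/st.
Qed.

End Step.

(* A maximal subspace spanned by elements of [S] and acting strictly
   triangularly is everything: otherwise some [s] in [S] normalizes it
   modulo itself and can be adjoined. *)
Theorem weakly_closed_nilpotent (S : 'M[K]_n -> Prop) :
  (forall s, S s -> exists k, s ^+ k = 0) ->
  (forall s t, S s -> S t -> S (s *m t - t *m s)) ->
  exists k, forall v, killed (lspan S) k v.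
Proof.
move=> Snil Scom.
pose good (l : seq 'M[K]_n) := (forall s, s \in l -> S s) /\
   exists k, forall v, killed (fun s => s \in l) k v.
suff: exists2 l, good l & forall s, S s -> lspan (fun s => s \in l) s.
  case=> l [_ [k hk]] Sl.
  by exists k => v; apply: killed_sub (killed_span (hk v)) => t; apply: lspan_trans.
pose rk l := \rank (\sum_(s <- l) <<mxvec s>> : 'M[K]_(n * n))%MS.
suff: forall d l, (n * n - rk l <= d)%N -> good l ->
   exists2 l, good l & forall s, S s -> lspan (fun s => s \in l) s.
  move=> /(_ _ [::] (leqnn _)); apply; split=> //; exists 1%N => v t; by rewrite in_nil.
elim=> [|d IH] l hd hl; case: (pselect (forall s, S s -> lspan (fun s => s \in l) s));
  try by move=> ?; exists l.
  case=> s _; apply: lspan_mxvec; apply: submx_full.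
  by rewrite /row_full eqn_leq rank_leq_col -subn_eq0 -leqn0.
have [lS [k hk]] := hl.
pose T := fun s => s \in l.
move=> /existsNP[s0 /not_implyP[Ss0 s0l]].
(* The flag has [k] levels, so every [s] satisfies [shift 0]. A commutator with an element of [T]
   that leaves the span gains one level. For [j = k + k] the whole space, which is level [k], is
   sent to 0, so the element would lie in the span; hence some element met on the way normalizes the
   span. *)
pose shift j s := forall i v, killed T i v -> killed T (i + k - j) (v *m s).
have chain j : (exists s, [/\ S s, ~ lspan T s & forall t, T t -> lspan T (s *m t - t *m s)]) \/
    exists s, [/\ S s, ~ lspan T s & shift j s].
  elim: j => [|j [?|[s [Ss sl sh]]]]; [right|by left|].
    exists s0; split=> // i v _; apply: killed_le (hk _); lia.
  case: (pselect (forall t, T t -> lspan T (s *m t - t *m s))) => [?|]; first by left; exists s.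
  move=> /existsNP[t /not_implyP[Tt st]]; right; exists (s *m t - t *m s).
  split=> //; first by apply: Scom => //; apply: lS.
  move=> i v hv; rewrite mulmxBr; apply: killedD.
    have := sh _ _ hv; case E: (i + k - j)%N => [|e].
      by move=> /= e0; rewrite mulmxA e0 mul0mx; apply: killed0.
    by move=> /(_ t Tt); rewrite mulmxA; apply: killed_le; lia.
  rewrite -scaleN1r; apply: killedZ; rewrite mulmxA.
  case: i hv => [|i] hv; first by rewrite hv !mul0mx; apply: killed0.
  by apply: killed_le (sh i _ (hv t Tt)); lia.
have [s [Ss sl hs]] : exists s, [/\ S s, ~ lspan T s & forall t, T t -> lspan T (s *m t - t *m s)].
  have [//|[s [Ss sl sh]]] := chain (k + k)%N.
  case: sl; suff -> : s = 0 by apply: Lspan0.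
  apply/row_matrixP => i; rewrite row0 rowE.
  by have /= := sh k _ (hk (delta_mx 0 i)); rewrite subnn.
have [r sr] := Snil s Ss.
apply: (IH (s :: l)); last first.
  split; first by move=> x; rewrite inE => /orP[/eqP ->|/lS].
  by exists (k * r)%N; apply: (killed_extend hk sr).
have : (rk l < rk (s :: l))%N.
  rewrite /rk big_cons ltnNge; apply/negP => hle; apply: sl; apply: lspan_mxvec.
  have /eqmxP eqm: (\sum_(s <- l) <<mxvec s>> == <<mxvec s>> + \sum_(s <- l) <<mxvec s>>)%MS.
    by rewrite -(geq_leqif (mxrank_leqif_eq _)) ?addsmxSr.
  by rewrite eqm (submx_trans _ (addsmxSl _ _)) ?genmxE.
have := rank_leq_col (\sum_(s <- s :: l) <<mxvec s>> : 'M[K]_(n * n))%MS.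
rewrite -/(rk (s :: l)); lia.
Qed.

End Jacobson.

Section ClosedField.
Variable C : closedFieldType.

Lemma nilpotent_trace0 n (M : 'M[C]_n) k : M ^+ k = 0 -> \tr M = 0.
Proof.
case: n M => [|n] M; first by move=> _; rewrite [M]flatmx0 mxtrace0.
move=> Mk; have [r cE] := closed_field_poly_normal (char_poly M).
rewrite (monicP (char_poly_monic M)) scale1r in cE.
have r0 z : z \in r -> z = 0.
  move=> zr; have : root (char_poly M) z by rewrite cE root_prod_XsubC.
  rewrite -eigenvalue_root_char => /eigenvalueP[v vM v0].
  have: v *m M ^+ k = z ^+ k *: v.
    elim: (k) => [|j IH]; first by rewrite !expr0 mulmx1 scale1r.
    by rewrite exprS -mulmxE mulmxA vM -scalemxAl IH scalerA -exprS.
  rewrite Mk mulmx0 => /esym/eqP; rewrite scaler_eq0 (negPf v0) orbF.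
  by rewrite expf_eq0 => /andP[_ /eqP].
have cX : char_poly M = 'X^(size r).
  rewrite cE big_seq (eq_bigr (fun _ => 'X)) -?big_seq.
    by rewrite big_const_seq count_predT iter_mulr_1.
  by move=> z /r0 ->; rewrite subr0.
have sr : size r = n.+1.
  by have := size_char_poly M; rewrite cX size_polyXn => -[].
have := @char_poly_trace _ _ M isT; rewrite cX coefXn sr /= (ltn_eqF (ltnSn n)).
by move=> /esym/eqP; rewrite oppr_eq0 => /eqP.
Qed.

End ClosedField.

Section NilCommutator.
Variables (K : fieldType) (n : nat).
Implicit Types T Z E : 'M[K]_n.

Definition mxcomm T Z := T *m Z - Z *m T.

Lemma mxcommBl T Z c : mxcomm (T - c%:M) Z = mxcomm T Z.
Proof.
by rewrite /mxcomm mulmxBl mulmxBr mul_scalar_mx mul_mx_scalar opprB addrA subrK.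
Qed.

Lemma iter_mxcommBl T Z c k : iter k (mxcomm (T - c%:M)) Z = iter k (mxcomm T) Z.
Proof. by elim: k => //= k ->; rewrite mxcommBl. Qed.

(** Each factor [T] on the right of [Z] either passes to its left or is absorbed in a bracket. With
    at least [m + k - 1] factors in all, either [m] of them reach [E] or [k] of them are
    absorbed. *)
Lemma mul_nilcomm_r E T Z m k i j : E *m T ^+ m = 0 -> iter k (mxcomm T) Z = 0 ->
  (m + k <= i + j + 1)%N -> E *m T ^+ i *m Z *m T ^+ j = 0.
Proof.
move=> Em; elim: k Z i j => [|k IHk] Z i j; first by move=> /= ->; rewrite mulmx0 mul0mx.
elim: j i => [|j IHj] i hZ hij.
  have -> : i = (m + (i - m))%N by lia.
  by rewrite exprD -mulmxE mulmxA Em !mul0mx.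
have -> : E *m T ^+ i *m Z *m T ^+ j.+1 =
    E *m T ^+ i.+1 *m Z *m T ^+ j - E *m T ^+ i *m mxcomm T Z *m T ^+ j.
  rewrite /mxcomm mulmxBr mulmxBl (exprS _ j) (exprSr _ i) -!mulmxE !mulmxA.
  by rewrite opprB addrC addrNK.
rewrite IHj ?IHk ?subrr //; try lia; by rewrite -iterSr.
Qed.

Lemma mul_nilcomm_l E T Z m k i j : T ^+ m *m E = 0 -> iter k (mxcomm T) Z = 0 ->
  (m + k <= i + j + 1)%N -> T ^+ j *m Z *m T ^+ i *m E = 0.
Proof.
move=> Em; elim: k Z i j => [|k IHk] Z i j; first by move=> /= ->; rewrite mulmx0 !mul0mx.
elim: j i => [|j IHj] i hZ hij.
  have -> : i = ((i - m) + m)%N by lia.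
  by rewrite exprD -mulmxE -!mulmxA Em !mulmx0.
have -> : T ^+ j.+1 *m Z *m T ^+ i *m E =
    T ^+ j *m Z *m T ^+ i.+1 *m E + T ^+ j *m mxcomm T Z *m T ^+ i *m E.
  rewrite /mxcomm mulmxBr !mulmxBl (exprSr _ j) (exprS _ i) -!mulmxE !mulmxA.
  by rewrite addrC subrK.
rewrite IHj ?IHk ?addr0 //; try lia; by rewrite -iterSr.
Qed.

End NilCommutator.

(** * Weights of a nilpotent Lie algebra of matrices *)

Section Primary.
Variables (K : fieldType) (n' : nat).
Local Notation n := n'.+1.

(* The projection onto the generalized eigenspace is a polynomial in the
   matrix, by Bezout and Cayley-Hamilton. *)
Lemma primary_idempotent (M : 'M[K]_n) c : exists p,
  let E := horner_mx M p in exists m,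
  [/\ E *m E = E, E *m (M - c%:M) ^+ m = 0,
      exists u, 1%:M - E = horner_mx M u *m (M - c%:M) ^+ m.+1,
      forall v : 'rV_n, v *m (M - c%:M) = 0 -> v *m E = v &
      forall Z k, iter k (mxcomm M) Z = 0 -> E *m Z = Z *m E].
Proof.
have [m [q qc cE]] := multiplicity_XsubC (char_poly M) c.
have cp0 : char_poly M != 0 by rewrite monic_neq0 // char_poly_monic.
rewrite cp0 /= in qc.
(* The exponent is [m.+1], not [m], so that [1%:M - E] has a factor [M - c%:M] and kills
   eigenvectors even when [m] is 0. *)
have cop : coprimep (('X - c%:P) ^+ m.+1) q.
  by rewrite coprimep_pexpl // coprimep_sym coprimep_XsubC.
have [[u v] /= uv] := Bezout_eq1_coprimepP _ _ cop.
have TE j : horner_mx M (('X - c%:P) ^+ j) = (M - c%:M) ^+ j.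
  by rewrite rmorphXn rmorphB /= horner_mx_X horner_mx_C.
exists (v * q); set E := horner_mx M _; rewrite /=; exists m.
have E1 : 1%:M - E = horner_mx M u *m (M - c%:M) ^+ m.+1.
  have <- : horner_mx M (u * ('X - c%:P) ^+ m.+1 + v * q) = 1%:M by rewrite uv rmorph1.
  by rewrite rmorphD /= addrK rmorphM /= TE mulmxE.
have Em : E *m (M - c%:M) ^+ m = 0.
  by rewrite -TE mulmxE /E -rmorphM -mulrA -cE rmorphM /= Cayley_Hamilton mulr0.
have Hcom p j : (M - c%:M) ^+ j *m horner_mx M p = horner_mx M p *m (M - c%:M) ^+ j.
  by rewrite -TE !mulmxE -!rmorphM mulrC.
have Ecom j : E *m (M - c%:M) ^+ j = (M - c%:M) ^+ j *m E.
  by rewrite -TE !mulmxE -!rmorphM mulrC.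
have EE1 : E *m (1%:M - E) = 0.
  by rewrite E1 -Hcom exprSr -mulmxE !mulmxA Em !mul0mx.
have E1E : (1%:M - E) *m E = 0 by rewrite mulmxBl mul1mx -[X in X - _](mulmx1 E) -mulmxBr.
have EE : E *m E = E.
  by apply/eqP; rewrite -subr_eq0 -oppr_eq0 opprB -[X in X - _](mulmx1 E) -mulmxBr EE1.
split=> //; first by exists u.
  move=> w wT; apply/eqP; rewrite -subr_eq0 -oppr_eq0 opprB.
  by rewrite -[X in X - _](mulmx1 w) -mulmxBr E1 -Hcom exprS -!mulmxE !mulmxA wT !mul0mx.
move=> Z k Zk.
have Zk' : iter k (mxcomm (M - c%:M)) Z = 0 by rewrite iter_mxcommBl.
(* Being idempotent, [1%:M - E] is divisible by arbitrarily high powers of [M - c%:M]; this makes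
   both off-diagonal blocks of [Z] vanish. *)
have E1j j : 1%:M - E = horner_mx M (u ^+ j.+1) *m (M - c%:M) ^+ (m.+1 * j.+1).
  elim: j => [|j IH]; first by rewrite muln1 expr1.
  have {1}-> : 1%:M - E = (1%:M - E) *m (1%:M - E) by rewrite mulmxBl EE1 subr0 mul1mx.
  rewrite {1}IH E1 -!TE !mulmxE -!rmorphM /=; congr (horner_mx M _).
  by rewrite [(m.+1 * j.+2)%N]mulnS exprD [u ^+ j.+2]exprS mulrACA [X in _ * X]mulrC [X in X * _]mulrC.
have h1 : E *m Z *m (1%:M - E) = 0.
  rewrite (E1j k) -Hcom mulmxA.
  have := @mul_nilcomm_r _ _ E _ Z m k 0 (m.+1 * k.+1) Em Zk'.
  rewrite expr0 mulmx1 => ->; first by rewrite mul0mx.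
  rewrite add0n; nia.
have h2 : (1%:M - E) *m Z *m E = 0.
  rewrite (E1j k) -!mulmxA.
  have := @mul_nilcomm_l _ _ E _ Z m k 0 (m.+1 * k.+1) _ Zk'.
  rewrite expr0 mulmx1 -!mulmxA => ->; first by rewrite mulmx0.
    by rewrite -Ecom.
  rewrite add0n; nia.
rewrite mulmxBr mulmx1 in h1; rewrite !mulmxBl mul1mx in h2.
by rewrite (subr0_eq h1) (subr0_eq h2).
Qed.

Lemma idempotent_trace (Q : 'M[K]_n) : Q *m Q = Q -> \tr Q = (\rank Q)%:R.
Proof.
move=> QQ; rewrite -{1}(mulmx_base Q) mxtrace_mulC.
suff -> : row_base Q *m col_base Q = 1%:M by rewrite mxtrace1.
apply: (row_full_inj (col_base_full Q)); apply: (row_free_inj (row_base_free Q)).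
by rewrite mulmx1 mulmx_base mulmxA -mulmxA !mulmx_base.
Qed.

End Primary.

Section Weights.
Variables (C : numClosedFieldType) (d n' : nat).
Local Notation n := n'.+1.
Variable (M : 'rV[C]_d -> 'M[C]_n).
Hypothesis M_lin : forall k a b, M (k *: a + b) = k *: M a + M b.
Hypothesis M_nil : forall a b, exists k, iter k (mxcomm (M a)) (M b) = 0.

Definition stable (A : 'M[C]_n) := forall a, (A *m M a <= A)%MS.

(** What is retained of being a polynomial expression in the operators [M a]. Both properties pass
    to sums, products and complements. *)
Definition tame (Q : 'M[C]_n) :=
  (forall a, Q *m M a = M a *m Q) /\ (forall A, stable A -> (A *m Q <= A)%MS).

Definition wval (w : 'cV[C]_d) (a : 'rV[C]_d) : C := (a *m w) 0 0.

Definition has_weight (w : 'cV[C]_d) (m : nat) (Q : 'M[C]_(m, n)) :=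
  forall a, exists k, Q *m (M a - (wval w a)%:M) ^+ k = 0.

Lemma M0 : M 0 = 0.
Proof. by have := M_lin 1 0 0; rewrite scaler0 scale1r addr0 => /eqP; rewrite -subr_eq subrr => /eqP. Qed.

Lemma M_sum (I : Type) (r : seq I) (P : pred I) (k : I -> C) (a : I -> 'rV[C]_d) :
  M (\sum_(i <- r | P i) k i *: a i) = \sum_(i <- r | P i) k i *: M (a i).
Proof.
elim: r => [|i r IH]; first by rewrite !big_nil M0.
by rewrite !big_cons; case: (P i) => //; rewrite M_lin IH.
Qed.

Lemma tameM Q Q' : tame Q -> tame Q' -> tame (Q *m Q').
Proof.
move=> [c1 s1] [c2 s2]; split=> [a|A Ast]; first by rewrite -mulmxA c2 !mulmxA c1.
by rewrite mulmxA (submx_trans (submxMr _ (s1 _ Ast))) // s2.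
Qed.

Lemma tameD Q Q' : tame Q -> tame Q' -> tame (Q + Q').
Proof.
move=> [c1 s1] [c2 s2]; split=> [a|A Ast]; first by rewrite mulmxDl mulmxDr c1 c2.
by rewrite mulmxDr addmx_sub ?s1 ?s2.
Qed.

Lemma tame0 : tame 0.
Proof. by split=> [a|A _]; rewrite ?mulmx0 ?mul0mx ?sub0mx. Qed.

Lemma tame_sum (I : Type) (r : seq I) (P : pred I) (F : I -> 'M[C]_n) :
  (forall i, P i -> tame (F i)) -> tame (\sum_(i <- r | P i) F i).
Proof. by move=> h; elim/big_ind: _ => //; [apply: tame0|apply: tameD]. Qed.

Lemma tame1 : tame 1%:M.
Proof. by split=> [a|A _]; rewrite ?mulmx1 ?mul1mx. Qed.

Lemma tameB1 Q : tame Q -> tame (1%:M - Q).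
Proof.
move=> [c1 s1]; split=> [a|A Ast]; first by rewrite mulmxBl mulmxBr mulmx1 mul1mx c1.
by rewrite mulmxBr mulmx1 addmx_sub ?eqmx_opp ?s1.
Qed.

Lemma tame_horner a p (E := horner_mx (M a) p) :
  (forall Z k, iter k (mxcomm (M a)) Z = 0 -> E *m Z = Z *m E) -> tame E.
Proof.
move=> h; split=> [b|A Ast]; first by have [k hk] := M_nil a b; apply: h hk.
exact: horner_mx_stable.
Qed.

Lemma eigenvector_in a (Q : 'M[C]_n) : Q != 0 -> Q *m M a = M a *m Q ->
  exists c (v : 'rV_n), [/\ v != 0, (v <= Q)%MS & v *m (M a - c%:M) = 0].
Proof.
move=> Q0 QM.
have [r cE] := closed_field_poly_normal (char_poly (M a)).
rewrite (monicP (char_poly_monic _)) scale1r in cE.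
have [v v0 vQ] : exists2 v : 'rV_n, v != 0 & (v <= Q)%MS.
  by have := nz_row_sub Q; exists (nz_row Q); rewrite ?nz_row_eq0.
have : v *m horner_mx (M a) (\prod_(z <- r) ('X - z%:P)) = 0.
  by rewrite -cE Cayley_Hamilton mulmx0.
elim: r {cE} v v0 vQ => [|z r IH] v v0 vQ.
  by rewrite big_nil rmorph1 mulmx1 => v00; rewrite v00 eqxx in v0.
rewrite big_cons rmorphM rmorphB /= horner_mx_X horner_mx_C -mulmxE mulmxA.
have [vz _|vz] := eqVneq (v *m (M a - z%:M)) 0; first by exists z, v.
apply: IH => //.
rewrite mulmxBr addmx_sub ?eqmx_opp ?mul_mx_scalar ?scalemx_sub //.
by rewrite (submx_trans (submxMr _ vQ)) // QM submxMl.
Qed.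

Lemma trace_weight (Q : 'M[C]_n) a c k : Q *m Q = Q -> Q *m M a = M a *m Q ->
  Q *m (M a - c%:M) ^+ k = 0 -> \tr (Q *m M a) = c * \tr Q.
Proof.
move=> QQ QM hk; apply/eqP; rewrite -subr_eq0 -mxtraceZ -linearB /=.
have -> : Q *m M a - c *: Q = Q *m (M a - c%:M) by rewrite mulmxBr mul_mx_scalar.
apply/eqP; apply: (@nilpotent_trace0 _ _ _ k.+1).
have QT : Q *m (M a - c%:M) = (M a - c%:M) *m Q by rewrite mulmxBr mulmxBl QM scalar_mxC.
rewrite !mulmxE exprMn_comm; last exact: QT.
have -> : Q ^+ k.+1 = Q by elim: k {hk} => [|k IH]; rewrite ?expr1 // exprS IH -mulmxE QQ.
by rewrite exprSr mulrA -!mulmxE hk mul0mx.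
Qed.

(** While some [M a] has several eigenvalues on the image of [Q], a primary idempotent cuts [Q] into
    two pieces of smaller rank. Once every [M a] has a single eigenvalue there, that eigenvalue is
    the normalized trace of [Q *m M a], hence linear in [a]: a weight. *)
Lemma weight_split (Q : 'M[C]_n) : Q *m Q = Q -> tame Q ->
  exists s : seq ('cV[C]_d * 'M[C]_n),
    (forall x, x \in s -> tame x.2 /\ has_weight x.1 x.2) /\ \sum_(x <- s) x.2 = Q.
Proof.
have [k] := ubnP (\rank Q); elim: k Q => // k IH Q rQ QQ tQ.
have [->|Q0] := eqVneq Q 0; first by exists [::]; rewrite big_nil.
have [h|h] := pselect (forall a, exists c m, Q *m (M a - c%:M) ^+ m = 0).
  exists [:: (\col_i (\tr (Q *m M (delta_mx 0 i)) / \tr Q), Q)].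
  rewrite big_seq1; split=> // x; rewrite inE => /eqP -> /=; split=> // a.
  have [c [m cm]] := h a; exists m; suff -> : wval (\col_i (\tr (Q *m M (delta_mx 0 i)) / \tr Q)) a = c by [].
  have trQ : \tr Q != 0 by rewrite idempotent_trace // pnatr_eq0 mxrank_eq0.
  apply: (mulIf trQ); rewrite -(trace_weight QQ (tQ.1 a) cm).
  rewrite /wval mxE mulr_suml [in RHS](row_sum_delta a) M_sum mulmx_sumr linear_sum /=.
  by apply: eq_bigr => i _; rewrite mxE -scalemxAr mxtraceZ -mulrA divfK.
move/existsNP: h => [a h].
have [c [v [v0 vQ vc]]] := eigenvector_in Q0 (tQ.1 a).
have [p [m]] := primary_idempotent (M a) c; set E := horner_mx _ _.
move=> [EE Em [u E1] Ev Ecom].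
have tE : tame E by apply: tame_horner.
have QE : Q *m E = E *m Q by apply: comm_mx_horner; apply: tQ.1.
have QE0 : Q *m E != Q.
  apply/eqP => QEQ; apply: h; exists c, m.
  by rewrite -QEQ -mulmxA Em mulmx0.
have QE1 : Q *m (1%:M - E) != Q.
  rewrite mulmxBr mulmx1 -subr_eq0 addrAC subrr add0r oppr_eq0; apply: contraNneq v0 => QE2.
  have /submxP[x xE] := vQ.
  by rewrite -(Ev _ vc) xE -mulmxA QE2 mulmx0.
have sub F : F *m F = F -> Q *m F = F *m Q -> Q *m F != Q -> (\rank (Q *m F) < k)%N.
  move=> FF QF QF0; apply: leq_trans (_ : \rank Q <= k)%N => //.
  have QFQ : (Q *m F <= Q)%MS by rewrite QF submxMl.
  rewrite ltn_neqAle mxrankS // andbT; apply: contraNneq QF0 => rE.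
  have /submxP[x xE]: (Q <= Q *m F)%MS by rewrite -(geq_leqif (mxrank_leqif_sup QFQ)) rE.
  by rewrite {1}xE -!mulmxA FF -xE.
have EE1 : (1%:M - E) *m (1%:M - E) = 1%:M - E.
  by rewrite mulmxBl mul1mx mulmxBr mulmx1 EE subrr subr0.
have QE1c : Q *m (1%:M - E) = (1%:M - E) *m Q by rewrite mulmxBr mulmxBl mulmx1 mul1mx QE.
have idem F : F *m F = F -> Q *m F = F *m Q -> Q *m F *m (Q *m F) = Q *m F.
  by move=> FF QF; rewrite -mulmxA (mulmxA F) -QF -!mulmxA FF mulmxA QQ.
have [s1 [h1 e1]] := IH _ (sub _ EE QE QE0) (idem _ EE QE) (tameM tQ tE).
have [s2 [h2 e2]] := IH _ (sub _ EE1 QE1c QE1) (idem _ EE1 QE1c) (tameM tQ (tameB1 tE)).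
exists (s1 ++ s2); rewrite big_cat /= e1 e2 -mulmxDr addrC subrK mulmx1; split=> // x.
by rewrite mem_cat => /orP[/h1|/h2].
Qed.

Lemma has_weight_mull m m' w (A : 'M[C]_(m', m)) (Q : 'M[C]_(m, n)) :
  has_weight w Q -> has_weight w (A *m Q).
Proof. by move=> h a; have [k hk] := h a; exists k; rewrite -mulmxA hk mulmx0. Qed.

Lemma has_weight_mulr m w (A : 'M[C]_(m, n)) (Q : 'M[C]_n) :
  (forall a, Q *m M a = M a *m Q) -> has_weight w A -> has_weight w (A *m Q).
Proof.
move=> QM h a; have [k hk] := h a; exists k.
suff -> : A *m Q *m (M a - (wval w a)%:M) ^+ k = A *m (M a - (wval w a)%:M) ^+ k *m Q.
  by rewrite hk mul0mx.
rewrite -!mulmxA; congr (_ *m _); rewrite !mulmxE; apply/commrX.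
by rewrite /GRing.comm -!mulmxE mulmxBr mulmxBl QM scalar_mxC.
Qed.

Lemma has_weight0 m w : has_weight w (0 : 'M[C]_(m, n)).
Proof. by move=> a; exists 0%N; rewrite mul0mx. Qed.

Lemma has_weightD m w (A B : 'M[C]_(m, n)) :
  has_weight w A -> has_weight w B -> has_weight w (A + B).
Proof.
move=> hA hB a; have [k hk] := hA a; have [l hl] := hB a; exists (k + l)%N.
rewrite mulmxDl exprD -mulmxE mulmxA hk mul0mx add0r.
by rewrite !mulmxE -exprD addnC exprD -!mulmxE mulmxA hl mul0mx.
Qed.

Lemma has_weight_uniq m w w' (A : 'M[C]_(m, n)) :
  has_weight w A -> has_weight w' A -> w != w' -> A = 0.
Proof.
move=> hw hw' ww'.
have [i wi] : exists i, w i 0 != w' i 0.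
  apply/existsP; rewrite -negb_forall; apply: contraNN ww' => /forallP h.
  by apply/eqP/matrixP => i j; rewrite ord1; apply/eqP.
have [k hk] := hw (delta_mx 0 i); have [l hl] := hw' (delta_mx 0 i).
move: hk hl; rewrite /wval -!rowE !mxE; move: (M _) => T.
elim: k A {hw hw'} => [|k IH] A; first by rewrite mulmx1.
rewrite exprS -mulmxE mulmxA => hk hl.
have AT : A *m (T - (w i 0)%:M) = 0.
  apply: IH => //; rewrite -mulmxA mulmxE; have cT a b : GRing.comm (T - a%:M) (T - b%:M).
    have TC x : GRing.comm T x%:M by rewrite /GRing.comm -!mulmxE scalar_mxC.
    apply: commr_sym; apply: commrB; first by apply/commr_sym/commrB.
    apply: commr_sym; apply: commrB; first exact/commr_sym.
    by rewrite /GRing.comm -!mulmxE scalar_mxC.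
  by rewrite (commrX _ (cT _ _)) -mulmxE mulmxA hl mul0mx.
have AT' : A *m (T - (w' i 0)%:M) = (w i 0 - w' i 0) *: A.
  move: AT; rewrite !mulmxBr => /subr0_eq ->.
  by rewrite !mul_mx_scalar scalerBl.
move: hl; have -> : A *m (T - (w' i 0)%:M) ^+ l = (w i 0 - w' i 0) ^+ l *: A.
  elim: (l) => [|j IHj]; first by rewrite !expr0 mulmx1 scale1r.
  by rewrite exprSr -mulmxE mulmxA IHj -scalemxAl AT' scalerA exprSr.
move/eqP; rewrite scaler_eq0 expf_eq0 subr_eq0 (negPf wi) andbF /=; by move/eqP.
Qed.

Record weight_decomposition (ws : seq 'cV[C]_d) (P : 'cV[C]_d -> 'M[C]_n) : Prop := {
  wd_uniq : uniq ws;
  wd_mem : forall w, (w \in ws) = (P w != 0);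
  wd_sum : \sum_(w <- ws) P w = 1%:M;
  wd_tame : forall w, tame (P w);
  wd_orth : forall w w', w != w' -> P w *m P w' = 0;
  wd_idem : forall w, P w *m P w = P w;
  wd_char : forall m (A : 'M[C]_(m, n)) w, has_weight w A <-> A *m P w = A }.

Theorem weight_decomposition_exists : exists ws P, weight_decomposition ws P.
Proof.
have [s [hs sE]] := weight_split (mulmx1 1%:M) tame1.
pose P w : 'M[C]_n := \sum_(x <- s | x.1 == w) x.2.
pose l := undup [seq x.1 | x <- s].
have Pt w : tame (P w).
  by rewrite /P big_seq_cond; apply: tame_sum => x /andP[/hs[]].
have Pw w : has_weight w (P w).
  rewrite /P big_seq_cond; elim/big_ind: _.
  - exact: has_weight0.
  - by move=> A B; apply: has_weightD.
  - by move=> x /andP[/hs[_ hx] /eqP <-].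
have lE : \sum_(w <- l) P w = 1%:M.
  rewrite -sE /P (exchange_big_dep xpredT) //=; apply: eq_big_seq => x xs.
  rewrite -big_filter (eq_filter (a2 := pred1 x.1)); last by move=> w /=; rewrite eq_sym.
  by rewrite filter_pred1_uniq ?undup_uniq ?mem_undup ?map_f // big_seq1.
have orth w w' : w != w' -> P w *m P w' = 0.
  move=> ww'; apply: (@has_weight_uniq _ w w') => //; last exact: has_weight_mull.
  by apply: has_weight_mulr => //; have [] := Pt w'.
have Plout w : w \notin l -> P w = 0.
  rewrite mem_undup => wl; rewrite /P big_seq_cond big1 // => x /andP[xs /eqP xw].
  by rewrite -xw map_f in wl.
have chr m (A : 'M[C]_(m, n)) w : has_weight w A <-> A *m P w = A.
  split=> [hA|<-]; last exact: has_weight_mull.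
  rewrite -[RHS]mulmx1 -lE [RHS]mulmx_sumr.
  have Aw w' : w' != w -> A *m P w' = 0.
    move=> ww'; apply: (@has_weight_uniq _ w' w) => //; first exact: has_weight_mull.
    by apply: has_weight_mulr => //; have [] := Pt w'.
  have [wl|wl] := boolP (w \in l).
    by rewrite (bigD1_seq w) ?undup_uniq //= big1 ?addr0 // => w' /Aw.
  rewrite Plout // mulmx0 big1_seq // => w' /andP[_ w'l]; apply: Aw.
  by apply: contraNneq wl => <-.
exists [seq w <- l | P w != 0], P; split=> //.
- by rewrite filter_uniq ?undup_uniq.
- move=> w; rewrite mem_filter; case: eqP => //= Pw0; rewrite -[w \in l]negbK.
  by apply/negP => /Plout.
- rewrite big_filter -[RHS]lE [RHS](bigID (fun w => P w != 0)) /= [X in _ + X]big1 ?addr0 //.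
  by move=> w; rewrite negbK => /eqP.
- by move=> w; apply/chr.
Qed.

End Weights.

(** * Cartan subalgebra and Killing form *)

Section LieBasics.
Variables (F : fieldType) (N : nat) (c : struct_const F N).
Implicit Types (x y z v : 'rV[F]_N) (A B D : 'M[F]_N).
Local Notation "[ x , y ]" := (lbr c x y).

Lemma mul_ad v x : v *m ad c x = [x, v].
Proof.
apply/rowP => j; rewrite mxE /lbr [in RHS]exchange_big /= summxE; apply: eq_bigr => i _.
rewrite mxE /lbr !summxE mulr_sumr; apply: eq_bigr => k _.
rewrite summxE (bigD1 i) //= big1 ?addr0 => [|l li]; last by rewrite !mxE (negPf li) andbF mulr0 mul0r.
by rewrite !mxE !eqxx mulr1 mulrCA mulrA.
Qed.

Lemma lbr_linr x k y z : [x, k *: y + z] = k *: [x, y] + [x, z].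
Proof. by rewrite -!mul_ad mulmxDl -scalemxAl. Qed.

Lemma lbr_linl x k y z : [k *: y + z, x] = k *: [y, x] + [z, x].
Proof.
rewrite /lbr scaler_sumr -big_split; apply: eq_bigr => i _ /=.
rewrite scaler_sumr -big_split; apply: eq_bigr => j _ /=.
by rewrite !mxE mulrDl scalerDl -mulrA scalerA.
Qed.

Lemma lbrDr x y z : [x, y + z] = [x, y] + [x, z].
Proof. by rewrite -[y]scale1r lbr_linr !scale1r. Qed.

Lemma lbrDl x y z : [y + z, x] = [y, x] + [z, x].
Proof. by rewrite -[y]scale1r lbr_linl !scale1r. Qed.

Lemma lbr0r x : [x, 0] = 0.
Proof. by rewrite -mul_ad mul0mx. Qed.

Lemma lbr0l x : [0, x] = 0.
Proof. by apply: (@addrI _ [0, x]); rewrite -lbrDl !addr0. Qed.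

Lemma lbrZr x k y : [x, k *: y] = k *: [x, y].
Proof. by rewrite -[k *: y]addr0 lbr_linr lbr0r addr0. Qed.

Lemma lbrZl x k y : [k *: y, x] = k *: [y, x].
Proof. by rewrite -[k *: y]addr0 lbr_linl lbr0l addr0. Qed.

Lemma lbrNr x y : [x, - y] = - [x, y].
Proof. by rewrite -scaleN1r lbrZr scaleN1r. Qed.

Lemma lbrNl x y : [- y, x] = - [y, x].
Proof. by rewrite -scaleN1r lbrZl scaleN1r. Qed.

Lemma lbr_sumr (I : Type) (r : seq I) (Q : pred I) (f : I -> 'rV_N) x :
  [x, \sum_(i <- r | Q i) f i] = \sum_(i <- r | Q i) [x, f i].
Proof. by apply: (big_morph _ (lbrDr x) (lbr0r x)). Qed.

Lemma lbr_suml (I : Type) (r : seq I) (Q : pred I) (f : I -> 'rV_N) x :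
  [\sum_(i <- r | Q i) f i, x] = \sum_(i <- r | Q i) [f i, x].
Proof. by apply: (big_morph (fun y => [y, x]) (lbrDl x) (lbr0l x)). Qed.

Lemma ad_lin k x y : ad c (k *: x + y) = k *: ad c x + ad c y.
Proof.
by apply/row_matrixP => i; rewrite !rowE mulmxDr -scalemxAr !mul_ad lbr_linl.
Qed.

Lemma mem_brmx A B x y : (x <= A)%MS -> (y <= B)%MS -> ([x, y] <= brmx c A B)%MS.
Proof.
move=> /submxP[a ->] /submxP[b ->]; rewrite !mulmx_sum_row lbr_suml summx_sub // => i _.
rewrite lbrZl scalemx_sub // lbr_sumr summx_sub // => j _.
rewrite lbrZr scalemx_sub // /brmx (sumsmx_sup i) // (sumsmx_sup j) //.
by rewrite genmxE.
Qed.

Lemma brmx_ind A B (Q : 'rV[F]_N -> Prop) :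
  Q 0 -> (forall k x y, Q x -> Q y -> Q (k *: x + y)) ->
  (forall x y, (x <= A)%MS -> (y <= B)%MS -> Q [x, y]) ->
  forall v, (v <= brmx c A B)%MS -> Q v.
Proof.
move=> Q0 QD Qb v.
have Qsum (I : Type) (r : seq I) (f : I -> 'rV_N) : (forall i, Q (f i)) -> Q (\sum_(i <- r) f i).
  move=> h; elim/big_ind: _ => //.
  by move=> x y Qx Qy; rewrite -[x]scale1r; apply: QD.
move=> /sub_sumsmxP[u ->]; apply: (Qsum _ _ _) => i.
have /sub_sumsmxP[w ->] := submxMl (u i) (\sum_(j < N) <<[row i A, row j B]>>)%MS.
apply: (Qsum _ _ _) => j; have: (w j *m <<[row i A, row j B]>> <= [row i A, row j B])%MS.
  by rewrite (submx_trans (submxMl _ _)) // genmxE.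
move=> /submxP[a ->]; rewrite [a]mx11_scalar mul_scalar_mx -[_ *: _]addr0.
by apply: QD => //; apply: Qb; apply: row_sub.
Qed.

Lemma brmx_sub A B m (D : 'M_(m, N)) :
  (forall x y, (x <= A)%MS -> (y <= B)%MS -> ([x, y] <= D)%MS) -> (brmx c A B <= D)%MS.
Proof.
move=> h; apply/row_subP => i; apply: (@brmx_ind A B (fun v => v <= D)%MS _ _ h _ (row_sub _ _)).
  exact: sub0mx.
by move=> k x y hx hy; rewrite addmx_sub ?scalemx_sub.
Qed.

Definition killing x y := \tr (ad c x *m ad c y).

Lemma killingC x y : killing x y = killing y x.
Proof. exact: mxtrace_mulC. Qed.

Lemma killing_linl k x y z : killing (k *: x + y) z = k * killing x z + killing y z.
Proof. by rewrite /killing ad_lin mulmxDl -scalemxAl mxtraceD mxtraceZ. Qed.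

Lemma killing0l z : killing 0 z = 0.
Proof.
have := killing_linl 1 0 0 z; rewrite scaler0 addr0 mul1r => /eqP.
by rewrite -subr_eq subrr => /eqP.
Qed.

Lemma killing0r z : killing z 0 = 0.
Proof. by rewrite killingC killing0l. Qed.

Lemma killingDl x y z : killing (x + y) z = killing x z + killing y z.
Proof. by rewrite -[x]scale1r killing_linl scale1r mul1r. Qed.

Lemma killingZl k x z : killing (k *: x) z = k * killing x z.
Proof. by rewrite -[k *: x]addr0 killing_linl killing0l addr0. Qed.

Lemma killingDr x y z : killing z (x + y) = killing z x + killing z y.
Proof. by rewrite killingC killingDl !(killingC z). Qed.

Lemma killingZr k x z : killing z (k *: x) = k * killing z x.
Proof. by rewrite killingC killingZl (killingC z). Qed.

Lemma killing_suml (I : Type) (r : seq I) (Q : pred I) (f : I -> 'rV_N) z :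
  killing (\sum_(i <- r | Q i) f i) z = \sum_(i <- r | Q i) killing (f i) z.
Proof. by apply: (big_morph (fun y => killing y z) (fun x y => killingDl x y z) (killing0l z)). Qed.

Lemma killing_sumr (I : Type) (r : seq I) (Q : pred I) (f : I -> 'rV_N) z :
  killing z (\sum_(i <- r | Q i) f i) = \sum_(i <- r | Q i) killing z (f i).
Proof. by rewrite killingC killing_suml; apply: eq_bigr => i _; rewrite killingC. Qed.

Hypothesis lie : is_lie_algebra c.

Lemma lbrxx x : [x, x] = 0.
Proof. by case: lie. Qed.

Lemma lbrC x y : [x, y] = - [y, x].
Proof.
have := lbrxx (x + y); rewrite lbrDl !lbrDr !lbrxx addr0 add0r => /eqP.
by rewrite addr_eq0 => /eqP.
Qed.

Lemma lbr_jacobi x y z : [x, [y, z]] = [[x, y], z] + [y, [x, z]].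
Proof.
have := lie.2 x y z; rewrite [ [z, [x, y]] ]lbrC [ [z, x] ]lbrC lbrNr => /eqP.
by rewrite subr_eq0 subr_eq addrC eq_sym => /eqP <-; rewrite addrC.
Qed.

Lemma ad_lbr x y : ad c [x, y] = mxcomm (ad c y) (ad c x).
Proof.
apply/row_matrixP => i; rewrite !rowE mulmxBr !mulmxA !mul_ad.
by rewrite (lbr_jacobi x) addrK.
Qed.

Lemma killing_inv x y z : killing [x, y] z = killing x [y, z].
Proof.
rewrite /killing !ad_lbr /mxcomm mulmxBl mulmxBr !linearB /= -[ad c y *m _ *m _]mulmxA.
by rewrite [X in X - _]mxtrace_mulC -!mulmxA.
Qed.

Lemma iter_mxcomm_ad k x y :
  iter k (mxcomm (ad c x)) (ad c y) = (-1) ^+ k *: ad c (iter k (fun v => [x, v]) y).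
Proof.
elim: k => [|k IH]; first by rewrite scale1r.
rewrite !iterS IH [in RHS]lbrC exprS -scalerA -[- [_, _]]addr0 -scaleN1r ad_lin.
have -> : ad c 0 = 0 by apply/row_matrixP => i; rewrite !rowE mul_ad lbr0l mulmx0.
rewrite addr0 ad_lbr !scalerA /mxcomm mulN1r mulrN1 opprK -scalemxAl -scalemxAr scalerBr.
by [].
Qed.

Lemma iter_lower_central A k x y : (x <= A)%MS -> (y <= A)%MS ->
  (iter k (fun v => [x, v]) y <= lower_central c A k)%MS.
Proof. by move=> xA yA; elim: k => //= k IH; apply: mem_brmx. Qed.

End LieBasics.

Section Grading.
Variables (C : numClosedFieldType) (n' : nat).
Local Notation N := n'.+1.
Variable c : struct_const C N.
Implicit Types (x y z : 'rV[C]_N) (A B D : 'M[C]_N) (u v w : 'cV[C]_N).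
Local Notation "[ x , y ]" := (lbr c x y).

(** Parametrizing [h] by all row vectors makes a weight a plain column instead of a form on the row
    space of [h]. The parametrization need not be injective. *)
Definition adh (h : 'M[C]_N) (a : 'rV[C]_N) := ad c (a *m h).

Lemma adh_lin h k a b : adh h (k *: a + b) = k *: adh h a + adh h b.
Proof. by rewrite /adh mulmxDl -scalemxAl ad_lin. Qed.

Lemma adh_nil h : is_lie_algebra c -> nilpotent_alg c h ->
  forall a b, exists k, iter k (mxcomm (adh h a)) (adh h b) = 0.
Proof.
move=> lie [k hk] a b; exists k; rewrite iter_mxcomm_ad //.
have /submx_trans/(_ hk) := iter_lower_central c k (submxMl a h) (submxMl b h).
rewrite submx0 => /eqP ->; rewrite -[X in ad c X](scale0r 0).
have -> : ad c (0 *: 0) = 0 by apply/row_matrixP => i; rewrite !rowE mul_ad scale0r lbr0l mulmx0.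
by rewrite scaler0.
Qed.

Record cartan_setting (h : 'M[C]_N) (ws : seq 'cV[C]_N) (P : 'cV[C]_N -> 'M[C]_N) : Prop := {
  cs_lie : is_lie_algebra c;
  cs_nil : nilpotent_alg c h;
  cs_sub : subalg c h;
  cs_norm : forall x, (brmx c <<x>>%MS h <= h)%MS -> (x <= h)%MS;
  cs_wd : weight_decomposition (adh h) ws P }.

Lemma cartan_setting_exists h : is_lie_algebra c -> cartan_subalg c h ->
  exists ws P, cartan_setting h ws P.
Proof.
move=> lie [hs [hn hN]].
have [ws [P wd]] := weight_decomposition_exists (adh_lin h) (adh_nil lie hn).
by exists ws, P.
Qed.

Variables (h : 'M[C]_N) (ws : seq 'cV[C]_N) (P : 'cV[C]_N -> 'M[C]_N).
Hypothesis cs : cartan_setting h ws P.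
Let lie := cs_lie cs.
Let wd := cs_wd cs.

Lemma grade_sum x : \sum_(w <- ws) x *m P w = x.
Proof. by rewrite -mulmx_sumr (wd_sum wd) mulmx1. Qed.

Lemma grade_orth x u w : x *m P u = x -> u != w -> x *m P w = 0.
Proof. by move=> <- uw; rewrite -mulmxA (wd_orth wd) // mulmx0. Qed.

Lemma grade_proj x u : x *m P u *m P u = x *m P u.
Proof. by rewrite -mulmxA (wd_idem wd). Qed.

Lemma grade_mem x u : x *m P u = x -> x != 0 -> u \in ws.
Proof. by move=> xu; rewrite (wd_mem wd); apply: contraNneq => P0; rewrite -xu P0 mulmx0. Qed.

Lemma stable_grade A w : stable (adh h) A -> (A *m P w <= A)%MS.
Proof. by have [_ +] := wd_tame wd w; apply. Qed.

Lemma stable_gradev A w x : stable (adh h) A -> (x <= A)%MS -> (x *m P w <= A)%MS.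
Proof. by move=> /(stable_grade w) As xA; rewrite (submx_trans (submxMr _ xA)). Qed.

Lemma stableP A : stable (adh h) A <-> (forall x y, (x <= h)%MS -> (y <= A)%MS -> ([x, y] <= A)%MS).
Proof.
split=> [As x y /submxP[a ->] /submxP[b ->]|As a].
  by rewrite -mul_ad -mulmxA (submx_trans (submxMl _ _)) //; apply: As.
by apply/row_subP => i; rewrite row_mul mul_ad; apply: As; rewrite ?submxMl ?row_sub.
Qed.

(** By the Jacobi identity [ad z - (p + q)] acts on [[x, y]] as [ad z - p] on the first factor plus
    [ad z - q] on the second. After [k + l] applications every term has exhausted the exponent of
    one factor. *)
Lemma lbr_has_weight x y u w : has_weight (adh h) u x -> has_weight (adh h) w y ->
  has_weight (adh h) (u + w) [x, y].
Proof.
move=> hx hy a; have [k hk] := hx a; have [l hl] := hy a; exists (k + l)%N.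
have -> : wval (u + w) a = wval u a + wval w a by rewrite /wval mulmxDr mxE.
move: (wval u a) (wval w a) hk hl => p q {hx hy}; move: (a *m h) => t; rewrite /adh.
have step x' y' : [x', y'] *m (ad c (a *m h) - (p + q)%:M) =
    [x' *m (ad c (a *m h) - p%:M), y'] + [x', y' *m (ad c (a *m h) - q%:M)].
  rewrite !mulmxBr !mul_mx_scalar !mul_ad lbrDl lbrDr lbrNl lbrNr lbrZl lbrZr.
  by rewrite (lbr_jacobi lie) scalerDl opprD !addrA; congr (_ + _); rewrite addrAC.
move: {2}(k + l)%N (erefl (k + l)%N) => m E.
elim: m k l x y E => [|m IH] k l x y E.
  have -> : k = 0%N by lia.
  by rewrite mulmx1 => -> _; rewrite lbr0l mul0mx.
move=> hk hl; rewrite E exprS -mulmxE mulmxA step mulmxDl.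
case: k hk E => [|k] hk E.
  by rewrite mulmx1 in hk; rewrite hk !lbr0l !mul0mx lbr0l mul0mx addr0.
case: l hl E => [|l] hl E.
  by rewrite mulmx1 in hl; rewrite hl !lbr0r !mul0mx lbr0r mul0mx addr0.
have -> : m = (k + l.+1)%N by lia.
rewrite (IH k l.+1) ?add0r //; try lia; last first.
  by rewrite -mulmxA mulmxE -exprS.
have -> : (k + l.+1 = k.+1 + l)%N by lia.
rewrite (IH k.+1 l) //; try lia.
by rewrite -mulmxA mulmxE -exprS.
Qed.

Lemma lbr_grade x y u w : x *m P u = x -> y *m P w = y -> [x, y] *m P (u + w) = [x, y].
Proof.
move=> /(wd_char wd) hx /(wd_char wd) hy; apply/(wd_char wd).
exact: lbr_has_weight.
Qed.

Lemma grade_ad x u v : x *m P u = x -> P v *m ad c x = P v *m ad c x *m P (u + v).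
Proof.
move=> xu; apply/row_matrixP => i; rewrite !row_mul !mul_ad lbr_grade //.
by rewrite -row_mul (wd_idem wd).
Qed.

Lemma grade_ad_orth x u v w : x *m P u = x -> w != u + v -> P v *m ad c x *m P w = 0.
Proof.
by move=> xu wuv; rewrite (grade_ad _ xu) -mulmxA (wd_orth wd) ?mulmx0 // eq_sym.
Qed.

(** For the converse, [h] acts on the space of weight 0 by nilpotent operators, and Jacobson's
    theorem gives a flag. A vector of one level is sent by [ad h] to the previous level, already in
    [h]; it normalizes [h] and therefore lies in it. *)
Lemma cartan_grade0 x : (x <= h)%MS <-> x *m P 0 = x.
Proof.
split.
  move=> xh; apply/(wd_char wd) => a; have [k hk] := cs_nil cs.
  exists k; rewrite /wval mulmx0 mxE raddf0 subr0 /adh.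
  have -> : x *m ad c (a *m h) ^+ k = iter k (fun y => [a *m h, y]) x.
    elim: (k) => [|j IH]; first by rewrite mulmx1.
    by rewrite exprSr -mulmxE mulmxA IH mul_ad.
  have /submx_trans/(_ hk) := iter_lower_central c k (submxMl a h) xh.
  by rewrite submx0 => /eqP.
move=> xP.
pose S s := exists a, s = P 0 *m adh h a.
have PC a : P 0 *m adh h a = adh h a *m P 0 by have [] := wd_tame wd 0.
have [||k hk] := @weakly_closed_nilpotent _ _ S.
- move=> s [a ->]; have /(wd_char wd) := wd_idem wd 0 => /(_ a)[k].
  rewrite /wval mulmx0 mxE raddf0 subr0 => hk; exists k.+1.
  rewrite mulmxE exprMn_comm; last exact: PC.
  have -> : P 0 ^+ k.+1 = P 0.
    by elim: k {hk} => [|k IH]; rewrite ?expr1 // exprS IH -mulmxE (wd_idem wd).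
  by rewrite exprSr mulrA -!mulmxE hk mul0mx.
- move=> _ _ [a ->] [b ->].
  have : ([b *m h, a *m h] <= h)%MS.
    by rewrite (submx_trans (mem_brmx _ (submxMl _ _) (submxMl _ _))) //; apply: cs_sub cs.
  move=> /submxP[d dE]; exists d; rewrite /adh -dE (ad_lbr lie) /mxcomm mulmxBr -/(adh h a) -/(adh h b).
  by rewrite -![P 0 *m _ *m (P 0 *m _)]mulmxA ![adh h _ *m (P 0 *m _)]mulmxA -!PC !mulmxA (wd_idem wd).
move: (hk x); elim: k x xP {hk} => [|k IH] x xP /=; first by move=> ->; rewrite sub0mx.
move=> hx; apply: (cs_norm cs); apply: brmx_sub => y z yx zh.
have /submxP[a ->] : (y <= x)%MS by rewrite (submx_trans yx) // genmxE.
rewrite [a]mx11_scalar mul_scalar_mx lbrZl scalemx_sub // (lbrC lie) eqmx_opp.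
have /submxP[b ->] := zh; rewrite -mul_ad -xP -mulmxA; apply: IH.
  by rewrite -[ad c _]/(adh h b) -!mulmxA -PC (mulmxA (P 0)) (wd_idem wd).
by apply: hx; apply: Lspan_in; exists b.
Qed.

End Grading.

Section Killing.
Variables (C : numClosedFieldType) (n' : nat).
Local Notation N := n'.+1.
Variable c : struct_const C N.
Implicit Types (x y z : 'rV[C]_N) (A B D : 'M[C]_N) (u v w : 'cV[C]_N).
Local Notation "[ x , y ]" := (lbr c x y).
Local Notation kil := (killing c).
Variables (h : 'M[C]_N) (ws : seq 'cV[C]_N) (P : 'cV[C]_N -> 'M[C]_N).
Hypothesis cs : cartan_setting c h ws P.
Let lie := cs_lie cs.
Let wd := cs_wd cs.

Lemma sum_trace (A : 'M[C]_N) : \tr A = \sum_(w <- ws) \tr (P w *m A).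
Proof. by rewrite -{1}(mul1mx A) -(wd_sum wd) mulmx_suml linear_sum. Qed.

Lemma killing_orth x y u w : x *m P u = x -> y *m P w = y -> u + w != 0 -> kil x y = 0.
Proof.
move=> xu yw uw; rewrite /killing sum_trace big1 // => v _.
rewrite -(wd_idem wd v) -mulmxA mxtrace_mulC mulmxA (grade_ad cs _ xu).
rewrite -!mulmxA (mulmxA (P (u + v))) (grade_ad_orth cs yw) ?mulmx0 ?mxtrace0 //.
by apply: contra uw => /eqP /esym/eqP; rewrite addrA -subr_eq0 addrK addrC.
Qed.

Definition wt w x := wval w (x *m pinvmx h).
Definition mult w : C := (\rank (P w))%:R.

Lemma wt_lin w k x y : wt w (k *: x + y) = k * wt w x + wt w y.
Proof. by rewrite /wt /wval !mulmxDl -!scalemxAl !mxE. Qed.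

Lemma wtD w x y : wt w (x + y) = wt w x + wt w y.
Proof. by rewrite -[x]scale1r wt_lin mul1r scale1r. Qed.

Lemma wt0r w : wt w 0 = 0.
Proof. by rewrite /wt /wval !mul0mx mxE. Qed.

Lemma wt_sum (I : Type) (r : seq I) (Q : pred I) (f : I -> 'rV_N) w :
  wt w (\sum_(i <- r | Q i) f i) = \sum_(i <- r | Q i) wt w (f i).
Proof. by apply: (big_morph (wt w) (wtD w) (wt0r w)). Qed.

Lemma wt_add u w x : wt (u + w) x = wt u x + wt w x.
Proof. by rewrite /wt /wval mulmxDr mxE. Qed.

Lemma wt0 x : wt 0 x = 0.
Proof. by rewrite /wt /wval mulmx0 mxE. Qed.

Lemma wt_opp w x : wt (- w) x = - wt w x.
Proof. by apply/eqP; rewrite -addr_eq0 -wt_add addNr wt0. Qed.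

Lemma wt_mulz w k x : wt (w *~ k) x = wt w x *~ k.
Proof.
have nat_case n : wt (w *+ n) x = wt w x *+ n.
  by elim: n => [|n IH]; rewrite ?mulr0n ?wt0 // !mulrS wt_add IH.
by case: k => n; rewrite ?NegzE ?mulrNz ?wt_opp -!pmulrn nat_case.
Qed.

Lemma wt_nil w z : (z <= h)%MS -> exists k, P w *m (ad c z - (wt w z)%:M) ^+ k = 0.
Proof.
move=> zh; have /(wd_char wd) := wd_idem wd w => /(_ (z *m pinvmx h)).
by rewrite /adh mulmxKpV.
Qed.

Lemma P_ad w z : (z <= h)%MS -> P w *m ad c z = ad c z *m P w.
Proof. by move=> /submxP[a ->]; have [+ _] := wd_tame wd w; apply. Qed.

Lemma wt_trace w z : (z <= h)%MS -> \tr (P w *m ad c z) = wt w z * mult w.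
Proof.
move=> zh; have [k hk] := wt_nil w zh.
rewrite /mult -idempotent_trace ?(wd_idem wd) //.
have := @trace_weight _ _ _ (adh c h) (P w) (z *m pinvmx h) (wt w z) k.
rewrite /adh mulmxKpV //; apply => //; [exact: wd_idem wd w|exact: P_ad].
Qed.

Lemma mult_neq0 w : w \in ws -> mult w != 0.
Proof. by rewrite (wd_mem wd) /mult pnatr_eq0 mxrank_eq0. Qed.

Lemma mult_ge0 w : 0 <= mult w.
Proof. by rewrite /mult ler0n. Qed.

Lemma killing_cartan_sq z : (z <= h)%MS ->
  kil z z = \sum_(w <- ws) mult w * wt w z ^+ 2.
Proof.
move=> zh; rewrite /killing sum_trace; apply: eq_bigr => w _.
have [k hk] := wt_nil w zh; set a := wt w z in hk *.
have PZ := P_ad w zh; set Z := ad c z in hk PZ *.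
have [T TE] : exists T, T = Z - a%:M by exists (Z - a%:M).
rewrite -TE in hk.
have PT : P w *m T = T *m P w by rewrite TE mulmxBr mulmxBl PZ scalar_mxC.
have nilT : \tr (P w *m (T *m T)) = 0.
  apply: (@nilpotent_trace0 _ _ _ k.+1).
  rewrite mulmxE exprMn_comm; last by rewrite /GRing.comm -!mulmxE mulmxA PT -!mulmxA PT.
  have -> : P w ^+ k.+1 = P w.
    by elim: (k) => [|j IH]; rewrite ?expr1 // exprS IH -mulmxE (wd_idem wd).
  by rewrite exprMn_comm // exprSr -!mulrA mulrA -!mulmxE hk mul0mx.
have trT : \tr (P w *m T) = 0.
  rewrite TE mulmxBr mul_mx_scalar linearB /= mxtraceZ wt_trace // idempotent_trace ?(wd_idem wd) //.
  by rewrite -/a subrr.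
have -> : Z = T + a%:M by rewrite TE subrK.
rewrite mulmxDl !mulmxDr !mxtraceD nilT mul_mx_scalar mul_scalar_mx -scalar_mxM.
rewrite -scalemxAr !mxtraceZ trT mulr0 mul_mx_scalar mxtraceZ idempotent_trace ?(wd_idem wd) //.
by rewrite !add0r expr2 mulrC.
Qed.

Lemma killing_cartan z z' : (z <= h)%MS -> (z' <= h)%MS ->
  kil z z' = \sum_(w <- ws) mult w * (wt w z * wt w z').
Proof.
move=> zh zh'; have := killing_cartan_sq (addmx_sub zh zh').
rewrite killingDl !killingDr (killingC c z') !killing_cartan_sq //.
have -> : \sum_(w <- ws) mult w * wt w (z + z') ^+ 2 =
   \sum_(w <- ws) mult w * wt w z ^+ 2 + 2 * (\sum_(w <- ws) mult w * (wt w z * wt w z')) +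
   \sum_(w <- ws) mult w * wt w z' ^+ 2.
  rewrite mulr_sumr -!big_split; apply: eq_bigr => w _ /=; rewrite wtD; ring.
set s1 := \sum_(w <- ws) _; set s2 := \sum_(w <- ws) _; set s3 := \sum_(w <- ws) _.
move=> E; have : 2 * (kil z z' - s3) = 0.
  by apply/eqP; rewrite mulrBr subr_eq0; apply/eqP; apply: (addrI s1); apply: (addIr s2); rewrite -E; ring.
by move/eqP; rewrite mulf_eq0 pnatr_eq0 /= subr_eq0 => /eqP.
Qed.

Lemma trace_commutator (Q X Y : 'M[C]_N) : Q *m X = Q *m X *m Q -> Q *m Y = Q *m Y *m Q ->
  \tr (Q *m mxcomm Y X) = 0.
Proof.
move=> QX QY; rewrite /mxcomm mulmxBr linearB /= !mulmxA {1}QY {1}QX.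
by rewrite -!(mulmxA (Q *m _)) mxtrace_mulC subrr.
Qed.

Lemma grade_ad_mem x u w : x *m P u = x -> P w *m ad c x != 0 -> u + w \in ws.
Proof.
move=> xu; rewrite (wd_mem wd); apply: contraNneq => Puw.
by rewrite (grade_ad cs _ xu) Puw mulmx0.
Qed.

(** The sum of the weight spaces in [K] is stable under [ad x] and [ad y], so their commutator has
    trace zero on it. Applied to full strings and half-strings, this replaces the representation
    theory of sl2 in the study of root strings. *)
Lemma string_trace (K : pred 'cV[C]_N) x y u :
  x *m P u = x -> y *m P (- u) = y ->
  (forall w, w \in ws -> K w -> P w *m ad c x != 0 -> K (u + w)) ->
  (forall w, w \in ws -> K w -> P w *m ad c y != 0 -> K (- u + w)) ->
  \sum_(w <- ws | K w) mult w * wt w [x, y] = 0.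
Proof.
move=> xu yu K1 K2.
have xyh : ([x, y] <= h)%MS.
  by apply/(cartan_grade0 cs); rewrite -{1}(subrr u); apply: (lbr_grade cs).
pose Q := \sum_(w <- ws | K w) P w.
rewrite (eq_bigr (fun w => \tr (P w *m ad c [x, y]))) => [|w _]; last by rewrite wt_trace // mulrC.
rewrite -linear_sum -mulmx_suml /= -/Q ad_lbr //.
have QP w : w \in ws -> K w -> P w *m Q = P w.
  move=> wws Kw; rewrite mulmx_sumr -big_filter (bigD1_seq w) ?mem_filter ?Kw ?filter_uniq ?(wd_uniq wd) //=.
  rewrite (wd_idem wd) big1 ?addr0 // => w'.
  by move=> ww'; rewrite (wd_orth wd) // eq_sym.
have stab z v : z *m P v = z -> (forall w, w \in ws -> K w -> P w *m ad c z != 0 -> K (v + w)) ->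
   Q *m ad c z = Q *m ad c z *m Q.
  move=> zv Kv; rewrite !mulmx_suml [LHS]big_seq_cond [RHS]big_seq_cond.
  apply: eq_bigr => w /andP[wws Kw].
  have [->|nz] := eqVneq (P w *m ad c z) 0; first by rewrite mul0mx.
  rewrite (grade_ad cs _ zv) -[RHS]mulmxA QP ?Kv //.
  exact: (grade_ad_mem zv).
by apply: trace_commutator; [exact: stab xu K1|exact: stab yu K2].
Qed.

(* The weight of a string element is [wt b + k wt a]; as the trace of a
   commutator vanishes on the string, [wt b] is a rational multiple of [wt a]. *)
Lemma string_ratio a b : b \in ws -> exists q : rat, forall x y,
  x *m P a = x -> y *m P (- a) = y -> wt b [x, y] = ratr q * wt a [x, y].
Proof.
move=> bws.
pose K w := `[< exists k : int, w = b + a *~ k >].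
pose kf w : int := if pselect (exists k : int, w = b + a *~ k) is left e then sval (cid e) else 0.
have kfE w : K w -> w = b + a *~ kf w.
  rewrite /K /kf => /asboolP e; case: pselect => // e'; exact: (svalP (cid e')).
pose s0 := (\sum_(w <- ws | K w) \rank (P w))%N.
pose s1 : int := \sum_(w <- ws | K w) kf w * (\rank (P w))%:Z.
exists (- s1%:~R / s0%:R) => x y xa ya.
have Kstep e w : K w -> K (a *~ e + w).
  by move=> /asboolP[k ->]; apply/asboolP; exists (e + k); rewrite mulrzDr addrCA.
have := string_trace (K := K) xa ya.
have K1 w : w \in ws -> K w -> P w *m ad c x != 0 -> K (a + w).
  by move=> _ Kw _; have := Kstep 1 w Kw; rewrite mulr1z.
have K2 w : w \in ws -> K w -> P w *m ad c y != 0 -> K (- a + w).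
  by move=> _ Kw _; have := Kstep (-1) w Kw; rewrite mulrNz mulr1z.
move=> /(_ K1 K2).
have -> : \sum_(w <- ws | K w) mult w * wt w [x, y] =
    s0%:R * wt b [x, y] + s1%:~R * wt a [x, y].
  rewrite natr_sum rmorph_sum /= !mulr_suml -big_split; apply: eq_bigr => w Kw /=.
  rewrite {2}(kfE w Kw) wt_add wt_mulz /mult -mulrzl rmorphM /=; ring.
have s00 : s0%:R != 0 :> C.
  rewrite pnatr_eq0 -lt0n /s0 -big_filter (big_rem b) /=; last first.
    by rewrite mem_filter bws andbT; apply/asboolP; exists 0; rewrite mulr0z addr0.
  by rewrite ltn_addr // lt0n mxrank_eq0 -(wd_mem wd).
move=> E; apply: (mulfI s00); rewrite rmorphM rmorphN fmorphV /= ratr_int ratr_nat.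
rewrite mulrA mulrCA divff // mulr1 mulNr; apply/eqP; rewrite -subr_eq0 opprK.
exact/eqP.
Qed.

Lemma grade_ad_nil x u : u != 0 -> x *m P u = x -> exists k, ad c x ^+ k = 0.
Proof.
move=> u0 xu; exists (size ws).
suff Pv v : P v *m ad c x ^+ size ws = 0.
  by rewrite -[LHS]mul1mx -(wd_sum wd) mulmx_suml big1.
have grade k : P v *m ad c x ^+ k = P v *m ad c x ^+ k *m P (v + u *+ k).
  elim: k => [|k IH]; first by rewrite mulr0n addr0 mulmx1 (wd_idem wd).
  rewrite exprSr -mulmxE !mulmxA IH -(mulmxA _ (P _)) (grade_ad cs _ xu).
  by rewrite mulrS addrCA -!mulmxA (wd_idem wd).
apply/eqP/negPn/negP => nz.
have in_ws k : (k <= size ws)%N -> v + u *+ k \in ws.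
  move=> ks; rewrite (wd_mem wd); apply: contra nz => /eqP Pk.
  have -> : size ws = (k + (size ws - k))%N by lia.
  by rewrite exprD -mulmxE mulmxA grade Pk mulmx0 mul0mx.
pose l := [seq v + u *+ k | k <- iota 0 (size ws).+1].
have : (size l <= size ws)%N.
  apply: uniq_leq_size.
    rewrite map_inj_uniq ?iota_uniq // => i j /addrI; rewrite -[u *+ i]scaler_nat -[u *+ j]scaler_nat => /eqP.
    rewrite -subr_eq0 -scalerBl scaler_eq0 (negPf u0) orbF subr_eq0 eqr_nat.
    by move/eqP.
  by move=> w /mapP[k]; rewrite mem_iota add0n ltnS => /andP[_ ks] ->; apply: in_ws.
by rewrite size_map size_iota ltnn.
Qed.

Definition killing_rad : 'M[C]_N := kermx (\matrix_(i, j) kil (delta_mx 0 i) (delta_mx 0 j)).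

Lemma killing_mx x y :
  x *m (\matrix_(i, j) kil (delta_mx 0 i) (delta_mx 0 j)) *m y^T = (kil x y)%:M.
Proof.
apply/matrixP => i j; rewrite !ord1 !mxE eqxx mulr1n [in RHS](row_sum_delta y) killing_sumr.
apply: eq_bigr => k _; rewrite !mxE killingZr mulrC; congr (_ * _).
rewrite [in RHS](row_sum_delta x) killing_suml; apply: eq_bigr => l _.
by rewrite mxE killingZl.
Qed.

Lemma killing_radP x : (x <= killing_rad)%MS <-> forall y, kil x y = 0.
Proof.
rewrite sub_kermx; split=> [/eqP x0 y|xy].
  by have /matrixP/(_ 0 0) := killing_mx x y; rewrite x0 mul0mx !mxE eqxx.
apply/eqP/rowP => j; have /matrixP/(_ 0 0) := killing_mx x (delta_mx 0 j).
by rewrite xy trmx_delta -colE !mxE eqxx => ->.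
Qed.

Lemma derived_ideal D : ideal_of c D 1%:M -> ideal_of c (brmx c D D) 1%:M.
Proof.
move=> [_ hD]; split; first exact: submx1.
have DD x y : (y <= D)%MS -> ([x, y] <= D)%MS.
  by move=> yD; rewrite (submx_trans _ hD) // mem_brmx ?submx1.
apply: brmx_sub => x y _; move: y; apply: brmx_ind.
- by rewrite lbr0r sub0mx.
- by move=> k y z hy hz; rewrite lbr_linr addmx_sub ?scalemx_sub.
move=> y z yD zD; rewrite (lbr_jacobi lie) addmx_sub ?mem_brmx ?DD //.
Qed.

Lemma ideal_stable D : ideal_of c D 1%:M -> stable (adh c h) D.
Proof.
move=> [_ hD]; apply/stableP => x y _ yD.
by rewrite (submx_trans _ hD) // mem_brmx ?submx1.
Qed.

Section PerfectIdeal.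
Variable D : 'M[C]_N.
Hypotheses (Dideal : ideal_of c D 1%:M) (Dperf : (D <= brmx c D D)%MS).
Hypothesis Drad : forall x y, (x <= D)%MS -> kil x y = 0.

Let DP x w : (x <= D)%MS -> (x *m P w <= D)%MS.
Proof. exact/(stable_gradev cs)/ideal_stable. Qed.

(** As [D] is perfect, its part of weight 0 is spanned by brackets [z] of opposite homogeneous
    elements. All weights at [z] are rational multiples of [wt u z]. If that value were nonzero,
    dividing [kil z z = 0] by its square would give a vanishing sum of rational squares with
    positive multiplicities, one of the squares being 1. *)
Lemma perfect_rad_wt0 x w : (x <= D)%MS -> w \in ws -> wt w (x *m P 0) = 0.
Proof.
move=> xD wws; move: (submx_trans xD Dperf) => {xD}; move: x.
apply: brmx_ind; first by rewrite mul0mx wt0r.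
  by move=> k x y hx hy; rewrite mulmxDl -scalemxAl wt_lin hx hy mulr0 addr0.
move=> x y xD yD; rewrite -(grade_sum cs x) lbr_suml mulmx_suml wt_sum big1_seq // => u /andP[_ uws].
rewrite -(grade_sum cs y) lbr_sumr mulmx_suml wt_sum big1 // => v _.
have [uv|uv] := eqVneq (u + v) 0; last first.
  by rewrite (grade_orth cs (lbr_grade cs (grade_proj cs x u) (grade_proj cs y v))) // wt0r.
have vE : v = - u by apply/eqP; rewrite -addr_eq0 addrC uv.
rewrite vE; set x' := x *m P u; set y' := y *m P (- u).
have x'u : x' *m P u = x' by apply: (grade_proj cs).
have y'u : y' *m P (- u) = y' by apply: (grade_proj cs).
set z := [x', y']; have zP : z *m P 0 = z by rewrite -(subrr u); apply: (lbr_grade cs).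
have zh : (z <= h)%MS by apply/(cartan_grade0 cs).
have zD : (z <= D)%MS by rewrite (submx_trans _ Dideal.2) // mem_brmx ?submx1 ?DP.
rewrite zP; have [q qE] := string_ratio u wws.
rewrite -/z (qE _ _ x'u y'u) -/z; suff -> : wt u z = 0 by rewrite mulr0.
apply/eqP/negPn/negP => uz.
pose r w' := wt w' z / wt u z.
have r0 w' : w' \in ws -> 0 <= mult w' * r w' ^+ 2.
  move=> w'ws; rewrite mulr_ge0 ?mult_ge0 //; have [q' q'E] := string_ratio u w'ws.
  by rewrite /r (q'E _ _ x'u y'u) mulfK // -rmorphXn ler0q sqr_ge0.
have : \sum_(w' <- ws) mult w' * r w' ^+ 2 = 0.
  rewrite (eq_bigr (fun w' => mult w' * wt w' z ^+ 2 * (wt u z) ^- 2)) => [|w' _].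
    by rewrite -mulr_suml -killing_cartan_sq // Drad // mul0r.
  by rewrite /r expr_div_n mulrA.
have uws' : u \in ws by [].
rewrite big_seq => /eqP; rewrite psumr_eq0 // => /allP/(_ u uws).
by rewrite uws /r divff // expr1n mulr1 (negPf (mult_neq0 uws)).
Qed.

End PerfectIdeal.

End Killing.

(** * Cartan's criterion: the Killing form is nondegenerate *)

Section NonDegenerate.
Variables (C : numClosedFieldType) (n' : nat).
Local Notation N := n'.+1.
Variable c : struct_const C N.
Implicit Types (x y z : 'rV[C]_N) (A B D : 'M[C]_N) (u v w : 'cV[C]_N).
Local Notation "[ x , y ]" := (lbr c x y).
Local Notation kil := (killing c).
Variables (h : 'M[C]_N) (ws : seq 'cV[C]_N) (P : 'cV[C]_N -> 'M[C]_N).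
Hypothesis cs : cartan_setting c h ws P.
Let lie := cs_lie cs.
Let wd := cs_wd cs.

Lemma perfect_rad_ad_nil D x u : ideal_of c D 1%:M -> (D <= brmx c D D)%MS ->
  (forall x y, (x <= D)%MS -> kil x y = 0) -> (x <= D)%MS -> x *m P u = x ->
  exists k, ad c x ^+ k = 0.
Proof.
move=> Di Dp Dr xD xu; have [u0|] := eqVneq u 0; last by move=> u0; apply: (grade_ad_nil cs u0 xu).
rewrite u0 in xu; have xh : (x <= h)%MS by apply/(cartan_grade0 cs).
have nil w : w \in ws -> exists k, P w *m ad c x ^+ k = 0.
  move=> wws; have [k] := wt_nil cs w xh.
  rewrite -{2}xu (perfect_rad_wt0 cs Di Dp Dr xD wws) raddf0 subr0 => hk; by exists k.
suff [k hk] : exists k, forall w, w \in ws -> P w *m ad c x ^+ k = 0.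
  by exists k; rewrite -[LHS]mul1mx -(wd_sum wd) mulmx_suml big1_seq // => w /andP[_ /hk].
elim: (ws) nil => [|w l IH] nil; first by exists 0%N.
have [k1 h1] := nil w (mem_head _ _).
have [k2 h2] := IH (fun v vl => nil v (mem_behead (s := w :: l) vl)).
exists (k1 + k2)%N => v; rewrite inE => /orP[/eqP ->|/h2 hv].
  by rewrite exprD -mulmxE mulmxA h1 mul0mx.
by rewrite addnC exprD -mulmxE mulmxA hv mul0mx.
Qed.

(* The weights vanish on the degree-0 part of [D], so the homogeneous elements
   of [D] are ad-nilpotent and Jacobson's theorem applies to them. *)
Lemma perfect_rad0 D : ideal_of c D 1%:M -> (D <= brmx c D D)%MS ->
  (forall x y, (x <= D)%MS -> kil x y = 0) -> D = 0.
Proof.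
move=> Di Dp Dr.
have DP x w : (x <= D)%MS -> (x *m P w <= D)%MS.
  by move=> xD; apply: (stable_gradev cs _ _ xD); apply: ideal_stable.
pose S s := exists u x, [/\ (x <= D)%MS, x *m P u = x & s = ad c x].
have [||k hk] := @weakly_closed_nilpotent _ _ S.
- by move=> _ [u [x [xD xu ->]]]; apply: perfect_rad_ad_nil Di Dp Dr xD xu.
- move=> _ _ [u [x [xD xu ->]]] [v [y [yD yv ->]]].
  exists (v + u), [y, x]; split; last by rewrite ad_lbr.
    by rewrite (submx_trans _ Di.2) // mem_brmx ?submx1.
  exact: (lbr_grade cs).
have adS x : (x <= D)%MS -> lspan S (ad c x).
  move=> xD; rewrite -(grade_sum cs x).
  have ad0 : ad c 0 = 0 by apply/row_matrixP => i; rewrite !rowE mul_ad lbr0l mulmx0.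
  have adD : {morph ad c : y z / y + z} by move=> y z; rewrite -[y]scale1r ad_lin !scale1r.
  rewrite (big_morph _ adD ad0); apply: lspan_sum => w _; apply: Lspan_in.
  by exists w, (x *m P w); split=> //; [apply: DP|apply: (grade_proj cs)].
suff D0 x : (x <= D)%MS -> x = 0 by apply/row_matrixP => i; rewrite row0 (D0 _ (row_sub i D)).
have {}hk : forall y, (y <= D)%MS -> killed (lspan S) k y by move=> y _; apply: hk.
elim: k hk x => [|k IH] hk //; apply: IH => x xD.
move: (submx_trans xD Dp); move: {xD} x; apply: brmx_ind.
- exact: killed0.
- by move=> a x y; apply: killedZD.
by move=> x y xD yD; rewrite -mul_ad; apply: hk => //; apply: adS.
Qed.

Lemma killing_rad_ideal : ideal_of c (killing_rad c) 1%:M.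
Proof.
split; first exact: submx1.
apply: brmx_sub => x y _ /killing_radP yr; apply/killing_radP => z.
by rewrite (lbrC lie) -scaleN1r killingZl (killing_inv lie) yr mulr0.
Qed.

(** The derived series of the radical of the form becomes stationary for reasons of dimension. Where
    it does, it is a perfect ideal inside the radical, hence 0; so the radical is solvable, and
    semisimplicity applies. *)
Lemma killing_nondeg : semisimple c -> forall x, (forall y, kil x y = 0) -> x = 0.
Proof.
move=> ss; suff R0 : (killing_rad c <= (0 : 'M[C]_N))%MS.
  by move=> x /killing_radP xr; apply/eqP; rewrite -submx0 (submx_trans xr).
have Ri := killing_rad_ideal; apply: ss => //.
pose D k := derived_series c (killing_rad c) k.
have Di k : ideal_of c (D k) 1%:M.
  by elim: k => [|k IH]; [exact: Ri|apply: (derived_ideal cs)].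
have DS k : (D k.+1 <= D k)%MS.
  by apply: submx_trans (Di k).2; apply: brmx_sub => x y xD yD; rewrite mem_brmx ?submx1.
have DR k : (D k <= killing_rad c)%MS.
  by elim: k => [|k IH] //; apply: submx_trans (DS k) IH.
suff [k hk] : exists k, (D k <= D k.+1)%MS.
  exists k; rewrite -/(D k) (perfect_rad0 (Di k) hk) // => x y xD.
  by have /killing_radP := submx_trans xD (DR k); apply.
apply: contrapT => /forallNP nD.
have rk k : (\rank (D k) + k <= N)%N.
  elim: k => [|k IH]; first by rewrite addn0 rank_leq_row.
  suff : (\rank (D k.+1) < \rank (D k))%N by lia.
  rewrite ltn_neqAle mxrankS ?DS // andbT; apply/eqP => E; apply: (nD k).
  by rewrite -(geq_leqif (mxrank_leqif_sup (DS k))) E.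
by have := rk N.+1; lia.
Qed.

End NonDegenerate.

(** * Roots and root spaces *)

Section Roots.
Variables (C : numClosedFieldType) (n' : nat).
Local Notation N := n'.+1.
Variable c : struct_const C N.
Implicit Types (x y z : 'rV[C]_N) (A B D : 'M[C]_N) (a b u v w : 'cV[C]_N).
Local Notation "[ x , y ]" := (lbr c x y).
Local Notation kil := (killing c).
Variables (h : 'M[C]_N) (ws : seq 'cV[C]_N) (P : 'cV[C]_N -> 'M[C]_N).
Hypothesis cs : cartan_setting c h ws P.
Let lie := cs_lie cs.
Let wd := cs_wd cs.
Local Notation wt := (wt h).

(** [wt] evaluates a column through the preimage chosen by [pinvmx h]. For a consistent column the
    choice is immaterial, so the column is determined by its values on [h]. *)
Definition consistent u := forall a : 'rV[C]_N, wval u a = wt u (a *m h).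

Lemma consistent_mem w : w \in ws -> consistent w.
Proof.
move=> wws a; have zh := submxMl a h.
apply: (mulIf (mult_neq0 cs wws)); rewrite -(wt_trace cs) // /mult -idempotent_trace ?(wd_idem wd) //.
have /(wd_char wd) := wd_idem wd w => /(_ a)[k hk].
by rewrite -(trace_weight (wd_idem wd w) _ hk) // /adh (P_ad cs).
Qed.

Lemma consistentD u w : consistent u -> consistent w -> consistent (u + w).
Proof. by move=> hu hw a; rewrite wt_add -hu -hw /wval mulmxDr mxE. Qed.

Lemma consistentN u : consistent u -> consistent (- u).
Proof. by move=> hu a; rewrite wt_opp -hu /wval mulmxN mxE. Qed.

Lemma consistent0 : consistent 0.
Proof. by move=> a; rewrite wt0 /wval mulmx0 mxE. Qed.

Lemma wt_inj u w : consistent u -> consistent w ->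
  (forall z, (z <= h)%MS -> wt u z = wt w z) -> u = w.
Proof.
move=> hu hw E; apply/matrixP => i j; rewrite ord1.
have := E _ (submxMl (delta_mx 0 i) h); rewrite -hu -hw.
by rewrite /wval -!rowE !mxE.
Qed.

Hypothesis nd : forall x, (forall y, kil x y = 0) -> x = 0.

Lemma killing_grade0 x z : (z <= h)%MS -> kil x z = kil (x *m P 0) z.
Proof.
move=> /(cartan_grade0 cs) zh; rewrite -{1}(grade_sum cs x) killing_suml.
have E w : w != 0 -> kil (x *m P w) z = 0.
  by move=> w0; apply: (killing_orth cs (grade_proj cs x w) zh); rewrite addr0.
have [ws0|] := boolP (0 \in ws).
  by rewrite (bigD1_seq 0) ?(wd_uniq wd) //= big1 ?addr0.
rewrite (wd_mem wd) negbK => /eqP P0; rewrite P0 mulmx0 killing0l big1_seq // => w /andP[_ wws].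
by apply: E; apply: contraTneq wws => ->; rewrite (wd_mem wd) P0 eqxx.
Qed.

Lemma cartan_nondeg z : (z <= h)%MS -> (forall y, (y <= h)%MS -> kil z y = 0) -> z = 0.
Proof.
move=> zh zy; apply: nd => y; rewrite killingC killing_grade0 // killingC zy //.
by apply/(cartan_grade0 cs); apply: (grade_proj cs).
Qed.

Lemma cartan_abelian x y : (x <= h)%MS -> (y <= h)%MS -> [x, y] = 0.
Proof.
move=> xh yh; have zh : ([x, y] <= h)%MS by rewrite (submx_trans _ (cs_sub cs)) // mem_brmx.
have wt0 w : w \in ws -> wt w [x, y] = 0.
  move=> wws; apply: (mulIf (mult_neq0 cs wws)).
  have PP z : (z <= h)%MS -> P w *m ad c z = P w *m ad c z *m P w.
    by move=> zh'; rewrite (P_ad cs) // -mulmxA (wd_idem wd).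
  by rewrite mul0r -(wt_trace cs) // ad_lbr // trace_commutator -?PP.
apply: cartan_nondeg => // z zh'; rewrite (killing_cartan cs) // big1_seq // => w /andP[_ wws].
by rewrite wt0 // mul0r mulr0.
Qed.

Definition killing_mat : 'M[C]_N := \matrix_(i, j) kil (delta_mx 0 i) (delta_mx 0 j).

Lemma killing_mat_unit : killing_mat \in unitmx.
Proof.
rewrite -row_free_unit -kermx_eq0 -submx0; apply/row_subP => i.
have /killing_radP/nd -> : (row i (kermx killing_mat) <= killing_rad c)%MS by apply: row_sub.
exact: sub0mx.
Qed.

(** The element of [h] that represents the weight [w] through the Killing form: the linear system is
    solved in the whole algebra and the solution projected to weight 0. *)
Definition tv w : 'rV[C]_N := (pinvmx h *m w)^T *m invmx killing_mat *m P 0.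

Lemma tv_h w : (tv w <= h)%MS.
Proof. by apply/(cartan_grade0 cs); apply: (grade_proj cs). Qed.

Lemma killing_tv w z : (z <= h)%MS -> kil (tv w) z = wt w z.
Proof.
move=> zh; rewrite -killing_grade0 //.
have /matrixP/(_ 0 0) := killing_mx c ((pinvmx h *m w)^T *m invmx killing_mat) z.
rewrite mulmxKV ?killing_mat_unit // [in RHS]mxE eqxx mulr1n => <-.
by rewrite -trmx_mul mxE /wt /wval mulmxA.
Qed.

Lemma killing_tvr w z : (z <= h)%MS -> kil z (tv w) = wt w z.
Proof. by rewrite killingC; apply: killing_tv. Qed.

Lemma mem_oppw w : w \in ws -> - w \in ws.
Proof.
rewrite (wd_mem wd) => Pw.
have [x [x0 xw]] : exists x, x != 0 /\ x *m P w = x.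
  exists (nz_row (P w)); rewrite nz_row_eq0; split=> //.
  have /submxP[d ->] := nz_row_sub (P w); exact: (grade_proj cs).
rewrite (wd_mem wd); apply: contraNneq x0 => Pmw; apply/eqP/nd => y.
rewrite -(grade_sum cs y) killing_sumr big1 // => v _.
have [wv|wv] := eqVneq (w + v) 0; last first.
  exact: (killing_orth cs xw (grade_proj cs y v)).
have -> : v = - w by apply/eqP; rewrite -addr_eq0 addrC wv.
by rewrite Pmw mulmx0 killing0r.
Qed.

Definition eigen w x := forall z, (z <= h)%MS -> [z, x] = wt w z *: x.

(** So far weight vectors are only generalized eigenvectors. As [h] is abelian, the nilpotent parts
    of its action on the weight space commute, and Jacobson's theorem yields a common kernel
    vector. *)
Lemma eigen_exists w : w \in ws -> exists x, [/\ x != 0, x *m P w = x & eigen w x].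
Proof.
move=> wws.
pose T z := ad c z - (wt w z)%:M.
pose S s := exists2 z, (z <= h)%MS & s = P w *m T z.
have PT z : (z <= h)%MS -> P w *m T z = T z *m P w.
  by move=> zh; rewrite mulmxBr mulmxBl (P_ad cs) // scalar_mxC.
have Tcom z z' : (z <= h)%MS -> (z' <= h)%MS -> T z *m T z' = T z' *m T z.
  move=> zh z'h; have adC : ad c z *m ad c z' = ad c z' *m ad c z.
    apply/eqP; rewrite -subr_eq0 -[_ - _]/(mxcomm _ _) -ad_lbr // cartan_abelian //.
    by apply/eqP/row_matrixP => i; rewrite !rowE mul_ad lbr0l mulmx0.
  have sc (A : 'M[C]_N) k : GRing.comm A k%:M by rewrite /GRing.comm -!mulmxE scalar_mxC.
  by apply: commrB => //; apply: commr_sym; apply: commrB => //; apply: commr_sym.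
have [||k hk] := @weakly_closed_nilpotent _ _ S.
- move=> _ [z zh ->]; have [k hk] := wt_nil cs w zh; exists k.+1.
  rewrite mulmxE exprMn_comm; last exact: PT.
  have -> : P w ^+ k.+1 = P w.
    by elim: (k) => [|j IH]; rewrite ?expr1 // exprS IH -mulmxE (wd_idem wd).
  by rewrite exprSr mulrA -!mulmxE hk mul0mx.
- move=> _ _ [z zh ->] [z' z'h ->]; exists 0; first exact: sub0mx.
  rewrite /T wt0r; have -> : ad c 0 = 0.
    by apply/row_matrixP => i; rewrite !rowE mul_ad lbr0l mulmx0.
  rewrite raddf0 subrr mulmx0 -/(T z) -/(T z').
  by rewrite !mulmxA -!(mulmxA (P w) (T _)) -!PT // !mulmxA (wd_idem wd) -!mulmxA Tcom // subrr.
have [v v0 vw] : exists2 x : 'rV_N, x != 0 & x *m P w = x.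
  exists (nz_row (P w)); first by rewrite nz_row_eq0 -(wd_mem wd).
  have /submxP[d ->] := nz_row_sub (P w); exact: (grade_proj cs).
have Sspan s : S s -> lspan S s by apply: Lspan_in.
have [x x0 [[l lS xE] xk]] := killed_neq0 v0 (killed_sub Sspan (hk v)).
have xw : x *m P w = x.
  rewrite {}xE; elim: l v vw lS {v0 hk} => //= s l IH v vw lS.
  apply: IH => [|t tl]; last by apply: lS; rewrite inE tl orbT.
  have [z zh ->] := lS s (mem_head _ _).
  by rewrite PT // mulmxA (grade_proj cs).
exists x; split=> // z zh; have := xk _ (ex_intro2 _ _ z zh (erefl _)).
by rewrite mulmxA xw mulmxBr mul_ad mul_mx_scalar => /subr0_eq.
Qed.

Lemma lbr_eigen w x y : x *m P w = x -> eigen w x -> y *m P (- w) = y ->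
  [x, y] = kil x y *: tv w.
Proof.
move=> xw ex yw; have xyh : ([x, y] <= h)%MS.
  by apply/(cartan_grade0 cs); rewrite -{1}(subrr w); apply: (lbr_grade cs).
apply/eqP; rewrite -subr_eq0; apply/eqP; apply: cartan_nondeg.
  by rewrite addmx_sub ?eqmx_opp ?scalemx_sub ?tv_h.
move=> z zh; rewrite -scaleN1r killingDl !killingZl killing_tv //.
rewrite killingC -(killing_inv lie) ex // killingZl; ring.
Qed.

Lemma dual_exists w x : x != 0 -> x *m P w = x -> exists2 y, y *m P (- w) = y & kil x y = 1.
Proof.
move=> x0 xw; have [y xy] : exists y, kil x y != 0.
  by apply: contrapT => /forallNP hy; case/eqP: x0; apply: nd => y; apply/eqP/negPn/negP.
have xyw : kil x (y *m P (- w)) = kil x y.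
  rewrite -[in RHS](grade_sum cs y) killing_sumr.
  have E v : v != - w -> kil x (y *m P v) = 0.
    by move=> vw; apply: (killing_orth cs xw (grade_proj cs y v)); rewrite addrC addr_eq0.
  have wws := mem_oppw (grade_mem cs xw x0).
  by rewrite (bigD1_seq (- w)) ?(wd_uniq wd) //= big1 ?addr0.
exists ((kil x y)^-1 *: (y *m P (- w))); first by rewrite -scalemxAl (grade_proj cs).
by rewrite killingZr xyw mulVf.
Qed.

(** [tv w] is a bracket of vectors of weights [w] and [- w], so all weights at it are multiples of
    [wt w (tv w)]. If this were 0, [tv w] would be orthogonal to [h], hence 0, and so would [w]. *)
Lemma wt_tv_neq0 w : w \in ws -> w != 0 -> wt w (tv w) != 0.
Proof.
move=> wws; apply: contraNneq => wt0t.
have [x [x0 xw ex]] := eigen_exists wws.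
have [y yw xy] := dual_exists x0 xw.
have tE : [x, y] = tv w by rewrite (lbr_eigen xw ex yw) xy scale1r.
have all0 b : b \in ws -> wt b (tv w) = 0.
  move=> bws; have [q qE] := string_ratio cs w bws.
  by rewrite -tE (qE _ _ xw yw) tE wt0t mulr0.
have t0 : tv w = 0.
  apply: cartan_nondeg; first exact: tv_h.
  move=> z zh; rewrite (killing_cartan cs) ?tv_h // big1_seq // => b /andP[_ bws].
  by rewrite all0 // mul0r mulr0.
apply/eqP; apply: wt_inj; [exact: consistent_mem|exact: consistent0|].
by move=> z zh; rewrite -killing_tv // t0 killing0l wt0.
Qed.

End Roots.

Section RootSpaces.
Variables (C : numClosedFieldType) (n' : nat).
Local Notation N := n'.+1.
Variable c : struct_const C N.
Implicit Types (x y z : 'rV[C]_N) (A B D : 'M[C]_N) (a b u v w : 'cV[C]_N).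
Local Notation "[ x , y ]" := (lbr c x y).
Local Notation kil := (killing c).
Variables (h : 'M[C]_N) (ws : seq 'cV[C]_N) (P : 'cV[C]_N -> 'M[C]_N).
Hypothesis cs : cartan_setting c h ws P.
Let lie := cs_lie cs.
Let wd := cs_wd cs.
Local Notation wt := (wt h).
Hypothesis nd : forall x, (forall y, kil x y = 0) -> x = 0.
Local Notation tv := (tv c h P).

(* [tv (-w)] has trace zero on the sum of the spaces of weight [k w], [k >= 1],
   with the line pairing to zero with an eigenvector of weight [-w] removed. *)
Lemma rank_root w : w \in ws -> w != 0 -> \rank (P w) = 1%N.
Proof.
move=> wws w0; have mws := mem_oppw cs nd wws.
have m0 : - w != 0 by rewrite oppr_eq0.
have [x [x0 xw ex]] := eigen_exists cs nd mws.
have [y yw xy] := dual_exists cs nd x0 xw.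
have yw' : y *m P w = y by rewrite -[w]opprK.
set t := tv (- w); have tE : [x, y] = t by rewrite (lbr_eigen cs nd xw ex yw) xy scale1r.
have tn0 := wt_tv_neq0 cs nd mws m0; rewrite -/t in tn0.
have th : (t <= h)%MS by apply: (tv_h cs).
pose K v := `[< exists k : nat, v = w *+ k.+1 >].
pose kf v : nat := if pselect (exists k : nat, v = w *+ k.+1) is left e then (sval (cid e)).+1 else 0%N.
have kfE v : K v -> v = w *+ kf v.
  rewrite /K /kf => /asboolP e; case: pselect => // e'; exact: (svalP (cid e')).
have Kw : K w by apply/asboolP; exists 0%N; rewrite mulr1n.
have kfw : (0 < kf w)%N by rewrite /kf; case: pselect => // -[]; exists 0%N; rewrite mulr1n.
pose Q := \sum_(v <- ws | K v) P v.
have QP v : v \in ws -> K v -> P v *m Q = P v.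
  move=> vws Kv; rewrite mulmx_sumr -big_filter (bigD1_seq v) ?mem_filter ?Kv ?filter_uniq ?(wd_uniq wd) //=.
  rewrite (wd_idem wd) big1 ?addr0 // => v'.
  by move=> vv'; rewrite (wd_orth wd) // eq_sym.
have Kn0 v : K v -> v != 0.
  by move=> /asboolP[k ->]; rewrite -scaler_nat scaler_eq0 (negPf w0) pnatr_eq0.
have xQ z : kil x (z *m Q) = kil x z.
  rewrite mulmx_sumr -big_filter (bigD1_seq w) ?mem_filter ?Kw ?filter_uniq ?(wd_uniq wd) //=.
  rewrite killingDr killing_sumr [X in _ + X]big1 ?addr0.
    rewrite -[in RHS](grade_sum cs z) (bigD1_seq w) ?(wd_uniq wd) //= killingDr killing_sumr.
    rewrite [X in _ + X]big1 ?addr0 // => v vw.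
    by apply: (killing_orth cs xw (grade_proj cs z v)); rewrite addrC subr_eq0.
  by move=> v vw; apply: (killing_orth cs xw (grade_proj cs z v)); rewrite addrC subr_eq0.
pose f : 'cV[C]_N := \col_i kil x (delta_mx 0 i).
have fE z : z *m f = (kil x z)%:M.
  apply/matrixP => i j; rewrite !ord1 !mxE eqxx mulr1n [in RHS](row_sum_delta z) killing_sumr.
  by apply: eq_bigr => k _; rewrite !mxE killingZr.
(* [E] is the projection [z |-> kil x z *: y], so [T] projects onto the kernel of [kil x] inside the
   image of [Q]. *)
pose E := f *m y; pose T := Q - E.
have zT z : z *m T = z *m Q - kil x z *: y by rewrite mulmxBr mulmxA fE mul_scalar_mx.
have QQ : Q *m Q = Q.
  rewrite {1}/Q mulmx_suml [LHS]big_seq_cond [RHS]big_seq_cond; apply: eq_bigr => v /andP[vws Kv].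
  exact: QP.
have yQ : y *m Q = y by rewrite -yw' -mulmxA QP.
have zT0 z : kil x (z *m T) = 0.
  by rewrite zT -scaleNr killingDr killingZr xQ xy; ring.
have zTQ z : z *m T *m Q = z *m T.
  by rewrite zT mulmxBl -scalemxAl yQ -mulmxA QQ.
have Tid z : z *m Q = z -> kil x z = 0 -> z *m T = z.
  by move=> zQ xz; rewrite zT zQ xz scale0r subr0.
have Qdec z : z *m Q = z -> z = \sum_(v <- ws | K v) z *m P v by move=> zQ; rewrite -mulmx_sumr.
have Qin v z : K v -> z *m P v = z -> z *m Q = z.
  move=> Kv zv; have [->|z0] := eqVneq z 0; first by rewrite mul0mx.
  by rewrite -zv -mulmxA QP // (grade_mem cs zv z0).
have xT : T *m ad c x = T *m ad c x *m T.
  apply/row_matrixP => i; rewrite !row_mul mul_ad rowE; set z := _ *m T.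
  rewrite Tid //; last by rewrite -(killing_inv lie) lbrxx // killing0l.
  rewrite {1 2}(Qdec z) ?zTQ // lbr_sumr mulmx_suml [LHS]big_seq_cond [RHS]big_seq_cond.
  apply: eq_bigr => v /andP[vws Kv]; have gv := grade_proj cs z v.
  have xzv := lbr_grade cs xw gv; have := Kv => /asboolP[[|k] vE].
    (* The step from weight [w] down to [h] is the only one that could leave the image of [T]; it
       vanishes because the pairing with [x] has been made zero. *)
    have -> : [x, z *m P v] = 0; last by rewrite mul0mx.
    rewrite vE (lbr_eigen cs nd xw ex); last by rewrite opprK (grade_proj cs).
    suff -> : kil x (z *m P (w *+ 1)) = 0 by rewrite scale0r.
    rewrite -(zT0 (delta_mx 0 i)) -/z [in RHS](Qdec z) ?zTQ // killing_sumr.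
    rewrite -big_filter (bigD1_seq w) ?mem_filter ?Kw ?filter_uniq ?(wd_uniq wd) //= big1 ?addr0 // => v'.
    by move=> vw; apply: (killing_orth cs xw (grade_proj cs z v')); rewrite addrC subr_eq0.
  apply: Qin xzv; apply/asboolP; exists k; by rewrite vE mulrS addrA addNr add0r.
have yT : T *m ad c y = T *m ad c y *m T.
  apply/row_matrixP => i; rewrite !row_mul mul_ad rowE; set z := _ *m T.
  have zQ : z *m Q = z by apply: zTQ.
  rewrite Tid //.
    rewrite (Qdec z) // lbr_sumr mulmx_suml [LHS]big_seq_cond [RHS]big_seq_cond.
    apply: eq_bigr => v /andP[vws Kv]; have gv := grade_proj cs z v.
    apply: Qin (lbr_grade cs yw' gv); have /asboolP[k ->] := Kv.
    by apply/asboolP; exists k.+1; rewrite [in RHS]mulrS.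
  rewrite -(killing_inv lie) tE (Qdec z) // killing_sumr big1 // => v Kv.
  have /(cartan_grade0 cs) t0 := th.
  by apply: (killing_orth cs t0 (grade_proj cs z v)); rewrite add0r Kn0.
(* Vanishing of the trace says that the sum of [kf v * \rank (P v)] over the multiples [v] of [w]
   equals 1; the term of [w] itself is already at least 1. *)
have := trace_commutator xT yT; rewrite -ad_lbr // tE /T mulmxBl linearB /=.
have -> : \tr (E *m ad c t) = wt w t.
  rewrite /E -mulmxA mxtrace_mulC mul_ad fE mxtrace_scalar mulr1n.
  by rewrite -(killing_inv lie) (lbrC lie) ex // -scaleNr killingZl xy mulr1 wt_opp opprK.
rewrite /Q mulmx_suml linear_sum /=.
rewrite (eq_bigr (fun v => wt w t * (kf v * \rank (P v))%:R)); last first.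
  move=> v Kv; have -> : \tr (P v *m ad c t) = wt w t *+ kf v * (\rank (P v))%:R.
    by rewrite (wt_trace cs) //; congr (_ * _); rewrite [in LHS](kfE v Kv) pmulrn wt_mulz.
  by rewrite natrM mulrA !mulr_natr.
rewrite -mulr_sumr -natr_sum => /eqP; rewrite subr_eq0 -{2}[wt w t]mulr1.
move=> /eqP/mulfI; rewrite -[wt w t]opprK -wt_opp oppr_eq0 => /(_ tn0) /eqP.
rewrite -[1]/(1%:R) eqr_nat -big_filter (big_rem w) /=; last by rewrite mem_filter Kw.
have : (0 < \rank (P w))%N by rewrite lt0n mxrank_eq0 -(wd_mem wd).
nia.
Qed.

Lemma root_line w x y : w \in ws -> w != 0 -> x *m P w = x -> x != 0 -> y *m P w = y ->
  exists k, y = k *: x.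
Proof.
move=> wws w0 xw x0 yw.
have xP : (x <= P w)%MS by rewrite -xw submxMl.
have : (P w <= x)%MS.
  by rewrite -(geq_leqif (mxrank_leqif_sup xP)) rank_root // rank_rV x0.
have yP : (y <= P w)%MS by rewrite -yw submxMl.
move=> /(submx_trans yP)/submxP[d ->]; exists (d 0 0).
by rewrite {1}[d]mx11_scalar mul_scalar_mx.
Qed.

Lemma root_eigen w x : w \in ws -> w != 0 -> x *m P w = x -> eigen c h w x.
Proof.
move=> wws w0 xw z zh; have [x' [x0 x'w ex]] := eigen_exists cs nd wws.
have [k ->] := root_line wws w0 x'w x0 xw.
by rewrite lbrZr ex // !scalerA mulrC.
Qed.

Lemma killing_root_neq0 w x y : w \in ws -> w != 0 -> x *m P w = x -> y *m P (- w) = y ->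
  x != 0 -> y != 0 -> kil x y != 0.
Proof.
move=> wws w0 xw yw x0 y0; have [y' yw' xy] := dual_exists cs nd x0 xw.
have y'0 : y' != 0 by apply: contra_eq_neq xy => ->; rewrite killing0r eq_sym oner_eq0.
have mw0 : - w != 0 by rewrite oppr_eq0.
have [k yE] := root_line (mem_oppw cs nd wws) mw0 yw' y'0 yw.
rewrite yE killingZr xy mulr1; apply: contraNneq y0 => k0.
by rewrite yE k0 scale0r.
Qed.

Lemma tv_bracket w : w \in ws -> exists x y, [/\ x *m P w = x, y *m P (- w) = y & [x, y] = tv w].
Proof.
move=> wws; have [x [x0 xw ex]] := eigen_exists cs nd wws.
have [y yw xy] := dual_exists cs nd x0 xw; exists x, y; split=> //.
by rewrite (lbr_eigen cs nd xw ex yw) xy scale1r.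
Qed.

(** Put [a = wt w (tv w)]. The Killing form of [tv w] with itself is [a], and it is also the sum of
    the squares of the weights at [tv w], namely [a ^+ 2 * s] with [s] a nonnegative rational. Hence
    [a] is the inverse of [s]. *)
Lemma wt_tv_rat w : w \in ws -> w != 0 ->
  exists2 q : rat, 0 < q & wt w (tv w) = ratr q.
Proof.
move=> wws w0; have t0 := wt_tv_neq0 cs nd wws w0.
have [x [y [xw yw xy]]] := tv_bracket wws.
have /choice[q qE] : forall b, exists q : rat, b \in ws -> wt b (tv w) = ratr q * wt w (tv w).
  move=> b; case: (boolP (b \in ws)) => [bws|_]; last by exists 0.
  by have [q hq] := string_ratio cs w bws; exists q => _; rewrite -xy; apply: hq.
pose s := \sum_(b <- ws) (\rank (P b))%:R * q b ^+ 2.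
have sE : wt w (tv w) * ratr s = 1.
  apply: (mulfI t0); rewrite mulr1 -[RHS](killing_tv cs nd) ?(tv_h cs) //.
  rewrite (killing_cartan_sq cs) ?(tv_h cs) // /s rmorph_sum /= !mulr_sumr.
  apply: eq_big_seq => b bws; rewrite (qE b bws) rmorphM rmorphXn /= ratr_nat /mult; ring.
have s0 : s != 0 by apply: contra_eq_neq sE => ->; rewrite rmorph0 mulr0 eq_sym oner_eq0.
have sp : 0 <= s by rewrite sumr_ge0 // => b _; rewrite mulr_ge0 ?ler0n ?sqr_ge0.
exists s^-1; first by rewrite invr_gt0 lt_def s0.
by rewrite fmorphV; apply: (mulIf (_ : ratr s != 0)); rewrite ?fmorph_eq0 // sE mulVf // fmorph_eq0.
Qed.

Lemma wt_tv_rat2 b w : b \in ws -> w \in ws -> exists q : rat, wt b (tv w) = ratr q.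
Proof.
move=> bws wws; have [->|w0] := eqVneq w 0.
  by exists 0; rewrite rmorph0 -(killing_tvr cs nd) ?(tv_h cs) // (killing_tv cs nd) ?(tv_h cs) // wt0.
have [x [y [xw yw xy]]] := tv_bracket wws.
have [q hq] := string_ratio cs w bws; have [r r0 rE] := wt_tv_rat wws w0.
by exists (q * r); rewrite rmorphM /= -rE -xy; apply: hq.
Qed.

(** If [b - a] were not a weight, the half-string [b + k a] with [k >= 0] would be stable, yet all
    its contributions to the trace of [ad c (tv a)] are nonnegative and that of [b] is positive. *)
Lemma root_sub a b : a \in ws -> a != 0 -> b \in ws -> 0 < wt b (tv a) -> b - a \in ws.
Proof.
move=> aws a0 bws; have [q q0 qE] := wt_tv_rat aws a0 => ba.
have [x [y [xa ya xy]]] := tv_bracket aws.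
apply: contraT => nba.
pose K v := `[< exists k : nat, v = b + a *+ k >].
have Kb : K b by apply/asboolP; exists 0%N; rewrite addr0.
have K1 w : w \in ws -> K w -> P w *m ad c x != 0 -> K (a + w).
  by move=> _ /asboolP[k ->] _; apply/asboolP; exists k.+1; rewrite mulrS addrCA.
have K2 w : w \in ws -> K w -> P w *m ad c y != 0 -> K (- a + w).
  move=> _ /asboolP[[|k] ->] nz; last by apply/asboolP; exists k; rewrite mulrS addrCA addKr.
  by case/negP: nba; rewrite addrC -[b]addr0 -(mulr0n a) (grade_ad_mem cs ya nz).
have := string_trace cs xa ya K1 K2; rewrite xy -big_filter (big_rem b) /=; last by rewrite mem_filter Kb.
move=> /eqP; rewrite gt_eqF // ltr_pwDl ?mulr_gt0 //.
  by rewrite lt_def mult_ge0 (mult_neq0 cs).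
rewrite big_seq sumr_ge0 // => w /mem_rem; rewrite mem_filter => /andP[/asboolP[k ->] _].
rewrite mulr_ge0 ?mult_ge0 // wt_add pmulrn wt_mulz -pmulrn qE addr_ge0 ?(ltW ba) //.
by rewrite mulrn_wge0 // ler0q ltW.
Qed.

(** If the bracket vanished, [ad x] would kill the whole line of weight [b], and the half-string
    going down from [b] would be stable. Its zero trace forces [wt b (tv a) >= 0]. The full string
    has zero trace as well, hence so has the upper half-string; but its terms are nonnegative, and
    positive at [a + b]. *)
Lemma root_bracket_neq0 a b x z : a \in ws -> a != 0 -> b \in ws -> b != 0 -> a + b \in ws ->
  x *m P a = x -> x != 0 -> z *m P b = z -> z != 0 -> [x, z] != 0.
Proof.
move=> aws a0 bws b0 abws xa x0 zb z0; apply/eqP => xz.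
have [q q0 qE] := wt_tv_rat aws a0; have [B BE] := wt_tv_rat2 bws aws.
have ea := root_eigen aws a0 xa.
have [y ya xy] := dual_exists cs nd x0 xa.
have {}xy : [x, y] = tv a by rewrite (lbr_eigen cs nd xa ea ya) xy scale1r.
have Pbx : P b *m ad c x = 0.
  apply/row_matrixP => i; rewrite row0 row_mul mul_ad.
  have gi : row i (P b) *m P b = row i (P b) by rewrite -row_mul (wd_idem wd).
  by have [k ->] := root_line bws b0 zb z0 gi; rewrite lbrZr xz scaler0.
pose K1 v := `[< exists k : nat, v = b - a *+ k >].
pose K2 v := `[< exists k : nat, v = b + a *+ k.+1 >].
have wtK1 v k : v = b - a *+ k -> wt v (tv a) = ratr (B - q *+ k).
  by move=> ->; rewrite wt_add wt_opp pmulrn wt_mulz -pmulrn BE qE rmorphB rmorphMn.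
have wtK2 v k : v = b + a *+ k -> wt v (tv a) = ratr (B + q *+ k).
  by move=> ->; rewrite wt_add pmulrn wt_mulz -pmulrn BE qE rmorphD rmorphMn.
have S1 : \sum_(w <- ws | K1 w) mult P w * wt w (tv a) = 0.
  rewrite -xy; apply: string_trace xa ya _ _ => // w _ /asboolP[k ->] nz; last first.
    by apply/asboolP; exists k.+1; rewrite mulrS opprD addrCA.
  case: k nz => [|k] nz; first by rewrite subr0 Pbx eqxx in nz.
  by apply/asboolP; exists k; rewrite mulrS opprD addrCA addNKr.
have S2 : \sum_(w <- ws | K1 w || K2 w) mult P w * wt w (tv a) = 0.
  rewrite -xy; apply: string_trace xa ya _ _ => // w _.
    move=> /orP[] /asboolP[k ->] _; last first.
      by apply/orP; right; apply/asboolP; exists k.+1; rewrite [in RHS]mulrS addrCA.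
    case: k => [|k]; apply/orP; [right|left]; apply/asboolP.
      by exists 0%N; rewrite mulr0n subr0 mulr1n addrC.
    by exists k; rewrite mulrS opprD addrCA addNKr.
  move=> /orP[] /asboolP[k ->] _; apply/orP.
    by left; apply/asboolP; exists k.+1; rewrite mulrS opprD addrCA.
  case: k => [|k]; [left|right]; apply/asboolP.
    by exists 0%N; rewrite mulr0n subr0 mulr1n addrCA addNr addr0.
  by exists k; rewrite [in LHS]mulrS addrCA addKr.
have B0 : 0 <= B.
  rewrite leNgt; apply/negP => Bn.
  have := S1; rewrite -big_filter (big_rem b) /=; last first.
    by rewrite mem_filter bws andbT; apply/asboolP; exists 0%N; rewrite subr0.
  move=> /eqP; rewrite lt_eqF // ltr_nwDl //.
    by rewrite nmulr_llt0 ?BE ?ltrq0 // lt_def mult_ge0 (mult_neq0 cs).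
  rewrite big_seq sumr_le0 // => w /mem_rem; rewrite mem_filter => /andP[/asboolP[k wE] _].
  rewrite (wtK1 _ _ wE) mulr_ge0_le0 ?mult_ge0 // lerq0.
  by rewrite subr_le0 (le_trans (ltW Bn)) // mulrn_wge0 // ltW.
have dis w : K1 w -> K2 w -> False.
  move=> /asboolP[k wE] /asboolP[l wE'].
  have := wtK1 _ _ wE; rewrite (wtK2 _ _ wE') => /fmorph_inj /addrI /eqP.
  rewrite -addr_eq0 -mulrnDr -mulr_natr mulf_eq0 pnatr_eq0 (gt_eqF q0) /=; lia.
have S3 : \sum_(w <- ws | K2 w) mult P w * wt w (tv a) = 0.
  move: S2; rewrite (bigID K1) /=.
  have -> : \sum_(w <- ws | (K1 w || K2 w) && K1 w) mult P w * wt w (tv a) = 0.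
    by rewrite -[RHS]S1; apply: eq_bigl => w; case: (K1 w); rewrite ?andbF.
  rewrite add0r => E; rewrite -[RHS]E; apply: eq_bigl => w.
  by have := dis w; case: (K1 w); case: (K2 w) => //= /(_ isT isT).
have := S3; rewrite -big_filter (big_rem (a + b)) /=; last first.
  by rewrite mem_filter abws andbT; apply/asboolP; exists 0%N; rewrite mulr1n addrC.
move=> /eqP; rewrite gt_eqF // ltr_pwDl //.
  apply: mulr_gt0; first by rewrite lt_def mult_ge0 (mult_neq0 cs).
  by rewrite (wtK2 _ 1%N) ?mulr1n 1?addrC // ltr0q; lra.
rewrite big_seq sumr_ge0 // => w /mem_rem; rewrite mem_filter => /andP[/asboolP[k wE] _].
by rewrite (wtK2 _ _ wE) mulr_ge0 ?mult_ge0 // ler0q addr_ge0 // mulrn_wge0 // ltW.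
Qed.

End RootSpaces.

(** * Gordan's alternative *)

Section Gordan.
Variables (F : realFieldType) (d : nat).
Implicit Types (v u : nat -> 'rV[F]_d) (w : 'cV[F]_d).

Definition pairing (x : 'rV[F]_d) (w : 'cV[F]_d) : F := (x *m w) 0 0.

Lemma pairingD x y w : pairing (x + y) w = pairing x w + pairing y w.
Proof. by rewrite /pairing mulmxDl mxE. Qed.

Lemma pairingN x w : pairing (- x) w = - pairing x w.
Proof. by rewrite /pairing mulNmx mxE. Qed.

Lemma pairingB x y w : pairing (x - y) w = pairing x w - pairing y w.
Proof. by rewrite pairingD pairingN. Qed.

Lemma pairingZ k x w : pairing (k *: x) w = k * pairing x w.
Proof. by rewrite /pairing -scalemxAl mxE. Qed.

Lemma pairing0 w : pairing 0 w = 0.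
Proof. by rewrite /pairing mul0mx mxE. Qed.

Lemma pairingDr x w w' : pairing x (w + w') = pairing x w + pairing x w'.
Proof. by rewrite /pairing mulmxDr mxE. Qed.

Lemma pairingZr k x w : pairing x (k *: w) = k * pairing x w.
Proof. by rewrite /pairing -scalemxAr mxE. Qed.

Lemma pairing_sum (I : Type) (r : seq I) (Q : pred I) (f : I -> 'rV_d) w :
  pairing (\sum_(i <- r | Q i) f i) w = \sum_(i <- r | Q i) pairing (f i) w.
Proof. by apply: (big_morph (fun x => pairing x w) (fun x y => pairingD x y w) (pairing0 w)). Qed.

Lemma pairing_sq (x : 'rV[F]_d) : x != 0 -> 0 < pairing x x^T.
Proof.
move=> x0; have E : pairing x x^T = \sum_i x 0 i ^+ 2.
  by rewrite /pairing mxE; apply: eq_bigr => i _; rewrite mxE expr2.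
rewrite lt_def E sumr_ge0 ?andbT => [|i _]; last exact: sqr_ge0.
apply: contra x0 => /eqP s0; apply/eqP/rowP => i; rewrite mxE; apply/eqP.
have := psumr_eq0P (fun i _ => sqr_ge0 (x 0 i)) s0 => /(_ i isT)/eqP.
by rewrite expf_eq0.
Qed.

Lemma small_multiple k (f g : nat -> F) : (forall i, (i < k)%N -> 0 < f i) ->
  exists2 e, 0 < e & forall i, (i < k)%N -> e * g i < f i.
Proof.
elim: k => [|k IH] fp; first by exists 1.
have [|e e0 he] := IH; first by move=> i ik; apply: fp; rewrite ltnW.
have fk := fp k (ltnSn k).
exists (Num.min e (f k / (1 + `|g k|) / 2)).
  by rewrite lt_min e0 divr_gt0 // divr_gt0 // ltr_pwDl.
set m := Num.min _ _; have m0 : 0 < m.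
  by rewrite lt_min e0 divr_gt0 // divr_gt0 // ltr_pwDl.
move=> i; rewrite ltnS leq_eqVlt => /orP[/eqP ->|ik].
  have g1 : 0 < 1 + `|g k| by rewrite ltr_pwDl.
  have mk : m * (1 + `|g k|) <= f k / 2.
    by rewrite -ler_pdivlMr // mulrAC ge_min lexx orbT.
  have : m * g k <= m * (1 + `|g k|) by rewrite ler_pM2l // (le_trans (ler_norm _)) // lerDr.
  by move=> h1; rewrite (le_lt_trans h1) // (le_lt_trans mk) // ltr_pdivrMr // ltr_pMr // ltrDl.
have [gi|gi] := lerP 0 (g i).
  by rewrite (le_lt_trans _ (he i ik)) // ler_wpM2r // ge_min lexx.
by rewrite (lt_trans _ (fp i (ltnW ik))) // pmulr_rlt0.
Qed.

(** Induction on the number of vectors. If the functional [w] found for the earlier vectors is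
    negative on [v k], these are pushed along [v k] into the kernel of [w]. A functional for the
    pushed vectors is corrected by a multiple of [w]; a relation among them lifts to one in which
    the coefficient of [v k] is nonnegative. If [w] vanishes on a nonzero [v k], a small multiple of
    [v k] itself is added. *)
Theorem gordan k v :
  (exists w, forall i, (i < k)%N -> 0 < pairing (v i) w) \/
  (exists a : nat -> F, [/\ forall i, 0 <= a i, exists2 i, (i < k)%N & 0 < a i
     & \sum_(i < k) a i *: v i = 0]).
Proof.
elim: k v => [|k IH] v; first by left; exists 0.
have ext a : [/\ forall i, 0 <= a i, exists2 i, (i < k)%N & 0 < a i
     & \sum_(i < k) a i *: v i = 0] -> exists a : nat -> F,
     [/\ forall i, 0 <= a i, exists2 i, (i < k.+1)%N & 0 < a i
     & \sum_(i < k.+1) a i *: v i = 0].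
  move=> [a0 [i ik ai] s0]; exists (fun i => if (i < k)%N then a i else 0); split.
  - by move=> j; case: ifP.
  - by exists i; rewrite ?ik // ltnW.
  - by rewrite big_ord_recr /= ltnn scale0r addr0 -[RHS]s0; apply: eq_bigr => j _; rewrite ltn_ord.
have [[w hw]|[a ha]] := IH v; last by right; apply: ext ha.
case: (ltrgtP (pairing (v k) w) 0) => [p0|p0|p0].
- pose p := pairing (v k) w; rewrite -/p in p0.
  pose u i := v i - (pairing (v i) w / p) *: v k.
  have ci i : (i < k)%N -> 0 < - (pairing (v i) w / p).
    by move=> ik; rewrite oppr_gt0 nmulr_llt0 ?invr_lt0 // hw.
  have uw i : pairing (u i) w = 0.
    by rewrite pairingB pairingZ -/p divfK ?subrr // lt_eqF.
  have [[w' hw']|[a [a0 [i ik ai] s0]]] := IH u.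
    have [e e0 he] := small_multiple (fun i => - (pairing (v i) w / p)) hw'.
    left; exists (w' + ((e - pairing (v k) w') / p) *: w).
    have vk : pairing (v k) (w' + ((e - pairing (v k) w') / p) *: w) = e.
      by rewrite pairingDr pairingZr -/p divfK ?lt_eqF // addrCA subrr addr0.
    move=> i; rewrite ltnS leq_eqVlt => /orP[/eqP ->|ik]; first by rewrite vk.
    have -> : v i = u i + (pairing (v i) w / p) *: v k by rewrite subrK.
    rewrite pairingD pairingZ vk pairingDr pairingZr uw mulr0 addr0.
    by have := he i ik; lra.
  right; exists (fun j => if (j < k)%N then a j else \sum_(l < k) a l * - (pairing (v l) w / p)); split.
  - move=> j; case: ifP => // _; rewrite sumr_ge0 // => l _.
    by rewrite mulr_ge0 // ltW // ci.
  - by exists i; rewrite ?ik // ltnW.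
  - rewrite big_ord_recr /= ltnn scaler_suml -big_split -[RHS]s0 /=; apply: eq_bigr => l _.
    by rewrite ltn_ord /u scalerBr scalerA mulrN scaleNr.
- by left; exists w => i; rewrite ltnS leq_eqVlt => /orP[/eqP ->|/hw].
- have [vk0|vk0] := eqVneq (v k) 0.
    right; exists (fun i => (i == k)%:R); split.
    + by move=> i; rewrite ler0n.
    + by exists k; rewrite ?eqxx ?ltr01.
    + rewrite big_ord_recr /= vk0 scaler0 addr0 big1 // => i _.
      by rewrite ltn_eqF ?ltn_ord // scale0r.
  have [e e0 he] := small_multiple (fun i => - pairing (v i) (v k)^T) hw.
  left; exists (w + e *: (v k)^T) => i; rewrite ltnS leq_eqVlt => /orP[/eqP ->|ik].
    by rewrite pairingDr p0 add0r pairingZr mulr_gt0 // pairing_sq.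
  by rewrite pairingDr pairingZr; have := he i ik; lra.
Qed.

Theorem gordan_fin (I : finType) (Q : pred I) (v : I -> 'rV[F]_d) :
  (exists w, forall i, Q i -> 0 < pairing (v i) w) \/
  (exists a : I -> F, [/\ forall i, 0 <= a i, forall i, ~~ Q i -> a i = 0,
     exists i, 0 < a i & \sum_i a i *: v i = 0]).
Proof.
pose s := enum Q.
have sQ i : (i \in s) = Q i by rewrite mem_enum.
have [[w hw]|[a [a0 [k ks ak] s0]]] := gordan (size s) (nth 0 [seq v i | i <- s]).
  left; exists w => i Qi; have := hw (index i s).
  rewrite index_mem sQ Qi (nth_map i) ?index_mem ?sQ // nth_index ?sQ //.
  exact.
right; have [i0 is0] : exists i0, i0 \in s by case: (s) ks => // i0 l _; exists i0; rewrite mem_head.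
exists (fun i => if Q i then a (index i s) else 0); split.
- by move=> i; case: ifP.
- by move=> i /negPf ->.
- exists (nth i0 s k); rewrite -sQ mem_nth // index_uniq ?enum_uniq //.
- rewrite -[RHS]s0 (bigID Q) /= [X in _ + X]big1 ?addr0 => [|i /negPf ->]; last by rewrite scale0r.
  rewrite (eq_bigr (fun i => a (index i s) *: v i)) => [|i ->] //.
  rewrite -big_enum -/s (big_nth i0) big_mkord; apply: eq_bigr => j _.
  by rewrite (nth_map i0) // index_uniq ?enum_uniq.
Qed.

End Gordan.

Lemma common_denominator (I : finType) (a : I -> rat) :
  exists2 D : nat, (0 < D)%N & forall i, exists z : int, D%:R * a i = z%:~R.
Proof.
exists (\prod_i `|denq (a i)|)%N; first by rewrite prodn_gt0 // => i; rewrite absz_gt0 denq_eq0.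
move=> i; exists (numq (a i) * (\prod_(j | j != i) `|denq (a j)|)%N%:Z).
rewrite (bigD1 i) //= natrM rmorphM /= -pmulrn mulrAC; congr (_ * _).
have {2}-> : a i = (numq (a i))%:~R / (denq (a i))%:~R by rewrite divq_num_den.
rewrite -[X in X%:R]/(absz _) natr_absz ger0_norm ?denq_ge0 //.
by rewrite mulrCA divff ?mulr1 // intr_eq0 denq_eq0.
Qed.

(** * The root decomposition in rational coordinates *)

Section RootSetting.
Variables (C : numClosedFieldType) (n' : nat).
Local Notation N := n'.+1.
Variable c : struct_const C N.
Implicit Types (x y z : 'rV[C]_N) (A B D : 'M[C]_N) (a b u v w : 'cV[C]_N).
Local Notation "[ x , y ]" := (lbr c x y).
Local Notation kil := (killing c).

(* The root [rho i] is recorded by its pairings with all roots.  The Killing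
   form being the sum of the squares of the roots, these rational coordinates
   make it the standard dot product. *)
Record root_setting (h : 'M[C]_N) (r : nat) (rho : 'I_r -> 'rV[rat]_r)
    (Q0 : 'M[C]_N) (Q : 'I_r -> 'M[C]_N) (t : 'I_r -> 'rV[C]_N) : Prop := {
  rs_sum : Q0 + \sum_i Q i = 1%:M;
  rs_cartan : forall x, (x <= h)%MS <-> x *m Q0 = x;
  rs_idem : forall i, Q i *m Q i = Q i;
  rs_orth : forall i j, i != j -> Q i *m Q j = 0;
  rs_idem0 : Q0 *m Q0 = Q0;
  rs_orth0l : forall i, Q0 *m Q i = 0;
  rs_orth0r : forall i, Q i *m Q0 = 0;
  rs_rank : forall i, \rank (Q i) = 1%N;
  rs_stable : forall A, stable (adh c h) A -> (A *m Q0 <= A)%MS /\ forall i, (A *m Q i <= A)%MS;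
  rs_abel : forall x y, (x <= h)%MS -> (y <= h)%MS -> [x, y] = 0;
  rs_th : forall i, (t i <= h)%MS;
  rs_t : forall i j x, x *m Q i = x -> [t j, x] = ratr (rho i 0 j) *: x;
  rs_eigen : forall i x z, x *m Q i = x -> (z <= h)%MS -> exists k, [z, x] = k *: x;
  rs_add : forall i j k x y, rho i + rho j = rho k ->
    x *m Q i = x -> y *m Q j = y -> [x, y] *m Q k = [x, y];
  rs_add_neq0 : forall i j k x y, rho i + rho j = rho k ->
    x *m Q i = x -> y *m Q j = y -> x != 0 -> y != 0 -> [x, y] != 0;
  rs_opp : forall i j x y, rho i + rho j = 0 ->
    x *m Q i = x -> y *m Q j = y -> [x, y] = kil x y *: t i;
  rs_out : forall i j x y, rho i + rho j != 0 -> (forall k, rho k != rho i + rho j) ->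
    x *m Q i = x -> y *m Q j = y -> [x, y] = 0;
  rs_kil : forall i j x y, rho i + rho j != 0 ->
    x *m Q i = x -> y *m Q j = y -> kil x y = 0;
  rs_kil0 : forall i x y, (x <= h)%MS -> y *m Q i = y -> kil x y = 0;
  rs_kil_neq0 : forall i j x y, rho i + rho j = 0 ->
    x *m Q i = x -> y *m Q j = y -> x != 0 -> y != 0 -> kil x y != 0;
  rs_neg : forall i, exists j, rho j = - rho i;
  rs_sub : forall i j, 0 < pairing (rho i) (rho j)^T -> i != j -> exists k, rho k = rho i - rho j;
  rs_dot : forall i j, pairing (rho i) (rho j)^T = rho i 0 j;
  rs_inj : injective rho;
  rs_neq0 : forall i, rho i != 0 }.

Variables (h : 'M[C]_N) (ws : seq 'cV[C]_N) (P : 'cV[C]_N -> 'M[C]_N).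
Hypothesis cs : cartan_setting c h ws P.
Let wd := cs_wd cs.
Local Notation wt := (wt h).
Hypothesis nd : forall x, (forall y, kil x y = 0) -> x = 0.
Local Notation tv := (tv c h P).

Let roots := [seq w <- ws | w != 0].
Let r := size roots.
Let rt (i : 'I_r) := nth 0 roots i.

Let rt_mem i : rt i \in ws.
Proof. by have := mem_nth 0 (ltn_ord i); rewrite mem_filter => /andP[]. Qed.

Let rt_neq0 i : rt i != 0.
Proof. by have := mem_nth 0 (ltn_ord i); rewrite mem_filter => /andP[]. Qed.

Let rt_ex w : w \in ws -> w != 0 -> exists i, rt i = w.
Proof.
move=> wws w0; have wr : w \in roots by rewrite mem_filter w0.
have wi : (index w roots < r)%N by rewrite index_mem.
by exists (Ordinal wi); rewrite /rt nth_index.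
Qed.

Let rt_inj : injective rt.
Proof.
move=> i j /eqP; rewrite /rt nth_uniq ?filter_uniq ?(wd_uniq wd) // => /eqP E.
exact: val_inj.
Qed.

Let sum_roots (F : 'cV[C]_N -> C) : F 0 = 0 -> \sum_(w <- ws) F w = \sum_i F (rt i).
Proof.
move=> F0; rewrite (bigID (fun w => w != 0)) /= [X in _ + X]big1 ?addr0.
  by rewrite -big_filter (big_nth 0) big_mkord.
by move=> w; rewrite negbK => /eqP ->.
Qed.

Let wt_sym a b : wt a (tv b) = wt b (tv a).
Proof. by rewrite -(killing_tv cs nd) ?(tv_h cs) // killingC (killing_tv cs nd) ?(tv_h cs). Qed.

Let cartan_kil z z' : (z <= h)%MS -> (z' <= h)%MS -> kil z z' = \sum_i wt (rt i) z * wt (rt i) z'.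
Proof.
move=> zh zh'; rewrite (killing_cartan cs) // sum_roots; last by rewrite !wt0 !mulr0.
by apply: eq_bigr => i _; rewrite /mult (rank_root cs nd) // mul1r.
Qed.

Let consistent_eq0 u : consistent h u -> (forall j, wt u (tv (rt j)) = 0) -> u = 0.
Proof.
move=> cu uj; apply: (wt_inj cu); first exact: consistent0.
have tu0 : tv u = 0.
  apply: (cartan_nondeg cs nd) => [|y yh]; first exact: (tv_h cs).
  by rewrite cartan_kil ?(tv_h cs) // big1 // => i _; rewrite wt_sym uj mul0r.
by move=> z zh; rewrite -(killing_tv cs nd) // tu0 killing0l wt0.
Qed.

Theorem root_setting_exists : exists r rho Q0 Q t, @root_setting h r rho Q0 Q t.
Proof.
have /choice[G0 G0E] : forall ij : 'I_r * 'I_r, exists q : rat, wt (rt ij.1) (tv (rt ij.2)) = ratr q.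
  by move=> [i j]; apply: (wt_tv_rat2 cs nd).
pose rho i := \row_j G0 (i, j).
have rhoE i j : ratr (rho i 0 j) = wt (rt i) (tv (rt j)) by rewrite mxE -G0E.
have ci i : consistent h (rt i) by apply: (consistent_mem cs).
have rel i j k : rho i + rho j = rho k <-> rt i + rt j = rt k.
  split=> [E|E].
    apply/eqP; rewrite -subr_eq0; apply/eqP; apply: consistent_eq0.
      by apply: consistentD (consistentN _) => //; apply: consistentD.
    move=> l; rewrite wt_add wt_opp wt_add -!rhoE -E -rmorphD -rmorphB /=.
    by rewrite [(rho i + rho j) _ _]mxE subrr rmorph0.
  apply/rowP => l; apply: (fmorph_inj (ratr : rat -> C)).
  by rewrite [in LHS]mxE rmorphD /= !rhoE -wt_add E.
have relo i j : rho i + rho j = 0 <-> rt i + rt j = 0.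
  split=> [E|E].
    apply: consistent_eq0; first exact: consistentD.
    move=> l; rewrite wt_add -!rhoE -rmorphD /=; move/rowP/(_ l): E.
    by rewrite [LHS]mxE => ->; rewrite mxE rmorph0.
  apply/rowP => l; apply: (fmorph_inj (ratr : rat -> C)).
  by rewrite [in LHS]mxE rmorphD /= !rhoE -wt_add E wt0 mxE rmorph0.
have rho_inj : injective rho.
  move=> i j E; apply: rt_inj; apply/eqP; rewrite -subr_eq0; apply/eqP; apply: consistent_eq0.
    exact: consistentD (consistentN _).
  by move=> l; rewrite wt_add wt_opp -!rhoE E subrr.
have dot i j : ratr (pairing (rho i) (rho j)^T) = wt (rt i) (tv (rt j)).
  rewrite -(killing_tv cs nd) ?(tv_h cs) // cartan_kil ?(tv_h cs) // /pairing mxE rmorph_sum /=.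
  by apply: eq_bigr => l _; rewrite [_^T _ _]mxE rmorphM /= !rhoE !(wt_sym (rt l)).
have neg i : exists j, rt i + rt j = 0.
  have m0 : - rt i != 0 by rewrite oppr_eq0.
  have [j jE] := rt_ex (mem_oppw cs nd (rt_mem i)) m0.
  by exists j; rewrite jE subrr.
have oppE i j : rho i + rho j = 0 -> rt j = - rt i.
  by move=> /relo/eqP; rewrite addrC addr_eq0 => /eqP.
exists r, rho, (P 0), (fun i => P (rt i)), (fun i => tv (rt i)); split.
- rewrite -(wd_sum wd) (bigID (fun w => w == 0)) /=; congr (_ + _).
    have [ws0|ws0] := boolP (0 \in ws).
      rewrite -big_filter (eq_filter (a2 := pred1 0)) // filter_pred1_uniq ?(wd_uniq wd) //.
      by rewrite big_seq1.
    move: (ws0); rewrite (wd_mem wd) negbK => /eqP P0.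
    by rewrite P0 big1 // => w /eqP ->.
  by rewrite -[RHS]big_filter (big_nth 0) big_mkord.
- by move=> x; apply: (cartan_grade0 cs).
- by move=> i; apply: (wd_idem wd).
- by move=> i j ij; apply: (wd_orth wd); rewrite (inj_eq rt_inj).
- exact: (wd_idem wd).
- by move=> i; apply: (wd_orth wd); rewrite eq_sym.
- by move=> i; apply: (wd_orth wd).
- by move=> i; apply: (rank_root cs nd).
- by move=> A Ast; split=> [|i]; apply: (stable_grade cs).
- exact: (cartan_abelian cs nd).
- by move=> i; apply: (tv_h cs).
- by move=> i j x xi; rewrite rhoE; apply: (root_eigen cs nd (rt_mem i) (rt_neq0 i) xi); apply: (tv_h cs).
- move=> i x z xi zh; exists (wt (rt i) z).
  by apply: (root_eigen cs nd (rt_mem i) (rt_neq0 i) xi).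
- by move=> i j k x y /rel <-; apply: (lbr_grade cs).
- move=> i j k x y /rel E xi yj x0 y0.
  by apply: (root_bracket_neq0 cs nd (rt_mem i) (rt_neq0 i) (rt_mem j) (rt_neq0 j)) => //; rewrite E.
- move=> i j x y /oppE E xi yj; apply: (lbr_eigen cs nd xi); rewrite -?E //.
  exact: (root_eigen cs nd (rt_mem i) (rt_neq0 i) xi).
- move=> i j x y ij nk xi yj; apply/eqP/negPn/negP => xy.
  have ijws := grade_mem cs (lbr_grade cs xi yj) xy.
  have ij0 : rt i + rt j != 0 by apply: contra ij => /eqP/relo ->.
  have [k kE] := rt_ex ijws ij0.
  by have /eqP[] := nk k; apply/esym/rel.
- move=> i j x y ij xi yj; apply: (killing_orth cs xi yj).
  by apply: contra ij => /eqP/relo ->.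
- move=> i x y /(cartan_grade0 cs) xh yi; apply: (killing_orth cs xh yi).
  by rewrite add0r.
- move=> i j x y /oppE E xi yj x0 y0.
  by apply: (killing_root_neq0 cs nd (rt_mem i) (rt_neq0 i)); rewrite -?E.
- move=> i; have [j /relo E] := neg i; exists j; apply/eqP.
  by rewrite -addr_eq0 addrC E.
- move=> i j; rewrite -(ltr0q C) dot => d ij.
  have ws' := root_sub cs nd (rt_mem j) (rt_neq0 j) (rt_mem i) d.
  have [k kE] : exists k, rt k = rt i - rt j.
    by apply: rt_ex => //; rewrite subr_eq0 (inj_eq rt_inj).
  have /rel <- : rt k + rt j = rt i by rewrite kE subrK.
  by exists k; rewrite addrK.
- by move=> i j; have := dot i j; rewrite -rhoE => /fmorph_inj.
- exact: rho_inj.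
- move=> i; apply/eqP => E; have : wt (rt i) (tv (rt i)) = 0 by rewrite -rhoE E mxE rmorph0.
  by move/eqP; apply/negP/(wt_tv_neq0 cs nd).
Qed.

End RootSetting.

(** * Combinatorics of roots *)

Section RootCombinatorics.
Variables (d r : nat) (rho : 'I_r -> 'rV[rat]_d).
Local Notation dot x y := (pairing x y^T).
Hypothesis rho_neg : forall i, exists j, rho j = - rho i.
Hypothesis rho_sub : forall i j, 0 < dot (rho i) (rho j) -> i != j ->
  exists k, rho k = rho i - rho j.

Lemma dotC (x y : 'rV[rat]_d) : dot x y = dot y x.
Proof. by rewrite /pairing !mxE; apply: eq_bigr => i _; rewrite !mxE mulrC. Qed.

Lemma dot_sumr (x : 'rV[rat]_d) (I : Type) (s : seq I) (f : I -> 'rV_d) :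
  dot x (\sum_(i <- s) f i) = \sum_(i <- s) dot x (f i).
Proof. by rewrite dotC pairing_sum; apply: eq_bigr => i _; rewrite dotC. Qed.

Lemma sum_gt0_ex (I : eqType) (s : seq I) (f : I -> rat) :
  0 < \sum_(i <- s) f i -> exists2 i, i \in s & 0 < f i.
Proof.
move=> s0; apply: contrapT => h; move: s0; rewrite ltNge big_seq sumr_le0 // => i si.
by rewrite leNgt; apply/negP => fi; apply: h; exists i.
Qed.

Lemma dot_sums_gt0_ex (s1 s2 : seq 'I_r) :
  \sum_(i <- s1) rho i = \sum_(i <- s2) rho i -> \sum_(i <- s1) rho i != 0 ->
  exists i j, [/\ i \in s1, j \in s2 & 0 < dot (rho i) (rho j)].
Proof.
move=> E V0; have := pairing_sq V0.
rewrite {1}pairing_sum => /sum_gt0_ex[i is1]; rewrite E dot_sumr => /sum_gt0_ex[j js2 ij].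
by exists i, j.
Qed.

Variable pos : pred 'I_r.
Hypothesis pos_add : forall i j k, pos i -> pos j -> rho k = rho i + rho j -> pos k.
Hypothesis pos_opp : forall i j, pos i -> pos j -> rho i + rho j != 0.

(** In a vanishing sum some term makes an obtuse angle with the leading one. The sum of the two is a
    positive root, since opposite positive roots are excluded; putting it in their place shortens
    the sum. *)
Lemma pos_pointed (s : seq 'I_r) : all pos s -> \sum_(i <- s) rho i = 0 -> s = [::].
Proof.
have [n] := ubnP (size s); elim: n s => // n IH [//|g s] /= sn /andP[pg ps].
rewrite big_cons => /eqP; rewrite addrC addr_eq0 => /eqP E.
have g0 : rho g != 0.
  by apply/eqP => g0; have := pos_opp pg pg; rewrite g0 addr0 eqxx.
have : 0 < \sum_(i <- s) - dot (rho g) (rho i).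
  by rewrite sumrN -dot_sumr E linearN /= /pairing mulmxN mxE opprK; apply: pairing_sq.
move=> /sum_gt0_ex[i si]; rewrite oppr_gt0 => gi.
have [j jE] := rho_neg i; have pi := allP ps _ si.
have gj : 0 < dot (rho g) (rho j) by rewrite jE dotC pairingN oppr_gt0 dotC.
have [k kE] : exists k, rho k = rho g + rho i.
  have [|k] := rho_sub gj; last by rewrite jE opprK; exists k.
  by apply/eqP => gjE; have := pos_opp pg pi; rewrite gjE jE addNr eqxx.
have ks : k :: rem i s = [::].
  apply: IH.
  - by rewrite /= size_rem // prednK //; case: (s) si.
  - rewrite /= (pos_add pg pi kE); apply/allP => j' /mem_rem; exact: (allP ps).
  - by rewrite big_cons kE -addrA; have := E; rewrite (big_rem i si) /= => ->; rewrite subrr.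
by [].
Qed.

(** Combinations with natural coefficients become multisets of roots, on which cancellation is an
    induction on size. *)
Definition mseq (m : 'I_r -> nat) : seq 'I_r := flatten [seq nseq (m i) i | i <- enum 'I_r].

Lemma mseq_sum m : \sum_(i <- mseq m) rho i = \sum_i rho i *+ m i.
Proof.
rewrite /mseq big_flatten /= big_map big_enum /=; apply: eq_bigr => i _.
by rewrite big_nseq -Monoid.iteropE.
Qed.

Lemma mseq_size m : size (mseq m) = (\sum_i m i)%N.
Proof.
rewrite /mseq size_flatten /shape -map_comp sumnE big_map big_enum /=.
by apply: eq_bigr => i _; rewrite size_nseq.
Qed.

Lemma mseq_count m i : count_mem i (mseq m) = m i.
Proof.
rewrite /mseq count_flatten -map_comp sumnE big_map big_enum /= (bigD1 i) //=.
rewrite count_nseq /= eqxx mul1n big1 ?addn0 // => j ji.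
by rewrite count_nseq /= (negPf ji).
Qed.

Lemma mseq_mem m i : (i \in mseq m) = (0 < m i)%N.
Proof. by rewrite -has_pred1 has_count mseq_count. Qed.

Lemma pos_indep (a : 'I_r -> rat) : (forall i, 0 <= a i) -> (forall i, ~~ pos i -> a i = 0) ->
  \sum_i a i *: rho i = 0 -> forall i, a i = 0.
Proof.
move=> a0 apos s0; have [D D0 /choice[z zE]] := common_denominator a.
have zn i : z i = `|z i|%N%:Z.
  rewrite gez0_abs // -(ler_int rat) -zE mulr_ge0 ?ler0n //.
have : mseq (fun i => `|z i|%N) = [::].
  apply: pos_pointed.
    apply/allP => i; rewrite mseq_mem; apply: contraTT => /apos ai.
    have := zE i; rewrite ai mulr0 => /esym/eqP; rewrite intr_eq0 => /eqP ->.
    by [].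
  transitivity (D%:R *: \sum_i a i *: rho i); last by rewrite s0 scaler0.
  rewrite mseq_sum scaler_sumr; apply: eq_bigr => i _.
  by rewrite scalerA zE zn -scaler_nat.
move=> m0 i; have : D%:R * a i = 0.
  rewrite zE zn; have := mseq_count (fun i => `|z i|%N) i; rewrite m0 /= => <-.
  by [].
by move/eqP; rewrite mulf_eq0 pnatr_eq0 (gtn_eqF D0) /= => /eqP.
Qed.

Hypothesis pos_total : forall i, pos i \/ exists2 j, pos j & rho j = - rho i.
Variable I : pred 'I_r.
Hypothesis I_pos : forall i, I i -> pos i.
Hypothesis I_up : forall i j k, I i -> pos j -> rho k = rho i + rho j -> I k.

(** These indices form the set [A]: their root spaces generate the ideal. *)
Definition generator i := I i && [forall j, forall k, pos j ==> (rho k == rho i - rho j) ==> ~~ I k].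

Lemma generatorP i j k : generator i -> pos j -> rho k = rho i - rho j -> ~~ I k.
Proof.
move=> /andP[_ /forallP/(_ j)/forallP/(_ k)] h pj kE.
by move: h; rewrite pj kE eqxx.
Qed.

Lemma generatorI i : generator i -> I i.
Proof. by case/andP. Qed.

Lemma generatorPn i : I i -> ~~ generator i -> exists j k, [/\ pos j, I k & rho k = rho i - rho j].
Proof.
move=> Ii; rewrite /generator Ii /= negb_forall => /existsP[j].
rewrite negb_forall => /existsP[k]; rewrite !negb_imply => /and3P[pj /eqP kE].
by move=> nIk; exists j, k; split=> //; move: nIk; case: (I k).
Qed.

(** The left-hand side of the cancellation needs a class stable under subtracting positive roots as
    long as the result is positive; such a subtraction takes a generator out of [I], whence the
    second alternative. *)
Let low i := pos i && (generator i || ~~ I i).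

(* Cancel a pair of elements of the two sides that are at an acute angle: their
   difference is zero or a root. *)
Lemma generator_balance n (gs es bs : seq 'I_r) : (size gs + size es + size bs <= n)%N ->
  all low gs -> all I es -> all pos bs ->
  \sum_(i <- gs) rho i = \sum_(i <- es) rho i + \sum_(i <- bs) rho i ->
  (size es <= size gs)%N /\
  (size es = size gs -> [/\ bs = [::], all generator es & perm_eq gs es]).
Proof.
elim: n gs es bs => [|n IH] gs es bs sn lgs Ies pbs E.
  by case: gs es bs sn {lgs Ies pbs E} => [|? ?] [|? ?] [|? ?].
have pgs : all pos gs by apply: sub_all lgs => i /andP[].
have pes : all pos es by apply: sub_all Ies => i /I_pos.
have [gs0|gs0] := eqVneq gs [::].
  have : es ++ bs = [::].
    apply: pos_pointed; first by rewrite all_cat pes pbs.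
    by rewrite big_cat /= -E gs0 big_nil.
  by move: E; rewrite gs0; case: (es); case: (bs).
have V0 : \sum_(i <- gs) rho i != 0.
  by apply: contra gs0 => /eqP /(pos_pointed pgs) ->.
have [g [z [gin zin gz]]] : exists i j, [/\ i \in gs, j \in es ++ bs & 0 < dot (rho i) (rho j)].
  by apply: dot_sums_gt0_ex; rewrite ?big_cat.
have lg := allP lgs _ gin; have pg := allP pgs _ gin.
have lrem : all low (rem g gs) by apply/allP => i /mem_rem; exact: (allP lgs).
have srem : size gs = (size (rem g gs)).+1 by rewrite size_rem // prednK //; case: (gs) gin.
have Egs : \sum_(i <- gs) rho i = rho g + \sum_(i <- rem g gs) rho i by rewrite (big_rem g gin).
have pgeq : perm_eq gs (g :: rem g gs) by apply: perm_to_rem.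
have diff : g = z \/ (exists2 k, pos k & rho k = rho g - rho z) \/
    (exists2 k, pos k & rho k = rho z - rho g).
  have [->|gz'] := eqVneq g z; first by left.
  right; have [k kE] := rho_sub gz gz'; have [pk|[l pl lE]] := pos_total k.
    by left; exists k.
  by right; exists l => //; rewrite lE kE opprB.
move: zin; rewrite mem_cat => /orP[zin|zin]; last first.
  have pz := allP pbs _ zin.
  have prem : all pos (rem z bs) by apply/allP => i /mem_rem; exact: (allP pbs).
  have sremb : size bs = (size (rem z bs)).+1 by rewrite size_rem // prednK //; case: (bs) zin.
  have Ebs : \sum_(i <- bs) rho i = rho z + \sum_(i <- rem z bs) rho i by rewrite (big_rem z zin).
  case: diff => [gzE|[[k pk kE]|[k pk kE]]].
  - have [|//|//|//||le _] := IH (rem g gs) es (rem z bs).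
    + by move: sn; rewrite srem sremb /=; move: (size (rem g gs)) (size (rem z bs)) (size es); clear; move=> p q t; lia.
    + by move: E; rewrite Egs Ebs gzE addrCA => /addrI.
    + by rewrite srem; split=> [|eq]; [exact: leqW|rewrite eq ltnn in le].
  - have nIk : ~~ I k.
      case/andP: lg => _ /orP[gg|nIg]; first exact: generatorP gg pz kE.
      by apply: contra nIg => Ik; apply: (I_up Ik pz); rewrite kE subrK.
    have [||//|//||le eqc] := IH (k :: rem g gs) es (rem z bs).
    + by move: sn; rewrite srem sremb /=; move: (size (rem g gs)) (size (rem z bs)) (size es); clear; move=> p q t; lia.
    + by rewrite /= lrem /low pk nIk orbT.
    + rewrite big_cons kE; move: E; rewrite Egs Ebs => E.
      apply: (addrI (rho z)); rewrite [RHS]addrCA -E addrA; congr (_ + _).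
      by rewrite addrC subrK.
    (* The new left element [k] lies outside [I], so the left side cannot be a rearrangement of
       [es], and the equality case is void. *)
    + rewrite /= -srem in le eqc; split=> // eq; have [_ _ pe] := eqc eq.
      have : k \in es by rewrite -(perm_mem pe) mem_head.
      by move=> /(allP Ies) Ik; rewrite Ik in nIk.
  - have [|//|//|||le _] := IH (rem g gs) es (k :: rem z bs).
    + by move: sn; rewrite srem sremb /=; move: (size (rem g gs)) (size (rem z bs)) (size es); clear; move=> p q t; lia.
    + by rewrite /= pk prem.
    + rewrite big_cons kE; move: E; rewrite Egs Ebs => E.
      apply: (addrI (rho g)); rewrite E [RHS]addrCA; congr (_ + _).
      by rewrite addrA; congr (_ + _); rewrite addrC subrK.
    + by rewrite srem; split=> [|eq]; [exact: leqW|rewrite eq ltnn in le].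
have Iz := allP Ies _ zin.
have Irem : all I (rem z es) by apply/allP => i /mem_rem; exact: (allP Ies).
have sreme : size es = (size (rem z es)).+1 by rewrite size_rem // prednK //; case: (es) zin.
have Ees : \sum_(i <- es) rho i = rho z + \sum_(i <- rem z es) rho i by rewrite (big_rem z zin).
case: diff => [gzE|[[k pk kE]|[k pk kE]]].
- have gg : generator g by move: lg; rewrite /low gzE Iz orbF => /andP[].
  have [|//|//|//||le eqc] := IH (rem g gs) (rem z es) bs.
  + by move: sn; rewrite srem sreme /=; move: (size (rem g gs)) (size (rem z es)) (size bs); clear; move=> p q t; lia.
  + by move: E; rewrite Egs Ees gzE -addrA => /addrI.
  split=> [|eq]; first by rewrite srem sreme.
  have [|-> ge pe] := eqc; first by rewrite srem sreme in eq; case: eq.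
  split=> //.
    by rewrite (perm_all _ (perm_to_rem zin)) /= ge andbT -gzE.
  rewrite (perm_trans pgeq) // perm_sym (perm_trans (perm_to_rem zin)) // -{1}gzE perm_cons.
  by rewrite perm_sym.
- have Ig : I g by apply: (I_up Iz pk); rewrite kE addrC subrK.
  have gg : generator g by move: lg; rewrite /low Ig orbF => /andP[].
  have := @generatorP g k z gg pk; rewrite Iz kE opprB addrC subrK => /(_ erefl).
  by [].
- have [|//|//|||le eqc] := IH (rem g gs) (rem z es) (k :: bs).
  + by move: sn; rewrite srem sreme /=; move: (size (rem g gs)) (size (rem z es)) (size bs); clear; move=> p q t; lia.
  + by rewrite /= pk pbs.
  + rewrite big_cons kE; move: E; rewrite Egs Ees => E.
    apply: (addrI (rho g)); rewrite E -addrA addrCA [RHS]addrCA; congr (_ + _).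
    by rewrite [RHS]addrA [rho g + _]addrC subrK.
  + split=> [|eq]; first by rewrite srem sreme.
    by have [|//] := eqc; rewrite srem sreme in eq; case: eq.
Qed.

(** After clearing denominators, the negative part of [b] is moved to the side of [a], which gives
    an equality between sums over multisets. The sign of the sum of [b] bounds the sizes in the
    direction opposite to [generator_balance], so its equality case applies. *)
Lemma generator_rat (a b : 'I_r -> rat) : (forall i, 0 <= a i) ->
  (forall i, ~~ pos i -> a i = 0) -> (forall i, ~~ generator i -> b i = 0) ->
  \sum_i b i <= 0 -> \sum_i b i *: rho i = \sum_i a i *: rho i ->
  forall i, a i = 0 /\ b i = 0.
Proof.
move=> a0 apos bgen sb E.
have [D D0 hD] := common_denominator (fun x : 'I_r + 'I_r => match x with inl i => a i | inr i => b i end).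
have /choice[za zaE] : forall i, exists z : int, D%:R * a i = z%:~R by move=> i; exact: hD (inl i).
have /choice[zb zbE] : forall i, exists z : int, D%:R * b i = z%:~R by move=> i; exact: hD (inr i).
have Dn0 : D%:R != 0 :> rat by rewrite pnatr_eq0 (gtn_eqF D0).
pose g i := if 0 <= zb i then `|zb i|%N else 0%N.
pose e i := if 0 <= zb i then 0%N else `|zb i|%N.
pose f i := `|za i|%N.
have zaf i : za i = f i.
  by rewrite /f gez0_abs // -(ler_int rat) -zaE mulr_ge0 ?ler0n.
have zbge i : zb i = (g i)%:Z - (e i)%:Z.
  rewrite /g /e; case: ifP => [z0|/negbT]; first by rewrite gez0_abs // subr0.
  by rewrite -ltNge => z0; rewrite sub0r ltz0_abs // opprK.
have zb0 i : zb i = 0 -> g i = 0%N /\ e i = 0%N by rewrite /g /e => ->.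
have ngen i : ~~ generator i -> zb i = 0.
  by move=> /bgen bi; apply/eqP; rewrite -(intr_eq0 rat) -zbE bi mulr0.
have npos i : ~~ pos i -> f i = 0%N.
  move=> /apos ai; apply/eqP; rewrite -eqz_nat -zaf -(intr_eq0 rat) -zaE ai mulr0 //.
have H := @generator_balance _ (mseq g) (mseq e) (mseq f) (leqnn _).
have [||||] := H.
- apply/allP => i; rewrite mseq_mem /low; case: (boolP (generator i)) => [gi _|/ngen/zb0[->]] //.
  by rewrite I_pos // generatorI.
- apply/allP => i; rewrite mseq_mem; case: (boolP (generator i)) => [gi _|/ngen/zb0[_ ->]] //.
  exact: generatorI.
- by apply/allP => i; rewrite mseq_mem; case: (boolP (pos i)) => // /npos ->.
- rewrite !mseq_sum; apply/eqP; rewrite addrC -subr_eq -sumrB; apply/eqP.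
  transitivity (D%:R *: \sum_i b i *: rho i).
    rewrite scaler_sumr; apply: eq_bigr => i _.
    by rewrite scalerA zbE zbge rmorphB /= scalerBl -!scaler_nat.
  rewrite E scaler_sumr; apply: eq_bigr => i _.
  by rewrite scalerA zaE zaf -scaler_nat.
rewrite !mseq_size => le eqc.
have eqs : (\sum_i e i = \sum_i g i)%N.
  apply/eqP; rewrite eqn_leq le -(ler_nat rat) !natr_sum -subr_le0 -sumrB.
  have -> : \sum_i ((g i)%:R - (e i)%:R) = D%:R * \sum_i b i :> rat.
    by rewrite mulr_sumr; apply: eq_bigr => i _; rewrite zbE zbge rmorphB.
  by rewrite mulr_ge0_le0 // ler0n.
have [f0 _ pe] := eqc eqs.
move=> i; split; apply: (mulfI Dn0); rewrite mulr0.
  by rewrite zaE zaf -(mseq_count f i) f0.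
have := permP pe (pred1 i); rewrite !mseq_count => gei.
by rewrite zbE zbge gei subrr.
Qed.

Lemma generator_indep (b : 'I_r -> rat) : (forall i, ~~ generator i -> b i = 0) ->
  \sum_i b i *: rho i = 0 -> forall i, b i = 0.
Proof.
move=> bg s0 i; have z0 : \sum_i (0 : rat) *: rho i = 0.
  by rewrite big1 // => j _; rewrite scale0r.
have r0 (j : 'I_r) : 0 <= (fun=> 0) j :> rat by [].
have n0 (j : 'I_r) : ~~ pos j -> (fun=> 0) j = 0 :> rat by [].
case: (lerP (\sum_i b i) 0) => sb.
  by have [] := generator_rat r0 n0 bg sb (etrans s0 (esym z0)) i.
have bg' j : ~~ generator j -> - b j = 0 by move=> /bg ->; rewrite oppr0.
have sb' : \sum_i - b i <= 0 by rewrite sumrN oppr_le0 ltW.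
have s0' : \sum_i - b i *: rho i = 0.
  by rewrite (eq_bigr (fun i => - (b i *: rho i))) => [|j _]; rewrite ?sumrN ?s0 ?oppr0 ?scaleNr.
have [_ /eqP] := generator_rat r0 n0 bg' sb' (etrans s0' (esym z0)) i.
by rewrite oppr_eq0 => /eqP.
Qed.

(** A functional constant on the generators is one that kills the span [S] of their differences, so
    Gordan's alternative is applied modulo [S]. Its second case would make a nontrivial nonnegative
    combination of positive roots equal to a combination of generators with coefficient sum 0, which
    [generator_rat] excludes. *)
Lemma generator_functional : exists mu nu, (forall i, pos i -> 0 < pairing (rho i) mu) /\
  (forall i, generator i -> pairing (rho i) mu = nu).
Proof.
pose S : 'M[rat]_d := (\sum_(p : 'I_r * 'I_r | generator p.1 && generator p.2)
  <<rho p.1 - rho p.2>>)%MS.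
have [[w hw]|[a [a0 apos [i ai] s0]]] := gordan_fin pos (fun i => rho i *m cokermx S).
  exists (cokermx S *m w); have E i : pairing (rho i) (cokermx S *m w) = pairing (rho i *m cokermx S) w.
    by rewrite /pairing mulmxA.
  case: (pickP generator) => [i0 gi0|g0]; last first.
    by exists 0; split=> i; rewrite ?g0 // => /hw; rewrite E.
  exists (pairing (rho i0) (cokermx S *m w)); split=> i; first by move/hw; rewrite E.
  move=> gi; apply/eqP; rewrite -subr_eq0 -pairingB /pairing mulmxA.
  suff -> : (rho i - rho i0) *m cokermx S = 0 by rewrite mul0mx mxE.
  apply/eqP; rewrite -submxE /S (sumsmx_sup (i, i0)) ?gi //=.
  by rewrite genmxE.
pose va := \sum_i a i *: rho i; have : (va <= S)%MS.
  by rewrite submxE mulmx_suml -[X in _ == X]s0; apply/eqP/eq_bigr => j _; rewrite -scalemxAl.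
move=> /sub_sumsmxP[u uE].
have [b [bg sb bE]] : exists b : 'I_r -> rat, [/\ forall i, ~~ generator i -> b i = 0,
    \sum_i b i = 0 & va = \sum_i b i *: rho i].
  rewrite uE; elim/big_ind: _.
  - by exists (fun=> 0); split=> //; rewrite big1 // => j _; rewrite scale0r.
  - move=> x y [b1 [g1 s1 ->]] [b2 [g2 s2 ->]]; exists (fun i => b1 i + b2 i); split.
    + by move=> j nj; rewrite g1 // g2 // addr0.
    + by rewrite big_split /= s1 s2 addr0.
    + by rewrite -big_split; apply: eq_bigr => j _; rewrite scalerDl.
  move=> [j k] /= /andP[gj gk].
  have /submxP[q ->] : (u (j, k) *m <<rho j - rho k>> <= rho j - rho k)%MS.
    by rewrite (submx_trans (submxMl _ _)) // genmxE.
  exists (fun i => q 0 0 * ((i == j)%:R - (i == k)%:R)); split.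
  - move=> l nl; have -> : (l == j) = false by apply: contraNF nl => /eqP ->.
    have -> : (l == k) = false by apply: contraNF nl => /eqP ->.
    by rewrite subrr mulr0.
  - have one m : \sum_(i < r) (i == m)%:R = 1 :> rat.
      by rewrite (bigD1 m) //= eqxx big1 ?addr0 // => l /negPf ->.
    by rewrite -mulr_sumr sumrB !one subrr mulr0.
  rewrite {1}[q]mx11_scalar mul_scalar_mx.
  rewrite (eq_bigr (fun i => q 0 0 *: ((i == j)%:R *: rho i - (i == k)%:R *: rho i))); last first.
    by move=> l _; rewrite -scalerA scalerBl.
  rewrite -scaler_sumr sumrB; congr (_ *: (_ - _)).
    by rewrite (bigD1 j) //= eqxx scale1r big1 ?addr0 // => l /negPf ->; rewrite scale0r.
  by rewrite (bigD1 k) //= eqxx scale1r big1 ?addr0 // => l /negPf ->; rewrite scale0r.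
have sb0 : \sum_i b i <= 0 by rewrite sb.
have [ai0 _] := generator_rat a0 apos bg sb0 (esym bE) i.
by rewrite ai0 ltxx in ai.
Qed.

(** The generators are independent and the form is positive definite, so their Gram matrix is
    invertible. Zero rows at the other indices keep it indexed by all roots; the right-hand side [G]
    vanishes there too, which makes the system solvable. *)
Lemma generator_solve (g : 'I_r -> rat) : exists cf : 'I_r -> rat,
  (forall i, ~~ generator i -> cf i = 0) /\
  forall j, generator j -> \sum_i cf i * dot (rho i) (rho j) = g j.
Proof.
pose X := \matrix_i (if generator i then rho i else 0).
have Xdot i j : (X *m X^T) i j = if generator i && generator j then dot (rho i) (rho j) else 0.
  have -> : (X *m X^T) i j = dot (row i X) (row j X).
    by rewrite /pairing !mxE; apply: eq_bigr => k _; rewrite !mxE.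
  rewrite !rowK; case: ifP => gi; last by rewrite pairing0.
  by case: ifP => gj //=; rewrite dotC pairing0.
pose G := \row_j (if generator j then g j else 0).
suff /submxP[u uE] : (G <= X *m X^T)%MS.
  exists (fun i => if generator i then u 0 i else 0); split=> [i /negPf -> //|j gj].
  have := congr1 (fun M : 'rV_r => M 0 j) uE; rewrite !mxE gj => ->.
  by apply: eq_bigr => i _; rewrite Xdot gj andbT; case: ifP => _; rewrite ?mul0r ?mulr0.
rewrite submxE; apply/eqP/rowP => l; rewrite mxE mxE big1 // => j _; rewrite mxE.
case: ifP => gj; last by rewrite mul0r.
pose y := col l (cokermx (X *m X^T)).
have XXy : X *m X^T *m y = 0 by rewrite /y colE mulmxA mulmx_coker mul0mx.
have yX : y^T *m X = 0.
  apply/eqP/negPn/negP => /pairing_sq; rewrite /pairing trmx_mul trmxK mulmxA -(mulmxA y^T).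
  by rewrite -mulmxA XXy mulmx0 mxE ltxx.
have y0 := @generator_indep (fun i => if generator i then y i 0 else 0).
suff : (if generator j then y j 0 else 0) = 0 by rewrite gj mxE => ->; rewrite mulr0.
apply: y0 => [i /negPf -> //|].
rewrite -[RHS]yX mulmx_sum_row; apply: eq_bigr => i _; rewrite rowK [y^T _ _]mxE.
by case: ifP => _; rewrite ?scale0r ?scaler0.
Qed.

End RootCombinatorics.

(** * Components of brackets in the root decomposition *)

Section RootCalculus.
Variables (C : numClosedFieldType) (n' : nat).
Local Notation N := n'.+1.
Variable c : struct_const C N.
Implicit Types (x y z : 'rV[C]_N) (A B D : 'M[C]_N).
Local Notation "[ x , y ]" := (lbr c x y).
Local Notation kil := (killing c).
Hypothesis lie : is_lie_algebra c.
Variables (h : 'M[C]_N) (r : nat) (rho : 'I_r -> 'rV[rat]_r)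
  (Q0 : 'M[C]_N) (Q : 'I_r -> 'M[C]_N) (t : 'I_r -> 'rV[C]_N).
Hypothesis rs : root_setting c h rho Q0 Q t.

Lemma root_decomp x : x = x *m Q0 + \sum_i x *m Q i.
Proof. by rewrite -mulmx_sumr -mulmxDr (rs_sum rs) mulmx1. Qed.

Lemma rootQQ x i j : x *m Q i *m Q j = if i == j then x *m Q i else 0.
Proof.
rewrite -mulmxA; case: eqP => [->|/eqP ij]; first by rewrite (rs_idem rs).
by rewrite (rs_orth rs) // mulmx0.
Qed.

Lemma rootQQ0 x i : x *m Q i *m Q0 = 0.
Proof. by rewrite -mulmxA (rs_orth0r rs) mulmx0. Qed.

Lemma rootQ0Q x i : x *m Q0 *m Q i = 0.
Proof. by rewrite -mulmxA (rs_orth0l rs) mulmx0. Qed.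

Lemma cartanQ x : (x <= h)%MS -> x *m Q0 = x.
Proof. by move/(rs_cartan rs). Qed.

Lemma Q0_cartan x : (x *m Q0 <= h)%MS.
Proof. by apply/(rs_cartan rs); rewrite -mulmxA (rs_idem0 rs). Qed.

Lemma cartanQi x i : (x <= h)%MS -> x *m Q i = 0.
Proof. by move=> /cartanQ <-; rewrite rootQ0Q. Qed.

Lemma rootQi0 x i : x *m Q i = x -> x *m Q0 = 0.
Proof. by move=> <-; rewrite rootQQ0. Qed.

Lemma rootQij x i j : x *m Q i = x -> i != j -> x *m Q j = 0.
Proof. by move=> <- ij; rewrite rootQQ (negPf ij). Qed.

Lemma root_eqP x y : x *m Q0 = y *m Q0 -> (forall i, x *m Q i = y *m Q i) -> x = y.
Proof.
move=> e0 e; rewrite (root_decomp x) (root_decomp y) e0; congr (_ + _).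
by apply: eq_bigr.
Qed.

Definition root_vec i := nz_row (Q i).

Lemma root_vec_neq0 i : root_vec i != 0.
Proof. by rewrite nz_row_eq0 -mxrank_eq0 (rs_rank rs). Qed.

Lemma root_vecQ i : root_vec i *m Q i = root_vec i.
Proof. by rewrite /root_vec; have /submxP[d ->] := nz_row_sub (Q i); rewrite rootQQ eqxx. Qed.

Lemma root_vecE i x : x *m Q i = x -> exists k, x = k *: root_vec i.
Proof.
move=> xi; have le : (root_vec i <= Q i)%MS := nz_row_sub (Q i).
have : (Q i <= root_vec i)%MS.
  by rewrite -(geq_leqif (mxrank_leqif_sup le)) (rs_rank rs) rank_rV root_vec_neq0.
have xQ : (x <= Q i)%MS by rewrite -xi submxMl.
move=> /(submx_trans xQ)/submxP[d ->]; exists (d 0 0).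
by rewrite {1}[d]mx11_scalar mul_scalar_mx.
Qed.

Lemma root_sub_mx i x m (A : 'M_(m, N)) : x *m Q i = x -> x != 0 -> (x <= A)%MS -> (Q i <= A)%MS.
Proof.
move=> xi x0 xA; have [k kE] := root_vecE xi.
have k0 : k != 0 by apply: contraNneq x0 => k0; rewrite kE k0 scale0r.
apply/row_subP => j; have [l ->] : exists l, row j (Q i) = l *: root_vec i.
  by apply: root_vecE; rewrite -row_mul (rs_idem rs).
have -> : root_vec i = k^-1 *: x by rewrite kE scalerA mulVf // scale1r.
by rewrite !scalemx_sub.
Qed.

Lemma stableQ A i x : stable (adh c h) A -> (x <= A)%MS -> (x *m Q i <= A)%MS.
Proof. by move=> /(rs_stable rs)[_ /(_ i)] AQ xA; rewrite (submx_trans (submxMr _ xA)). Qed.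

Lemma stableQ0 A x : stable (adh c h) A -> (x <= A)%MS -> (x *m Q0 <= A)%MS.
Proof. by move=> /(rs_stable rs)[AQ _] xA; rewrite (submx_trans (submxMr _ xA)). Qed.

Lemma eigenQ z x i : (z <= h)%MS -> exists k, [z, x *m Q i] = k *: (x *m Q i).
Proof. by apply: (rs_eigen rs (i := i)); rewrite rootQQ eqxx. Qed.

Lemma cartan_bracket z x i : (z <= h)%MS -> [z, x] *m Q i = [z, x *m Q i].
Proof.
move=> zh; rewrite {1}(root_decomp x) lbrDr lbr_sumr mulmxDl (rs_abel rs) ?Q0_cartan //.
rewrite mul0mx add0r mulmx_suml (bigD1 i) //= big1 ?addr0 => [|j ji].
  have [k ->] := eigenQ x i zh.
  by rewrite -scalemxAl rootQQ eqxx.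
have [k ->] := eigenQ x j zh.
by rewrite -scalemxAl rootQQ (negPf ji) scaler0.
Qed.

Lemma bracketQ x y k : [x, y] *m Q k = [x *m Q0, y *m Q k] - [y *m Q0, x *m Q k] +
  \sum_(p : 'I_r * 'I_r | rho p.1 + rho p.2 == rho k) [x *m Q p.1, y *m Q p.2].
Proof.
rewrite {1}(root_decomp x) lbrDl mulmxDl cartan_bracket ?Q0_cartan // -addrA; congr (_ + _).
rewrite lbr_suml {1}(root_decomp y).
under eq_bigr => i _ do rewrite lbrDr lbr_sumr.
rewrite big_split mulmxDl -lbr_suml (lbrC lie) mulNmx cartan_bracket ?Q0_cartan //=.
congr (- _ + _).
  rewrite mulmx_suml (bigD1 k) //= rootQQ eqxx big1 ?addr0 // => i ik.
  by rewrite rootQQ (negPf ik).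
rewrite pair_big /= mulmx_suml (bigID (fun p : 'I_r * 'I_r => rho p.1 + rho p.2 == rho k)) /=.
rewrite [X in _ + X]big1 ?addr0; last first.
  move=> [i j] /= ijk; have [ij0|ij0] := eqVneq (rho i + rho j) 0.
    rewrite (rs_opp rs ij0) ?rootQQ ?eqxx // -scalemxAl.
    by rewrite (cartanQi k (rs_th rs i)) scaler0.
  have [[l lE]|nl] := pselect (exists l, rho l = rho i + rho j).
    have lk : l != k by apply: contraNneq ijk => <-; rewrite lE.
    by apply: (rootQij _ lk); apply: (rs_add rs (esym lE)); rewrite rootQQ eqxx.
  rewrite (rs_out rs ij0) ?mul0mx ?rootQQ ?eqxx // => l; apply/eqP => lE.
  by apply: nl; exists l.
by apply: eq_bigr => -[i j] /= /eqP E; apply: (rs_add rs E); rewrite rootQQ eqxx.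
Qed.

Lemma bracketQ0 x y : [x, y] *m Q0 =
  \sum_(p : 'I_r * 'I_r | rho p.1 + rho p.2 == 0) kil (x *m Q p.1) (y *m Q p.2) *: t p.1.
Proof.
have z0 z z' : (z <= h)%MS -> [z, z'] *m Q0 = 0.
  move=> zh; rewrite {1}(root_decomp z') lbrDr lbr_sumr mulmxDl (rs_abel rs) ?Q0_cartan //.
  rewrite mul0mx add0r mulmx_suml big1 // => j _.
  have [k ->] := eigenQ z' j zh.
  by rewrite -scalemxAl rootQQ0 scaler0.
rewrite {1}(root_decomp x) lbrDl mulmxDl z0 ?Q0_cartan // add0r.
rewrite lbr_suml {1}(root_decomp y).
under eq_bigr => i _ do rewrite lbrDr lbr_sumr.
rewrite big_split mulmxDl -lbr_suml (lbrC lie) mulNmx z0 ?Q0_cartan //= oppr0 add0r.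
rewrite pair_big /= mulmx_suml (bigID (fun p : 'I_r * 'I_r => rho p.1 + rho p.2 == 0)) /=.
rewrite [X in _ + X]big1 ?addr0; last first.
  move=> [i j] /= ij0.
  have [[l lE]|nl] := pselect (exists l, rho l = rho i + rho j).
    by apply: (@rootQi0 _ l); apply: (rs_add rs (esym lE)); rewrite rootQQ eqxx.
  rewrite (rs_out rs ij0) ?mul0mx ?rootQQ ?eqxx // => l; apply/eqP => lE.
  by apply: nl; exists l.
apply: eq_bigr => -[i j] /= /eqP E; rewrite (rs_opp rs E) ?rootQQ ?eqxx //.
by rewrite -scalemxAl cartanQ // (rs_th rs).
Qed.

Lemma bracket_support x y k : [x, y] *m Q k != 0 ->
  [\/ (x *m Q0 != 0) && (y *m Q k != 0), (y *m Q0 != 0) && (x *m Q k != 0)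
    | exists i j, [/\ x *m Q i != 0, y *m Q j != 0 & rho i + rho j = rho k]].
Proof.
move=> xyk; have [h1|/negPf h1] := boolP ((x *m Q0 != 0) && (y *m Q k != 0)).
  by apply: Or31.
have [h2|/negPf h2] := boolP ((y *m Q0 != 0) && (x *m Q k != 0)).
  by apply: Or32.
apply: Or33; apply: contrapT => nex; case/eqP: xyk; rewrite bracketQ.
rewrite big1 ?addr0 => [|[i j] /= /eqP E].
  suff -> : [x *m Q0, y *m Q k] = 0.
    suff -> : [y *m Q0, x *m Q k] = 0 by rewrite subr0.
    move: h2; case: eqP => [->|_]; first by rewrite lbr0l.
    by case: eqP => // ->; rewrite lbr0r.
  move: h1; case: eqP => [->|_]; first by rewrite lbr0l.
  by case: eqP => // ->; rewrite lbr0r.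
have [->|xi] := eqVneq (x *m Q i) 0; first by rewrite lbr0l.
have [->|yj] := eqVneq (y *m Q j) 0; first by rewrite lbr0r.
by case: nex; exists i, j.
Qed.

Lemma bracket_support0 x y : [x, y] *m Q0 != 0 ->
  exists i j, [/\ x *m Q i != 0, y *m Q j != 0 & rho i + rho j = 0].
Proof.
move=> xy0; apply: contrapT => nex; case/eqP: xy0; rewrite bracketQ0 big1 // => -[i j] /= /eqP E.
have [->|xi] := eqVneq (x *m Q i) 0; first by rewrite killing0l scale0r.
have [->|yj] := eqVneq (y *m Q j) 0; first by rewrite killing0r scale0r.
by case: nex; exists i, j.
Qed.

(** A sum of matrices rather than of row spaces: it is at once the subspace and the projection onto
    it. *)
Definition root_span (K : pred 'I_r) : 'M[C]_N := \sum_(i | K i) Q i.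

Lemma root_spanP (K : pred 'I_r) x : (x <= root_span K)%MS <->
  x *m Q0 = 0 /\ forall i, ~~ K i -> x *m Q i = 0.
Proof.
split=> [/submxP[d ->]|[x0 xK]].
  rewrite /root_span mulmx_sumr mulmx_suml big1 => [|i Ki]; last by rewrite rootQQ0.
  split=> // i /negPf nKi; rewrite mulmx_suml big1 // => j Kj; rewrite rootQQ.
  by case: eqP => // jE; rewrite -jE Kj in nKi.
rewrite (root_decomp x) x0 add0r (bigID K) /= [X in _ + X]big1 ?addr0 => [|i /xK ->] //.
by rewrite -mulmx_sumr submxMl.
Qed.

Lemma tE_neq0 i : t i != 0.
Proof.
apply/eqP => t0; have := rs_t rs i (root_vecQ i); rewrite t0 lbr0l => /esym/eqP.
rewrite scaler_eq0 (negPf (root_vec_neq0 i)) orbF fmorph_eq0 -(rs_dot rs) gt_eqF //.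
exact/pairing_sq/(rs_neq0 rs).
Qed.

End RootCalculus.

(** * The roots of a Borel subalgebra and of its ideals *)

Section Degrees.
Variables (r d : nat) (rho : 'I_r -> 'rV[rat]_d).

(** The part of linearity that brackets detect; it is what makes [z ^ deg i] act as an
    automorphism. *)
Definition additive_deg (deg : 'I_r -> int) :=
  (forall i j k, rho i + rho j = rho k -> deg i + deg j = deg k) /\
  (forall i j, rho i + rho j = 0 -> deg i + deg j = 0).

Lemma int_functional (mu : 'cV[rat]_d) : exists2 D : nat, (0 < D)%N &
  exists deg, additive_deg deg /\ forall i, D%:R * pairing (rho i) mu = (deg i)%:~R.
Proof.
have [D D0 /choice[deg degE]] := common_denominator (fun i => pairing (rho i) mu).
exists D => //; exists deg; split=> //; split=> [i j k E|i j E].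
  by apply/eqP; rewrite -(eqr_int rat) rmorphD /= -!degE -mulrDr -pairingD E.
by apply/eqP; rewrite -(eqr_int rat) rmorphD /= -!degE -mulrDr -pairingD E pairing0 mulr0.
Qed.

End Degrees.

Section BorelRoots.
Variables (C : numClosedFieldType) (n' : nat).
Local Notation N := n'.+1.
Variable c : struct_const C N.
Implicit Types (x y z : 'rV[C]_N) (A B D : 'M[C]_N).
Local Notation "[ x , y ]" := (lbr c x y).
Hypothesis lie : is_lie_algebra c.
Variables (h : 'M[C]_N) (r : nat) (rho : 'I_r -> 'rV[rat]_r)
  (Q0 : 'M[C]_N) (Q : 'I_r -> 'M[C]_N) (t : 'I_r -> 'rV[C]_N).
Hypothesis rs : root_setting c h rho Q0 Q t.
Variables (b n : 'M[C]_N).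
Hypotheses (Hb : borel_subalg c b) (hb : (h <= b)%MS) (Hn : nilradical c b n).
Hypotheses (Hbn : (h + n == b)%MS) (Hhn : (h :&: n <= (0 : 'M[C]_N))%MS).

Definition pos_root : pred 'I_r := fun i => (Q i <= n)%MS.
Local Notation pos := pos_root.

Lemma ideal_borel_stable A : ideal_of c A b -> stable (adh c h) A.
Proof.
move=> [Ab Ai]; apply/stableP => x y xh yA; rewrite (submx_trans _ Ai) //.
by rewrite mem_brmx ?(submx_trans xh).
Qed.

Lemma nil_ideal : ideal_of c n b.
Proof. by case: Hn. Qed.

Lemma nil_grade0 x : (x <= n)%MS -> x *m Q0 = 0.
Proof.
move=> xn; apply/eqP; rewrite -submx0 (submx_trans _ Hhn) // sub_capmx (Q0_cartan rs).
by rewrite (stableQ0 rs (ideal_borel_stable nil_ideal)).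
Qed.

Lemma nilP x : (x <= n)%MS <-> x *m Q0 = 0 /\ forall i, ~~ pos i -> x *m Q i = 0.
Proof.
split=> [xn|/(root_spanP rs) xr].
  split=> [|i]; first exact: nil_grade0.
  apply: contraNeq => xi; apply: (root_sub_mx rs _ xi); first by rewrite (rootQQ rs) eqxx.
  exact: (stableQ rs _ (ideal_borel_stable nil_ideal)).
by rewrite (submx_trans xr) // /root_span summx_sub.
Qed.

Lemma borelP x : (x <= b)%MS <-> forall i, ~~ pos i -> x *m Q i = 0.
Proof.
have /eqmxP bE := Hbn; split.
  rewrite -bE => /sub_addsmxP[[u v] /= ->] i ni; rewrite mulmxDl.
  rewrite (cartanQi rs) ?submxMl // add0r.
  by have /nilP[_ ->] := submxMl v n.
move=> xi; rewrite -bE -[x](subrK (x *m Q0)) addrC addmx_sub_adds ?(Q0_cartan rs) //.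
apply/nilP; split=> [|i ni]; first by rewrite mulmxBl -mulmxA (rs_idem0 rs) subrr.
by rewrite mulmxBl (rootQ0Q rs) xi // subr0.
Qed.

Lemma borel_pos i : (Q i <= b)%MS -> pos i.
Proof.
move=> Qb; apply: contraT => ni; have := root_vec_neq0 rs i.
have /borelP/(_ i ni) : (root_vec Q i <= b)%MS by rewrite (submx_trans (nz_row_sub _)).
by rewrite (root_vecQ rs) => ->; rewrite eqxx.
Qed.

Lemma root_vec_pos i : pos i -> (root_vec Q i <= n)%MS.
Proof. by move=> pi; rewrite (submx_trans (nz_row_sub _)). Qed.

Lemma nil_borel x : (x <= n)%MS -> (x <= b)%MS.
Proof. by move=> xn; rewrite (submx_trans xn) //; case: nil_ideal. Qed.

Lemma ideal_root_up A i j k : ideal_of c A b -> (Q i <= A)%MS -> pos j ->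
  rho k = rho i + rho j -> (Q k <= A)%MS.
Proof.
move=> [_ Ai] Qi pj kE; have viA : (root_vec Q i <= A)%MS by rewrite (submx_trans (nz_row_sub _)).
have vij : [root_vec Q j, root_vec Q i] *m Q k = [root_vec Q j, root_vec Q i].
  by apply: (rs_add rs (i := j) (j := i)); rewrite ?(root_vecQ rs) // kE addrC.
apply: (root_sub_mx rs vij).
  by apply: (rs_add_neq0 rs (i := j) (j := i) (k := k)); rewrite ?(root_vecQ rs) ?(root_vec_neq0 rs) // kE addrC.
by rewrite (submx_trans _ Ai) // mem_brmx // nil_borel // root_vec_pos.
Qed.

Lemma pos_root_add i j k : pos i -> pos j -> rho k = rho i + rho j -> pos k.
Proof. exact/ideal_root_up/nil_ideal. Qed.

(** Otherwise the bracket of the two root vectors, a nonzero multiple of [t i], would lie in both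
    [h] and [n]. *)
Lemma pos_root_opp i j : pos i -> pos j -> rho i + rho j != 0.
Proof.
move=> pi pj; apply/eqP => E.
have nz := rs_kil_neq0 rs E (root_vecQ rs i) (root_vecQ rs j) (root_vec_neq0 rs i) (root_vec_neq0 rs j).
have ijn : ([root_vec Q i, root_vec Q j] <= n)%MS.
  by rewrite (submx_trans _ nil_ideal.2) // mem_brmx ?nil_borel ?root_vec_pos.
have := nil_grade0 ijn; rewrite (rs_opp rs E) ?(root_vecQ rs) // -scalemxAl.
rewrite (cartanQ rs) ?(rs_th rs) // => /eqP; rewrite scaler_eq0 (negPf nz) /=.
by rewrite (negPf (tE_neq0 rs i)).
Qed.

Section PositiveDegree.
Variable deg : 'I_r -> int.
Hypothesis deg_add : additive_deg rho deg.

Lemma deg_borelP x : (x <= h + root_span Q (fun i => (0 < deg i)%R))%MS <->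
  forall i, ~~ (0 < deg i) -> x *m Q i = 0.
Proof.
split=> [/sub_addsmxP[[u v] /= ->] i ni|xi].
  rewrite mulmxDl (cartanQi rs) ?submxMl // add0r.
  by have /(root_spanP rs)[_ ->] := submxMl v (root_span Q (fun i => 0 < deg i)).
rewrite -[x](subrK (x *m Q0)) addrC addmx_sub_adds ?(Q0_cartan rs) //.
apply/(root_spanP rs); split=> [|i ni]; first by rewrite mulmxBl -mulmxA (rs_idem0 rs) subrr.
by rewrite mulmxBl (rootQ0Q rs) xi // subr0.
Qed.

Let bd : 'M[C]_N := (h + root_span Q (fun i => (0 < deg i)%R))%MS.

Lemma deg_bracket a x y : (forall i, x *m Q i != 0 -> a < deg i) ->
  (forall i, y *m Q i != 0 -> a < deg i) -> 0 <= a -> [x, y] *m Q0 = 0.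
Proof.
move=> hx hy a0; apply/eqP; apply: contraT => /(bracket_support0 lie rs)[i [j [/hx xi /hy yj E]]].
by have := deg_add.2 _ _ E; lia.
Qed.

Lemma deg_borel_subalg : subalg c bd.
Proof.
apply: brmx_sub => x y /deg_borelP xd /deg_borelP yd; apply/deg_borelP => k.
apply: contraNeq => /(bracket_support lie rs)[].
- by case/andP=> _; apply: contraNT => /yd ->; rewrite eqxx.
- by case/andP=> _; apply: contraNT => /xd ->; rewrite eqxx.
move=> [i [j [xi yj E]]]; rewrite -(deg_add.1 _ _ _ E) addr_gt0 //.
  by apply: contraNT xi => /xd ->.
by apply: contraNT yj => /yd ->.
Qed.

Lemma deg_borel_solvable : solvable_alg c bd.
Proof.
have FP (a : int) x : (x <= root_span Q (fun i => (a < deg i)%R))%MS -> forall i, x *m Q i != 0 -> a < deg i.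
  by move=> /(root_spanP rs)[_ xa] i; apply: contraNT => /xa ->.
have F1 : (brmx c bd bd <= root_span Q (fun i => (0 < deg i)%R))%MS.
  apply: brmx_sub => x y xd yd; apply/(root_spanP rs); split; last first.
    by apply/deg_borelP; rewrite (submx_trans _ deg_borel_subalg) // mem_brmx.
  move/deg_borelP: xd => xd; move/deg_borelP: yd => yd.
  apply: (@deg_bracket 0) => // i; apply: contraNT => di.
    exact/eqP/xd.
  exact/eqP/yd.
have FS k : (derived_series c bd k.+1 <= root_span Q (fun i => (k%:Z < deg i)%R))%MS.
  elim: k => [|k IH]; first exact: F1.
  apply: brmx_sub => x y /submx_trans/(_ IH) xd /submx_trans/(_ IH) yd.
  have x0 : x *m Q0 = 0 by have /(root_spanP rs)[] := xd.
  have y0 : y *m Q0 = 0 by have /(root_spanP rs)[] := yd.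
  move/FP: xd => xd; move/FP: yd => yd.
  apply/(root_spanP rs); split; first exact: deg_bracket xd yd _.
  move=> l; apply: contraNeq => /(bracket_support lie rs)[]; rewrite ?x0 ?y0 ?eqxx //.
  by move=> [i [j [/xd xi /yd yj E]]]; rewrite -(deg_add.1 _ _ _ E); lia.
exists (\sum_i `|deg i|).+1%N; apply: (submx_trans (FS _)).
rewrite /root_span big1 // => i; rewrite ltNge (bigD1 i) //=; lia.
Qed.

(** [h] and the root spaces of positive degree span a solvable subalgebra [bd] containing [b]; the
    maximality of [b] leaves no room for another root. *)
Lemma deg_borel_max : (forall i, pos i -> 0 < deg i) -> forall i, 0 < deg i -> pos i.
Proof.
move=> pd i di; apply: borel_pos.
have bbd : (b <= bd)%MS.
  apply/row_subP => j; have /borelP bj := row_sub j b.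
  by apply/deg_borelP => k nk; apply: bj; apply: contra nk; apply: pd.
have [_ [_ bmax]] := Hb; apply: submx_trans (bmax _ deg_borel_subalg deg_borel_solvable bbd).
rewrite (submx_trans _ (addsmxSr _ _)) //; apply/row_subP => j; apply/(root_spanP rs).
split; first by rewrite -row_mul (rs_orth0r rs) row0.
by move=> k nk; rewrite -row_mul (rs_orth rs) ?row0 //; apply: contraNneq nk => <-.
Qed.

End PositiveDegree.

(* By Gordan's alternative and the maximality of [b], if neither [rho i] nor
   [- rho i] is positive, each of them is cancelled by a nonnegative combination
   of positive roots; adding the two relations contradicts the independence of
   nonnegative combinations. *)
Lemma pos_root_total i : pos i \/ exists2 j, pos j & rho j = - rho i.
Proof.
have [pi|ni] := boolP (pos i); first by left.
have [j jE] := rs_neg rs i; have [pj|nj] := boolP (pos j); first by right; exists j.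
have step l : ~~ pos l -> exists a : 'I_r -> rat, [/\ forall i, 0 <= a i, forall i, ~~ pos i -> i != l -> a i = 0,
     exists i, 0 < a i & \sum_i a i *: rho i = 0].
  move=> nl; have [[w hw]|[a [a0 aP ap s0]]] := gordan_fin (fun i => pos i || (i == l)) rho.
    have [D D0 [deg [dadd dE]]] := int_functional rho w.
    have degp m : pos m || (m == l) -> 0 < deg m.
      by move=> /hw; rewrite -(ltr_int rat) -dE => wm; rewrite mulr_gt0 ?ltr0n.
    have /negP[] := nl; apply: (deg_borel_max dadd) => [m pm|]; apply: degp; rewrite ?pm ?eqxx ?orbT //.
  by exists a; split=> // m nm ml; apply: aP; rewrite negb_or nm.
have [a [a0 aP [ia ap] sa]] := step i ni.
have [b' [b0 bP [ib bp] sb]] := step j nj.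
have ij : i != j.
  apply/eqP => ijE; have : 2%:R *: rho i = 0 by rewrite scaler_nat mulr2n {2}ijE jE subrr.
  by move/eqP; rewrite scaler_eq0 (negPf (rs_neq0 rs i)).
have indep := pos_indep (rs_neg rs) (rs_sub rs) pos_root_add pos_root_opp.
have sumD (f : 'I_r -> rat) l : (forall m, ~~ pos m -> m != l -> f m = 0) -> ~~ pos l ->
    \sum_m f m *: rho m = f l *: rho l + \sum_m (if pos m then f m else 0) *: rho m.
  move=> fP nl; rewrite [in RHS](bigD1 l) //= (negPf nl) scale0r add0r (bigD1 l) //=.
  congr (_ + _); apply: eq_bigr => m ml; case: ifP => // /negbT nm.
  by rewrite fP // scale0r.
have ai0 : 0 < a i.
  rewrite lt_def a0 andbT; apply/eqP => ai; move: sa; rewrite (sumD _ _ aP ni) ai scale0r add0r.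
  move=> /indep h0; have := h0 _ _ ia; case: ifP => [_|/negbT nia] /= E.
    by move: ap; rewrite E ?ltxx // => m; case: ifP.
  move: ap; have [->|iai] := eqVneq ia i; first by rewrite ai ltxx.
  by rewrite aP // ltxx.
have bj0 : 0 < b' j.
  rewrite lt_def b0 andbT; apply/eqP => bj; move: sb; rewrite (sumD _ _ bP nj) bj scale0r add0r.
  move=> /indep h0; have := h0 _ _ ib; case: ifP => [_|/negbT nib] /= E.
    by move: bp; rewrite E ?ltxx // => m; case: ifP.
  move: bp; have [->|ibj] := eqVneq ib j; first by rewrite bj ltxx.
  by rewrite bP // ltxx.
(* The two relations are weighted so that the terms in [rho i] and in [rho j = - rho i] cancel. *)
pose f m := if pos m then b' j * a m + a i * b' m else 0.
have f0 m : 0 <= f m by rewrite /f; case: ifP => // _; rewrite addr_ge0 ?mulr_ge0.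
have sf : \sum_m f m *: rho m = 0.
  rewrite (sumD _ _ aP ni) in sa; rewrite (sumD _ _ bP nj) jE in sb.
  transitivity (b' j *: \sum_m (if pos m then a m else 0) *: rho m +
                a i *: \sum_m (if pos m then b' m else 0) *: rho m).
    rewrite !scaler_sumr -big_split; apply: eq_bigr => m _ /=; rewrite /f !scalerA -scalerDl.
    by case: ifP; rewrite ?mulr0 ?addr0.
  move/eqP: sa; rewrite addrC addr_eq0 => /eqP ->.
  move/eqP: sb; rewrite addrC addr_eq0 => /eqP ->.
  by rewrite !scalerN !scalerA opprK mulrC addNr.
have fz m : f m = 0 by apply: indep => // l /negPf nl; rewrite /f nl.
have am m : pos m -> a m = 0.
  move=> pm; have := fz m; rewrite /f pm => /eqP; rewrite paddr_eq0 ?mulr_ge0 // => /andP[+ _].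
  by rewrite mulf_eq0 (gt_eqF bj0) => /eqP.
move: sa; rewrite (sumD _ _ aP ni) big1 ?addr0 => [|m _]; last first.
  by case: ifP => [/am ->|_]; rewrite scale0r.
by move/eqP; rewrite scaler_eq0 (gt_eqF ai0) (negPf (rs_neq0 rs i)).
Qed.

End BorelRoots.

Section IdealRoots.
Variables (C : numClosedFieldType) (n' : nat).
Local Notation N := n'.+1.
Variable c : struct_const C N.
Implicit Types (x y z : 'rV[C]_N) (A B D : 'M[C]_N).
Local Notation "[ x , y ]" := (lbr c x y).
Local Notation kil := (killing c).

Record ideal_setting (h : 'M[C]_N) (r : nat) (rho : 'I_r -> 'rV[rat]_r) (Q0 : 'M[C]_N)
    (Q : 'I_r -> 'M[C]_N) (t : 'I_r -> 'rV[C]_N) (b n m : 'M[C]_N) : Prop := {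
  is_lie : is_lie_algebra c;
  is_nondeg : forall x, (forall y, kil x y = 0) -> x = 0;
  is_roots : root_setting c h rho Q0 Q t;
  is_borel : borel_subalg c b;
  is_cartan_borel : (h <= b)%MS;
  is_nilrad : nilradical c b n;
  is_borel_sum : (h + n == b)%MS;
  is_borel_cap : (h :&: n <= (0 : 'M[C]_N))%MS;
  is_ideal : ideal_of c m b;
  is_nil_ideal : (m <= n)%MS }.

Variables (h : 'M[C]_N) (r : nat) (rho : 'I_r -> 'rV[rat]_r)
  (Q0 : 'M[C]_N) (Q : 'I_r -> 'M[C]_N) (t : 'I_r -> 'rV[C]_N) (b n m : 'M[C]_N).
Hypothesis st : ideal_setting h rho Q0 Q t b n m.
Let lie := is_lie st.
Let rs := is_roots st.
Let Hb := is_borel st.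
Let hb := is_cartan_borel st.
Let Hn := is_nilrad st.
Let Hbn := is_borel_sum st.
Let Hhn := is_borel_cap st.
Let Hm := is_ideal st.
Let mn := is_nil_ideal st.
Local Notation pos := (pos_root Q n).

Definition ideal_root : pred 'I_r := fun i => (Q i <= m)%MS.
Local Notation I := ideal_root.
Local Notation gen := (generator rho pos I).

Let padd := pos_root_add rs Hn.
Let popp := pos_root_opp rs hb Hn Hhn.
Let ptot := pos_root_total lie rs Hb hb Hn Hbn Hhn.

Lemma ideal_root_pos i : I i -> pos i.
Proof. by move=> Ii; apply: submx_trans mn. Qed.

Lemma ideal_rootU i j k : I i -> pos j -> rho k = rho i + rho j -> I k.
Proof. exact: (ideal_root_up rs Hn Hm). Qed.

Lemma ideal_stableh : stable (adh c h) m.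
Proof. exact: (ideal_borel_stable hb Hm). Qed.

Lemma idealP x : (x <= m)%MS <-> x *m Q0 = 0 /\ forall i, ~~ I i -> x *m Q i = 0.
Proof.
split=> [xm|/(root_spanP rs) xr].
  split=> [|i]; first by apply: (nil_grade0 rs hb Hn Hhn); apply: submx_trans mn.
  apply: contraNeq => xi; apply: (root_sub_mx rs _ xi); first by rewrite (rootQQ rs) eqxx.
  exact: (stableQ rs _ ideal_stableh).
by rewrite (submx_trans xr) // /root_span summx_sub.
Qed.

Lemma degree_exists : exists deg nu, [/\ additive_deg rho deg, forall i, pos i -> 0 < deg i
  & forall i, gen i -> deg i = nu].
Proof.
have [mu [nu [mp mg]]] := generator_functional (rs_neg rs) (rs_sub rs) padd popp ptot ideal_root_pos ideal_rootU.
have [D D0 [deg [dadd dE]]] := int_functional rho mu.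
case: (pickP gen) => [i0 gi0|g0]; last first.
  exists deg, 0; split=> // i; last by rewrite g0.
  by move/mp => pi; rewrite -(ltr_int rat) -dE mulr_gt0 ?ltr0n.
exists deg, (deg i0); split=> // i; first by move/mp => pi; rewrite -(ltr_int rat) -dE mulr_gt0 ?ltr0n.
by move=> gi; apply/eqP; rewrite -(eqr_int rat) -!dE !mg.
Qed.

Variables (deg : 'I_r -> int) (nu : int).
Hypothesis hdeg : [/\ additive_deg rho deg, forall i, pos i -> 0 < deg i
  & forall i, gen i -> deg i = nu].
Let dadd : additive_deg rho deg. Proof. by case: hdeg. Qed.
Let dpos i : pos i -> 0 < deg i. Proof. by case: hdeg => _ + _; apply. Qed.
Let dgen i : gen i -> deg i = nu. Proof. by case: hdeg => _ _; apply. Qed.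

Lemma ideal_root_ind (K : 'I_r -> Prop) : (forall i, gen i -> K i) ->
  (forall i j k, I k -> pos j -> K k -> rho i = rho k + rho j -> K i) ->
  forall i, I i -> K i.
Proof.
move=> Kg KU i; have [d] := ubnP `|deg i|%N; elim: d i => // d IH i di Ii.
have [gi|ngi] := boolP (gen i); first exact: Kg.
have [j [k [pj Ik kE]]] := generatorPn Ii ngi.
have E : rho i = rho k + rho j by rewrite kE subrK.
apply: (KU _ _ _ Ik pj _ E); apply: IH => //.
have := dadd.1 _ _ _ (esym E); have := dpos pj; have := dpos (ideal_root_pos Ik).
by move: di; clear; lia.
Qed.

Lemma gen_exists i : I i -> exists j, gen j.
Proof.
by move: i; apply: ideal_root_ind => [i gi|//]; exists i.
Qed.

Lemma nu_gt0 i : I i -> 0 < nu.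
Proof. by move=> /gen_exists[j gj]; rewrite -(dgen gj) dpos // ideal_root_pos // (generatorI gj). Qed.

Lemma deg_ge_nu i : I i -> nu <= deg i.
Proof.
move: i; apply: ideal_root_ind => [i /dgen -> //|i j k Ik pj nk E].
have := dadd.1 _ _ _ (esym E); have := dpos pj; lia.
Qed.

Lemma deg_gt_nu i : I i -> ~~ gen i -> nu < deg i.
Proof.
move=> Ii ngi; have [j [k [pj Ik kE]]] := generatorPn Ii ngi.
have E : rho i = rho k + rho j by rewrite kE subrK.
have := dadd.1 _ _ _ (esym E); have := dpos pj; have := deg_ge_nu Ik; lia.
Qed.

(** If the component at a generator [i] vanishes, [x] lies in [m] with the root space of [i]
    omitted. This is still an ideal, since [i] is not the sum of a root of [m] and a positive root.
    Conversely, an ideal containing [x] contains the root spaces of the generators, and bracketing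
    upwards reaches all of [m]. *)
Lemma mbulletP x : mbullet c b n m x <-> (x <= m)%MS /\ forall i, gen i -> x *m Q i != 0.
Proof.
split=> [[xn [xm xJ]]|[xm xg]].
  split=> // i gi; apply/eqP => xi0.
  pose J := root_span Q (fun j => I j && (j != i)).
  have JP y : (y <= J)%MS <-> (y <= m)%MS /\ y *m Q i = 0.
    split=> [/(root_spanP rs)[y0 yI]|[/idealP[y0 yI] yi]].
      split; last by apply: yI; rewrite eqxx andbF.
      by apply/idealP; split=> // j nj; apply: yI; rewrite (negPf nj).
    apply/(root_spanP rs); split=> // j; rewrite negb_and negbK => /orP[/yI //|/eqP ->] //.
  have Jb : ideal_of c J b.
    split; first by apply: submx_trans (Hm.1); apply/row_subP => j; have /JP[] := row_sub j J.
    apply: brmx_sub => y z yb /JP[zm zi]; apply/JP; split.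
      by rewrite (submx_trans _ Hm.2) // mem_brmx.
    apply/eqP/negPn/negP => /(bracket_support lie rs)[].
    - by rewrite zi eqxx andbF.
    - by have /idealP[-> _] := zm; rewrite eqxx.
    move=> [j [k [yj zk E]]].
    have pj : pos j by apply: contraNT yj => nj; have /(borelP rs hb Hn Hbn Hhn) -> := yb.
    have Ik : I k by apply: contraNT zk => nk; have /idealP[_ ->] := zm.
    have := generatorP gi pj (k := k); rewrite Ik -E addrC addKr => /(_ erefl).
    by [].
  have mJ := xJ J Jb; have /JP[_] : (root_vec Q i <= J)%MS.
    apply: submx_trans (mJ _); last by apply/JP.
    exact: submx_trans (nz_row_sub _) (generatorI gi).
  by rewrite (root_vecQ rs) => /eqP; rewrite (negPf (root_vec_neq0 rs i)).
split; first by rewrite (submx_trans xm).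
split=> // J Jb xJ.
have QJ i : I i -> (Q i <= J)%MS.
  move: i; apply: ideal_root_ind => [i gi|i j k Ik pj Qk E].
    apply: (root_sub_mx rs (x := x *m Q i)); rewrite ?(rootQQ rs) ?eqxx ?xg //.
    exact: (stableQ rs _ (ideal_borel_stable hb Jb)).
  exact: (ideal_root_up rs Hn Jb Qk pj E).
apply/row_subP => j; rewrite (root_decomp rs (row j m)).
have /idealP[-> rI] := row_sub j m; rewrite add0r summx_sub // => i _.
have [Ii|/rI ->] := boolP (I i); last exact: sub0mx.
by rewrite (submx_trans (submxMl _ _)) // QJ.
Qed.

(** The neutral element [h0] is sought in the span of the [t i] with [i] a generator, because
    brackets of [e] with opposite root vectors can only produce such elements. The value 2 is the
    sl2 normalization of [[h0, e]]. *)
Lemma weight_exists : exists (p : 'I_r -> rat) (h0 : 'rV[C]_N), [/\ (h0 <= h)%MS,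
  forall i x, x *m Q i = x -> [h0, x] = ratr (p i) *: x,
  forall i, gen i -> p i = 2,
  exists cf : 'I_r -> rat, (forall i, ~~ gen i -> cf i = 0) /\ h0 = \sum_i ratr (cf i) *: t i &
  exists w, forall i, p i = pairing (rho i) w].
Proof.
have [cf [c0 cE]] := generator_solve (rs_neg rs) (rs_sub rs) padd popp ptot ideal_root_pos ideal_rootU (fun=> 2).
pose p i := \sum_j cf j * pairing (rho j) (rho i)^T.
exists p, (\sum_i ratr (cf i) *: t i); split.
- by rewrite summx_sub // => i _; rewrite scalemx_sub // (rs_th rs).
- move=> i x xi; rewrite lbr_suml /p rmorph_sum /= scaler_suml; apply: eq_bigr => j _.
  by rewrite lbrZl (rs_t rs _ xi) scalerA dotC (rs_dot rs) rmorphM.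
- by move=> i gi; rewrite /p cE.
- by exists cf.
exists (\sum_j cf j *: (rho j)^T) => i; rewrite /p /pairing mulmx_sumr summxE.
by apply: eq_bigr => j _; rewrite -/(pairing _ _) dotC /pairing -scalemxAr [in RHS]mxE.
Qed.

(* The degree [2 deg - nu p] vanishes on the generators, where [p = 2] and
   [deg = nu]; [D] clears denominators. *)
Lemma lambda_exists (p : 'I_r -> rat) : (exists w, forall i, p i = pairing (rho i) w) ->
  exists2 D : nat, (0 < D)%N & exists lam, additive_deg rho lam /\
    forall i, (lam i)%:~R = D%:R * (2 * (deg i)%:~R - nu%:~R * p i).
Proof.
move=> [w pE].
have [D D0 /choice[lam lE]] := common_denominator (fun i => 2 * (deg i)%:~R - nu%:~R * p i).
exists D => //; exists lam; split=> //; split=> [i j k E|i j E]; apply/eqP.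
  rewrite -(eqr_int rat) rmorphD /= -!lE -(dadd.1 _ _ _ E) !pE -E pairingD rmorphD /=.
  by apply/eqP; ring.
have dE : (deg j)%:~R = - (deg i)%:~R :> rat.
  by apply/eqP; rewrite -addr_eq0 -rmorphD /= addrC (dadd.2 _ _ E).
have wE : pairing (rho j) w = - pairing (rho i) w.
  by apply/eqP; rewrite -addr_eq0 -pairingD addrC E pairing0.
rewrite -(eqr_int rat) rmorphD /= -!lE !pE dE wE; apply/eqP; ring.
Qed.

End IdealRoots.

(** * Contraction to the minimal roots *)

Section Sl2.
Variables (C : numClosedFieldType) (n' : nat).
Local Notation N := n'.+1.
Variable c : struct_const C N.
Implicit Types (x y z e f k : 'rV[C]_N).
Local Notation "[ x , y ]" := (lbr c x y).
Hypothesis lie : is_lie_algebra c.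

Lemma sl2_descent e f k y (q : C) : [e, f] = k -> [k, f] = - 2 *: f ->
  [e, y] = 0 -> [k, y] = q *: y -> forall j : nat,
  [k, iter j (lbr c f) y] = (q - 2 * j%:R) *: iter j (lbr c f) y /\
  [e, iter j.+1 (lbr c f) y] = (j.+1%:R * (q - j%:R)) *: iter j (lbr c f) y.
Proof.
move=> ef kf ey ky; elim=> [|j [IH1 IH2]].
  by rewrite /= mulr0n mulr0 !subr0 mul1r (lbr_jacobi lie) ef ey lbr0r addr0.
have kj : [k, iter j.+1 (lbr c f) y] = (q - 2 * j.+1%:R) *: iter j.+1 (lbr c f) y.
  rewrite iterS (lbr_jacobi lie) kf IH1 lbrZl lbrZr -scalerDl -natr1; congr (_ *: _); ring.
split=> //; rewrite iterS (lbr_jacobi lie) ef kj IH2 lbrZr -iterS -scalerDl.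
congr (_ *: _); rewrite -![in RHS]natr1 -natr1; ring.
Qed.

(** For [q < 0] the factor [j.+1 * (q - j)] never vanishes, so no power of [ad f] can kill [y]. *)
Lemma sl2_iter_neq0 e f k y (q : rat) : [e, f] = k -> [k, f] = - 2 *: f ->
  [e, y] = 0 -> [k, y] = ratr q *: y -> q < 0 -> y != 0 ->
  forall j : nat, iter j (lbr c f) y != 0.
Proof.
move=> ef kf ey ky q0 y0; elim=> [|j IH] //.
have [_ h] := sl2_descent ef kf ey ky j.
apply: contraNneq IH => fz; move: h; rewrite fz lbr0r => /esym/eqP.
rewrite scaler_eq0 mulf_eq0 pnatr_eq0 /= => /orP[|//].
rewrite -(ratr_nat C j) -rmorphB fmorph_eq0 lt_eqF //.
by rewrite subr_lt0 (lt_le_trans q0) // ler0n.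
Qed.

End Sl2.

Section Surjectivity.
Variables (C : numClosedFieldType) (n' : nat).
Local Notation N := n'.+1.
Variable c : struct_const C N.
Implicit Types (x y z : 'rV[C]_N) (A B D : 'M[C]_N).
Local Notation "[ x , y ]" := (lbr c x y).
Local Notation kil := (killing c).
Variables (h : 'M[C]_N) (r : nat) (rho : 'I_r -> 'rV[rat]_r)
  (Q0 : 'M[C]_N) (Q : 'I_r -> 'M[C]_N) (t : 'I_r -> 'rV[C]_N) (b n m : 'M[C]_N).
Hypothesis st : ideal_setting c h rho Q0 Q t b n m.
Let lie := is_lie st.
Let rs := is_roots st.
Let nd := is_nondeg st.
Local Notation pos := (pos_root Q n).
Local Notation I := (ideal_root Q m).
Local Notation gen := (generator rho pos I).
Let popp := pos_root_opp rs (is_cartan_borel st) (is_nilrad st) (is_borel_cap st).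
Let ptot := pos_root_total lie rs (is_borel st) (is_cartan_borel st) (is_nilrad st) (is_borel_sum st) (is_borel_cap st).
Variables (deg : 'I_r -> int) (nu : int).
Hypothesis hdeg : [/\ additive_deg rho deg, forall i, pos i -> 0 < deg i
  & forall i, gen i -> deg i = nu].
Let dadd : additive_deg rho deg. Proof. by case: hdeg. Qed.
Let dgen i : gen i -> deg i = nu. Proof. by case: hdeg => _ _; apply. Qed.
Variables (p : 'I_r -> rat) (h0 : 'rV[C]_N) (w : 'cV[rat]_r) (cf : 'I_r -> rat).
Hypotheses (h0h : (h0 <= h)%MS)
  (h0p : forall i x, x *m Q i = x -> [h0, x] = ratr (p i) *: x)
  (pgen : forall i, gen i -> p i = 2)
  (cf0 : forall i, ~~ gen i -> cf i = 0)
  (h0E : h0 = \sum_i ratr (cf i) *: t i)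
  (pw : forall i, p i = pairing (rho i) w).
Variables (D : nat) (lam : 'I_r -> int).
Hypotheses (D0 : (0 < D)%N) (ladd : additive_deg rho lam)
  (lamE : forall i, (lam i)%:~R = D%:R * (2 * (deg i)%:~R - nu%:~R * p i)).
Variable e : 'rV[C]_N.
Hypotheses (e0 : e *m Q0 = 0) (engen : forall i, ~~ gen i -> e *m Q i = 0)
  (egen : forall i, gen i -> e *m Q i != 0).

Lemma gen_sub_out i j : gen i -> gen j -> forall k, rho k <> rho i - rho j.
Proof.
move=> gi gj k kE; have [pk|[l pl lE]] := ptot k.
  have := @generatorP _ _ _ _ _ i k j gi pk; rewrite kE opprB addrC subrK (generatorI gj).
  by move=> /(_ erefl).
have := @generatorP _ _ _ _ _ j l i gj pl; rewrite lE kE opprK addrC subrK (generatorI gi).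
by move=> /(_ erefl).
Qed.

(** Differences of generators are not roots, so only opposite pairs contribute to [[e, f]]. Each
    contributes a multiple of [t i] that is adjusted to [cf i] by scaling the root vector. *)
Lemma opposite_exists : exists f, [e, f] = h0 /\ [h0, f] = - 2 *: f.
Proof.
have /choice[F FE] : forall i, exists v, gen i -> exists j,
    [/\ rho i + rho j = 0, v *m Q j = v & kil (e *m Q i) v = ratr (cf i)].
  move=> i; have [gi|ngi] := boolP (gen i); last by exists 0.
  have [j jE] := rs_neg rs i; have ij : rho i + rho j = 0 by rewrite jE subrr.
  have eii : e *m Q i *m Q i = e *m Q i by rewrite (rootQQ rs) eqxx.
  have nz := rs_kil_neq0 rs ij eii (root_vecQ rs j) (egen gi) (root_vec_neq0 rs j).
  exists ((ratr (cf i) / kil (e *m Q i) (root_vec Q j)) *: root_vec Q j) => _; exists j; split=> //.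
    by rewrite -scalemxAl (root_vecQ rs).
  by rewrite killingZr divfK.
exists (\sum_(i | gen i) F i); split.
  have -> : e = \sum_(i | gen i) e *m Q i.
    by rewrite {1}(root_decomp rs e) e0 add0r (bigID gen) /= [X in _ + X]big1 ?addr0.
  rewrite h0E [RHS](bigID gen) /= [X in _ = _ + X]big1 ?addr0; last by move=> i /cf0 ->; rewrite rmorph0 scale0r.
  rewrite lbr_suml; apply: eq_bigr => i gi; rewrite lbr_sumr (bigD1 i) //= big1 ?addr0.
    have [j [ij Fj kE]] := FE i gi.
    by rewrite (rs_opp rs ij) ?(rootQQ rs) ?eqxx // kE.
  move=> k /andP[gk ki]; have [j [kj Fj _]] := FE k gk.
  have jE : rho j = - rho k by apply/eqP; rewrite -addr_eq0 addrC kj.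
  apply: (rs_out rs (i := i) (j := j)) => //; last by rewrite (rootQQ rs) eqxx.
    by rewrite jE subr_eq0 (inj_eq (rs_inj rs)) eq_sym.
  by move=> l; apply/eqP; rewrite jE; apply: gen_sub_out.
rewrite lbr_sumr scaler_sumr; apply: eq_bigr => i gi.
have [j [ij Fj _]] := FE i gi; rewrite (h0p Fj); congr (_ *: _).
have -> : p j = - 2.
  by apply/eqP; rewrite -addr_eq0 -(pgen gi) !pw -pairingD addrC ij pairing0.
by rewrite rmorphN /= ratr_nat.
Qed.

Lemma lam_gen i : gen i -> lam i = 0.
Proof.
move=> gi; apply/eqP; rewrite -(intr_eq0 rat) lamE (dgen gi) (pgen gi).
by rewrite [nu%:~R * 2]mulrC subrr mulr0.
Qed.

(** The iterates of [ad f] on [y] would be nonzero eigenvectors of [h0] with eigenvalues [q - 2 j]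
    for all [j], but [h0] has only the eigenvalues 0 and [p i]. *)
Lemma no_highest_vector (q : rat) y : y != 0 -> [e, y] = 0 -> y *m Q0 = 0 ->
  q < 0 -> (forall i, y *m Q i != 0 -> p i = q) -> False.
Proof.
move=> y0 ey yQ0 q0 yq; have [f [ef h0f]] := opposite_exists.
have h0y : [h0, y] = ratr q *: y.
  rewrite (root_decomp rs y) yQ0 add0r lbr_sumr scaler_sumr; apply: eq_bigr => i _.
  have [->|yi] := eqVneq (y *m Q i) 0; first by rewrite lbr0r scaler0.
  by rewrite (h0p (i := i)) ?(yq i) // (rootQQ rs) eqxx.
pose B := \sum_i `|p i| + 1.
have B0 : 0 <= B by rewrite addr_ge0 ?sumr_ge0.
have [j jB] : exists j : nat, B < j%:R by exists (Num.bound B); apply: archi_boundP.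
have nz := sl2_iter_neq0 lie ef h0f ey h0y q0 y0 j.
have [hj _] := sl2_descent lie ef h0f ey h0y j.
set v := iter j _ _ in nz hj; have hq : ratr q - 2 * j%:R = ratr (q - 2 * j%:R) :> C.
  by rewrite rmorphB rmorphM /= !ratr_nat.
case/eqP: nz; apply: (root_eqP rs) => [|i]; rewrite mul0mx.
  have : [h0, v] *m Q0 = 0.
    rewrite {1}(root_decomp rs v) lbrDr lbr_sumr (rs_abel rs) ?(Q0_cartan rs) // add0r mulmx_suml.
    by rewrite big1 // => i _; rewrite (h0p (i := i)) ?(rootQQ rs) ?eqxx // -scalemxAl (rootQQ0 rs) scaler0.
  rewrite hj -scalemxAl => /eqP; rewrite scaler_eq0 hq fmorph_eq0 lt_eqF => [/eqP //|].
  by rewrite subr_lt0 (lt_le_trans q0) // mulr_ge0 ?ler0n.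
have : [h0, v] *m Q i = ratr (p i) *: (v *m Q i).
  by rewrite (cartan_bracket rs) // (h0p (i := i)) // (rootQQ rs) eqxx.
rewrite hj -scalemxAl => /eqP; rewrite -subr_eq0 -scalerBl hq -rmorphB scaler_eq0 fmorph_eq0.
rewrite lt_eqF => [/eqP //|]; have pB : `|p i| + 1 <= B.
  by rewrite lerD2r (bigD1 i) //= lerDl sumr_ge0.
have := ler_norm (- p i); rewrite normrN => pi.
by move: (j%:R) jB => J jB; lra.
Qed.

Variables (d l : int).
Let J := fun i => [&& I i, ~~ gen i, deg i == d & lam i == l].
(** Bracketing with [e] adds [nu] to [deg] and 0 to [lam], hence carries these root spaces into
    those of [J]. *)
Let T := fun i => [&& pos i, deg i == d - nu & lam i == l].

Lemma root_span_id (K : pred 'I_r) x : (x <= root_span Q K)%MS -> x *m root_span Q K = x.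
Proof.
move=> /(root_spanP rs)[x0 xK]; rewrite [RHS](root_decomp rs x) x0 add0r mulmx_sumr.
rewrite [RHS](bigID K) /= [X in _ = _ + X]big1 ?addr0 // => i /xK //.
Qed.

(* Otherwise a nonzero linear form on the span of [J], written [kil _ y], kills
   [[T, e]].  Then [[e, y] = 0], while [h0] acts on [y] by a negative number,
   as [lam <= 0] and [deg > 0] on [J]. *)
Lemma lower_span : l <= 0 -> (root_span Q J <= root_span Q T *m ad c e)%MS.
Proof.
move=> l0; set W := _ *m _; rewrite submxE; apply: contraT => JW.
have [k [i ki]] : exists k i, (root_span Q J *m cokermx W) i k != 0.
  apply: contrapT => nik; case/eqP: JW; apply/matrixP => i k; rewrite [RHS]mxE.
  by apply/eqP/negPn/negP => ik; apply: nik; exists k, i.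
pose phi := col k (cokermx W).
have Wphi : W *m phi = 0 by rewrite /phi colE mulmxA mulmx_coker mul0mx.
(* [y] represents, through the Killing form, [phi] composed with the projection onto the span of
   [J]. *)
pose y := (invmx (killing_mat c) *m (root_span Q J *m phi))^T.
have kily x : (kil x y)%:M = x *m root_span Q J *m phi.
  by rewrite -killing_mx -/(killing_mat c) trmxK mulmxA mulmxK ?(killing_mat_unit nd) // mulmxA.
have kil0 x : x *m root_span Q J *m phi = 0 -> kil x y = 0.
  by rewrite -kily => /matrixP/(_ 0 0); rewrite !mxE eqxx.
have y0 : y != 0.
  apply: contraNneq ki => yz; have := kily (delta_mx 0 i); rewrite yz killing0r.
  by rewrite -mulmxA -rowE => /matrixP/(_ 0 0); rewrite /phi colE mulmxA -colE !mxE mul0rn => <-.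
have yQ i1 : y *m Q i1 != 0 -> exists2 i2, rho i2 = - rho i1 & J i2.
  move=> yi; have [i2 i2E] := rs_neg rs i1; exists i2 => //.
  have E : rho i2 + rho i1 = 0 by rewrite i2E addNr.
  have yii : y *m Q i1 *m Q i1 = y *m Q i1 by rewrite (rootQQ rs) eqxx.
  have := rs_kil_neq0 rs E (root_vecQ rs i2) yii (root_vec_neq0 rs i2) yi.
  have -> : kil (root_vec Q i2) (y *m Q i1) = kil (root_vec Q i2) y.
    rewrite [in RHS](root_decomp rs y) killingDr killing_sumr.
    rewrite [X in _ = X + _]killingC (rs_kil0 rs (Q0_cartan rs y) (root_vecQ rs i2)) add0r.
    rewrite (bigD1 i1) //= big1 ?addr0 // => j ji.
    apply: (rs_kil rs _ (root_vecQ rs i2) (j := j)); last by rewrite (rootQQ rs) eqxx.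
    by rewrite i2E addrC subr_eq0 (inj_eq (rs_inj rs)).
  apply: contraNT => nJ; apply/eqP/kil0.
  have [_ z] : root_vec Q i2 *m Q0 = 0 /\ root_vec Q i2 *m root_span Q J = 0; last by rewrite z mul0mx.
  split; first exact: (rootQi0 rs (root_vecQ rs i2)).
  rewrite mulmx_sumr big1 // => j Jj; apply: (rootQij rs (root_vecQ rs i2)).
  by apply: contraNneq nJ => ->.
have yQ0 : y *m Q0 = 0.
  apply: nd => x; have K0 z z' : (z <= h)%MS -> kil z z' = kil z (z' *m Q0).
    move=> zh; rewrite {1}(root_decomp rs z') killingDr killing_sumr big1 ?addr0 // => j _.
    by apply: (rs_kil0 rs zh (i := j)); rewrite (rootQQ rs) eqxx.
  rewrite K0 ?(Q0_cartan rs) // killingC -K0 ?(Q0_cartan rs) //; apply: kil0.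
  by rewrite mulmx_sumr big1 ?mul0mx // => j _; rewrite (rootQ0Q rs).
have [be Jbe] : exists be, J be.
  apply: contrapT => nJ; case/eqP: y0; apply: (root_eqP rs); rewrite ?yQ0 ?mul0mx // => j.
  by rewrite mul0mx; apply/eqP/negPn/negP => /yQ[i2 _ Ji2]; apply: nJ; exists i2.
have nu0 : 0 < nu by case/and4P: Jbe => /(nu_gt0 st hdeg).
(* [deg] and [lam] determine [p], so [p] is constant on [J] and [y], supported on the opposite
   roots, is an eigenvector of [h0]. *)
have pJ j : J j -> nu%:~R * p j = 2 * d%:~R - l%:~R / D%:R.
  case/and4P => _ _ /eqP dj /eqP lj; have := lamE j; rewrite dj lj => ->.
  by rewrite mulrAC divff ?pnatr_eq0 ?(gtn_eqF D0) // mul1r opprB addrC subrK.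
have nuq : nu%:~R != 0 :> rat by rewrite intr_eq0 gt_eqF.
have d0 : 0 < d.
  by case/and4P: Jbe => Ib _ /eqP <- _; case: hdeg => _ + _; apply; apply: (ideal_root_pos st).
have pbe : 0 < p be.
  have : 0 < nu%:~R * p be.
    rewrite pJ // subr_gt0 (le_lt_trans (_ : _ <= 0)) ?mulr_gt0 ?ltr0z //.
    by rewrite pmulr_lle0 ?invr_gt0 ?ltr0n // lerz0.
  by rewrite pmulr_rgt0 // ltr0z.
have ey : [e, y] = 0.
  apply: nd => x; rewrite killingC -(killing_inv lie); apply: kil0.
  rewrite (root_decomp rs x) lbrDl lbr_suml !mulmxDl.
  have -> : [x *m Q0, e] *m root_span Q J = 0.
    rewrite mulmx_sumr big1 // => j /and4P[_ nj _ _].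
    by rewrite (cartan_bracket rs) ?(Q0_cartan rs) // engen // lbr0r.
  rewrite mul0mx add0r mulmx_suml mulmx_suml big1 // => i1 _; set x1 := x *m Q i1.
  have x1i : x1 *m Q i1 = x1 by rewrite (rootQQ rs) eqxx.
  have x10 : x1 *m Q0 = 0 by rewrite (rootQQ0 rs).
  have supp k1 : [x1, e] *m Q k1 != 0 -> exists2 j, gen j & rho i1 + rho j = rho k1.
    move=> /(bracket_support lie rs)[]; rewrite ?x10 ?e0 ?eqxx //.
    move=> [i2 [j [x1i2 ej E]]]; exists j; first by apply: contraNT ej => /engen ->.
    suff -> : i1 = i2 by [].
    by apply/eqP; apply: contraNT x1i2 => ne; rewrite (rootQij rs x1i).
  have [Ti|nT] := boolP (T i1).
    have xeJ : ([x1, e] <= root_span Q J)%MS.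
      case/and3P: (Ti) => pi /eqP di /eqP li; apply/(root_spanP rs); split.
        apply/eqP/negPn/negP => /(bracket_support0 lie rs)[i2 [j [x1i2 ej E]]].
        have gj : gen j by apply: contraNT ej => /engen ->.
        have E2 : i1 = i2 by apply/eqP; apply: contraNT x1i2 => ne; rewrite (rootQij rs x1i).
        have := popp pi (ideal_root_pos st (generatorI gj)); rewrite E2 E.
        by rewrite eqxx.
      move=> k1 nJ; apply/eqP/negPn/negP => /supp[j gj E]; case/negP: nJ; apply/and4P; split.
      - by apply: (ideal_rootU st (generatorI gj) pi); rewrite -E addrC.
      - apply/negP => gk; have := @generatorP _ _ _ _ _ k1 i1 j gk pi.
        by rewrite -E addrC addKr (generatorI gj) => /(_ erefl).
      - by rewrite -(dadd.1 _ _ _ E) di (dgen gj) subrK.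
      - by rewrite -(ladd.1 _ _ _ E) li (lam_gen gj) addr0.
    rewrite root_span_id // (lbrC lie) -mul_ad.
    have <- : x1 *m root_span Q T = x1.
      apply: root_span_id; apply/(root_spanP rs); split=> // j nTj.
      by apply: (rootQij rs x1i); apply: contraNneq nTj => <-.
    by rewrite mulNmx -!mulmxA (mulmxA _ (ad c e)) Wphi !mulmx0 oppr0.
  (* Outside [T] nothing reaches [J]: a root that is not positive is the opposite of a positive one,
     and subtracting the latter from a generator cannot end in [I]. *)
  rewrite mulmx_sumr big1 ?mul0mx // => k1 /and4P[Ik _ /eqP dk /eqP lk].
  apply/eqP/negPn/negP => /supp[j gj E]; case/negP: nT; apply/and3P; split.
  - have [//|[g pg gE]] := ptot i1.
    have := @generatorP _ _ _ _ _ j g k1 gj pg; rewrite gE opprK -E addrC Ik.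
    by move=> /(_ erefl).
  - by rewrite -dk -(dadd.1 _ _ _ E) (dgen gj) addrK.
  - by rewrite -lk -(ladd.1 _ _ _ E) (lam_gen gj) addr0.
exfalso; apply: (@no_highest_vector (- p be) y) => //; first by rewrite oppr_lt0.
move=> i1 /yQ[i2 i2E Ji2]; have -> : p i1 = - p i2 by rewrite !pw i2E pairingN opprK.
by congr (- _); apply: (mulfI nuq); rewrite !pJ.
Qed.

End Surjectivity.

(** * Elimination by unipotent elements *)

Section Contraction.
Variables (C : numClosedFieldType) (n' : nat).
Local Notation N := n'.+1.
Variable c : struct_const C N.
Implicit Types (x y z : 'rV[C]_N) (A B D : 'M[C]_N).
Local Notation "[ x , y ]" := (lbr c x y).
Variables (h : 'M[C]_N) (r : nat) (rho : 'I_r -> 'rV[rat]_r)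
  (Q0 : 'M[C]_N) (Q : 'I_r -> 'M[C]_N) (t : 'I_r -> 'rV[C]_N) (b n m : 'M[C]_N).
Hypothesis st : ideal_setting c h rho Q0 Q t b n m.
Let lie := is_lie st.
Let rs := is_roots st.
Local Notation pos := (pos_root Q n).
Local Notation I := (ideal_root Q m).
Local Notation gen := (generator rho pos I).
Variables (deg : 'I_r -> int) (nu : int).
Hypothesis hdeg : [/\ additive_deg rho deg, forall i, pos i -> 0 < deg i
  & forall i, gen i -> deg i = nu].
Let dadd : additive_deg rho deg. Proof. by case: hdeg. Qed.
Let dpos i : pos i -> 0 < deg i. Proof. by case: hdeg => _ + _; apply. Qed.

(** [lam] is fixed before [e]: the elimination applies the statement to the [A]-part of the current
    vector, and all its steps must share one grading. *)
Lemma contracting_degree : exists lam, [/\ additive_deg rho lam, forall i, gen i -> lam i = 0 &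
  forall e i z, e *m Q0 = 0 -> (forall j, ~~ gen j -> e *m Q j = 0) ->
    (forall j, gen j -> e *m Q j != 0) ->
    I i -> ~~ gen i -> lam i <= 0 -> z *m Q i = z ->
    exists x, [/\ (x <= n)%MS, forall j, x *m Q j != 0 -> deg j = deg i - nu & [e, x] = z]].
Proof.
have [p [h0 [h0h h0p pgen [cf [cf0 h0E]] [w pw]]]] := weight_exists st.
have [D D0 [lam [ladd lamE]]] := lambda_exists hdeg (ex_intro _ w pw).
exists lam; split=> // [i gi|e i z e0 engen egen Ii ngi l0 zi].
  exact: (lam_gen hdeg pgen lamE gi).
have := lower_span st hdeg h0h h0p pgen cf0 h0E pw D0 ladd lamE e0 engen egen (deg i) l0.
set J := root_span _ _; set T := root_span _ _ => JT.
have zJ : (z <= J)%MS.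
  apply/(root_spanP rs); split; first exact: (rootQi0 rs zi).
  by move=> j nj; apply: (rootQij rs zi); apply: contraNneq nj => <-; rewrite Ii ngi !eqxx.
have /submxP[u uE] := submx_trans zJ JT.
have /(root_spanP rs)[u0 uT] := submxMl u T.
exists (u *m T); split.
- apply/(nilP rs (is_cartan_borel st) (is_nilrad st) (is_borel_cap st)); split=> // j nj.
  by apply: uT; rewrite (negPf nj).
- move=> j; apply: contraNeq => dj; rewrite uT //.
  by rewrite (negPf dj) andbF.
- by rewrite -mul_ad -mulmxA -uE.
Qed.

Definition fil (a : int) x := x *m Q0 = 0 /\ forall i, x *m Q i != 0 -> a <= deg i.

Lemma fil_bracket a a' x y : 0 < a -> 0 < a' -> fil a x -> fil a' y -> fil (a + a') [x, y].
Proof.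
move=> a0 a'0 [x0 xa] [y0 ya]; split.
  apply/eqP/negPn/negP => /(bracket_support0 lie rs)[i [j [/xa xi /ya yj E]]].
  by have := dadd.2 _ _ E; lia.
move=> k /(bracket_support lie rs)[]; rewrite ?x0 ?y0 ?eqxx //.
by move=> [i [j [/xa xi /ya yj E]]]; rewrite -(dadd.1 _ _ _ E) lerD.
Qed.

Lemma fil_iter a a' x y k : 0 < a -> 0 < a' -> fil a x -> fil a' y ->
  fil (a *+ k + a') (iter k (lbr c x) y).
Proof.
move=> a0 a'0 xa ya; elim: k => [|k IH]; first by rewrite add0r.
rewrite mulrS -addrA /=; apply: fil_bracket => //.
by rewrite ltr_wpDl // mulrn_wge0 // ltW.
Qed.

Lemma fil_lt a x i : fil a x -> deg i < a -> x *m Q i = 0.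
Proof. by move=> [_ xa] di; apply/eqP/negPn/negP => /xa; rewrite leNgt di. Qed.

Lemma mul_exp_ad x y : y *m exp_ad c x =
  \sum_(k < N.+1) (k`!%:R)^-1 *: iter k (lbr c x) y.
Proof.
rewrite /exp_ad mulmx_sumr; apply: eq_bigr => k _; rewrite -scalemxAr; congr (_ *: _).
elim: (k : nat) => [|j IH]; first by rewrite mulmx1.
by rewrite exprSr -mulmxE mulmxA IH mul_ad.
Qed.

Variable S : 'rV[C]_N -> Prop.
Hypotheses (Sm : forall x, S x -> mbullet c b n m x) (SB : B_stable c h n S).

Let core := root_span Q gen.

Lemma coreQ x i : x *m core *m Q i = if gen i then x *m Q i else 0.
Proof.
case: ifP => gi; last by have /(root_spanP rs)[_ ->] := submxMl x core; rewrite ?gi.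
rewrite /core /root_span mulmx_sumr mulmx_suml (bigD1 i) //= (rootQQ rs) eqxx.
by rewrite big1 ?addr0 // => j /andP[_ ji]; rewrite (rootQQ rs) (negPf ji).
Qed.

Lemma coreQ0 x : x *m core *m Q0 = 0.
Proof. by have /(root_spanP rs)[] := submxMl x core. Qed.

Section Lambda.
Variable lam : 'I_r -> int.
Hypothesis lsurj : forall e i z, e *m Q0 = 0 -> (forall j, ~~ gen j -> e *m Q j = 0) ->
    (forall j, gen j -> e *m Q j != 0) ->
    I i -> ~~ gen i -> lam i <= 0 -> z *m Q i = z ->
    exists x, [/\ (x <= n)%MS, forall j, x *m Q j != 0 -> deg j = deg i - nu & [e, x] = z].

Let bad i := [&& I i, ~~ gen i & lam i <= 0].

(* [exp (ad u) x = x - [e, u]] up to terms of degree greater than [d], and [u]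
   is chosen so that [[e, u]] is the bad part of [x] in degree [d]. *)
Lemma elimination_step (d : int) x : S x -> (forall i, bad i -> deg i < d -> x *m Q i = 0) ->
  exists2 x', S x' & forall i, bad i -> deg i < d + 1 -> x' *m Q i = 0.
Proof.
move=> Sx xd; case: (pickP (fun i => bad i && (deg i == d))) => [i0|nb]; last first.
  exists x => // i bi; rewrite ltzD1 le_eqVlt => /orP[di|]; last exact: xd.
  by have := nb i; rewrite bi di.
case/andP=> /and3P[Ii0 ngi0 _] /eqP di0.
have nu0 := nu_gt0 st hdeg Ii0.
have dnu : nu < d by rewrite -di0; apply: (deg_gt_nu st hdeg).
have dn0 : 0 < d - nu by rewrite subr_gt0.
have [xm xg] := (mbulletP st hdeg x).1 (Sm Sx).
have [x0 xI] := (idealP st x).1 xm.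
pose e := x *m core.
have eg j : gen j -> e *m Q j != 0 by move=> gj; rewrite coreQ gj xg.
have eng j : ~~ gen j -> e *m Q j = 0 by move=> /negPf nj; rewrite coreQ nj.
have /choice[F FE] : forall i, exists u, bad i -> deg i = d ->
    [/\ (u <= n)%MS, forall j, u *m Q j != 0 -> deg j = d - nu & [e, u] = x *m Q i].
  move=> i; have [/and3P[Ii ngi li]|nb] := boolP (bad i); last by exists 0.
  have xii : x *m Q i *m Q i = x *m Q i by rewrite (rootQQ rs) eqxx.
  have [u [un ud eu]] := lsurj (coreQ0 x) eng eg Ii ngi li xii.
  by exists u => _ <-.
pose u := \sum_(i | bad i && (deg i == d)) F i.
have un : (u <= n)%MS by apply: summx_sub => i /andP[bi /eqP di]; case: (FE i bi di).
have u0 : u *m Q0 = 0 by apply: (nil_grade0 rs (is_cartan_borel st) (is_nilrad st) (is_borel_cap st)).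
have uf : fil (d - nu) u.
  split=> // j uj; rewrite leNgt; apply: contra uj => dj; rewrite mulmx_suml.
  apply/eqP/big1 => i /andP[bi /eqP di].
  have [_ Fd _] := FE i bi di; apply/eqP; apply: contraTT dj => /Fd ->.
  by rewrite ltxx.
have eu : [e, u] = \sum_(i | bad i && (deg i == d)) x *m Q i.
  by rewrite lbr_sumr; apply: eq_bigr => i /andP[bi /eqP di]; case: (FE i bi di).
have xf : fil nu x.
  by split=> // i xi; apply: (deg_ge_nu st hdeg); apply: contraNT xi => /xI ->.
have yf : fil (nu + 1) (x - e).
  split; first by rewrite mulmxBl x0 coreQ0 subrr.
  move=> i; rewrite mulmxBl coreQ; case: ifP => [_|/negbT ngi]; first by rewrite subrr eqxx.
  rewrite subr0 => xi; have Ii : I i by apply: contraNT xi => /xI ->.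
  by have := deg_gt_nu st hdeg Ii ngi; lia.
exists (x *m exp_ad c u); first by apply: SB => //; apply: BG_unip.
move=> i bi; rewrite ltzD1 => di.
(* Terms with two or more brackets have degree at least [(d - nu) *+ 2 + nu], which exceeds [d]
   because [nu < d]. Only [x + [u, x]] matters up to degree [d]. *)
rewrite mul_exp_ad mulmx_suml big_ord_recl big_ord_recl /= big1 ?addr0; last first.
  move=> k _; rewrite -scalemxAl (fil_lt (fil_iter k.+2 dn0 nu0 uf xf)) ?scaler0 //.
  have q0 : 0 <= (d - nu) *+ k by rewrite mulrn_wge0 // ltW.
  by rewrite !mulrS; move: q0 di dn0; move: ((d - nu) *+ k) (deg i) => q d'; clear; lia.
rewrite invr1 !scale1r.
have -> : [u, x] = - [e, u] + [u, x - e].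
  by rewrite -(lbrC lie) -lbrDr addrC subrK.
rewrite mulmxDl (fil_lt (fil_bracket dn0 _ uf yf)) ?addr0; try lia.
rewrite eu mulNmx mulmx_suml.
case: (ltrgtP (deg i) d) di => // [di _|di _].
  rewrite xd // big1 ?subr0 // => j /andP[bj /eqP dj]; rewrite (rootQQ rs).
  by case: eqP => // ji; rewrite -dj ji ltxx in di.
rewrite (bigD1 i) ?bi ?di ?eqxx //= (rootQQ rs) eqxx big1 ?addr0 ?subrr // => j /andP[_ ji].
by rewrite (rootQQ rs) (negPf ji).
Qed.

Lemma elimination x : S x -> exists2 x', S x' & forall i, bad i -> x' *m Q i = 0.
Proof.
move=> Sx; suff /(_ (\sum_i `|deg i|).+1%N)[x' Sx' h'] : forall k : nat,
    exists2 x', S x' & forall i, bad i -> deg i < k%:Z -> x' *m Q i = 0.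
  exists x' => // i bi; apply: h' => //; rewrite (bigD1 i) //=; lia.
elim=> [|k [x' Sx' h']].
  exists x => // i /and3P[Ii _ _] di; have := dpos (ideal_root_pos st Ii); lia.
have [x'' S'' h''] := elimination_step Sx' h'; exists x'' => // i bi di.
by apply: h'' => //; move: di; rewrite -addn1 PoszD.
Qed.

End Lambda.
End Contraction.

(** * Torus elements and limits along one-parameter subgroups *)

Section TorusElements.
Variables (C : numClosedFieldType) (n' : nat).
Local Notation N := n'.+1.
Variable c : struct_const C N.
Implicit Types (x y z : 'rV[C]_N).
Hypothesis lie : is_lie_algebra c.
Variables (h : 'M[C]_N) (r : nat) (rho : 'I_r -> 'rV[rat]_r)
  (Q0 : 'M[C]_N) (Q : 'I_r -> 'M[C]_N) (t : 'I_r -> 'rV[C]_N).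
Hypothesis rs : root_setting c h rho Q0 Q t.

Definition torus_mx (psi : 'I_r -> C) : 'M[C]_N := Q0 + \sum_i psi i *: Q i.

Lemma torus_mxQ psi x i : x *m torus_mx psi *m Q i = psi i *: (x *m Q i).
Proof.
rewrite /torus_mx mulmxDr mulmxDl (rootQ0Q rs) add0r mulmx_sumr mulmx_suml (bigD1 i) //=.
rewrite big1 ?addr0 => [|j ji]; last by rewrite -scalemxAr -scalemxAl (rootQQ rs) (negPf ji) scaler0.
by rewrite -scalemxAr -scalemxAl (rootQQ rs) eqxx.
Qed.

Lemma torus_mxQ0 psi x : x *m torus_mx psi *m Q0 = x *m Q0.
Proof.
rewrite /torus_mx mulmxDr mulmxDl -mulmxA (rs_idem0 rs) mulmx_sumr mulmx_suml big1 ?addr0 // => i _.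
by rewrite -scalemxAr -scalemxAl (rootQQ0 rs) scaler0.
Qed.

Definition multiplicative (psi : 'I_r -> C) := [/\ forall i, psi i != 0,
  forall i j k, rho i + rho j = rho k -> psi i * psi j = psi k &
  forall i j, rho i + rho j = 0 -> psi i * psi j = 1].

Lemma torus_mx_elt psi : multiplicative psi -> torus_elt c h (torus_mx psi).
Proof.
move=> [psi0 psiD psi1]; split; [|split].
- have inv : torus_mx psi *m torus_mx (fun i => (psi i)^-1) = 1%:M; last by have [] := mulmx1_unit inv.
  apply/row_matrixP => l; rewrite !rowE mulmx1 mulmxA.
  apply: (root_eqP rs) => [|i]; first by rewrite !torus_mxQ0.
  by rewrite !torus_mxQ scalerA mulVf // scale1r.
- move=> x y; apply: (root_eqP rs) => [|k].
    rewrite torus_mxQ0 !(bracketQ0 lie rs); apply: eq_bigr => -[i j] /= /eqP E.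
    by rewrite !torus_mxQ killingZl killingZr mulrA psi1 // mul1r.
  rewrite torus_mxQ !(bracketQ lie rs) !torus_mxQ0 !torus_mxQ !lbrZr scalerDr scalerBr.
  congr (_ + _); rewrite scaler_sumr; apply: eq_bigr => -[i j] /= /eqP E.
  by rewrite !torus_mxQ lbrZl lbrZr scalerA (psiD _ _ _ E).
- move=> x xh; apply: (root_eqP rs) => [|i]; first by rewrite torus_mxQ0.
  by rewrite torus_mxQ (cartanQi rs) // scaler0.
Qed.

Lemma multiplicative_exprz (z : C) (lam : 'I_r -> int) : z != 0 -> additive_deg rho lam ->
  multiplicative (fun i => z ^ lam i).
Proof.
move=> z0 [lD l0]; split=> [i|i j k E|i j E]; first exact: expfz_neq0.
  by rewrite -(lD _ _ _ E) expfzDr.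
by rewrite -expfzDr // l0 // expr0z.
Qed.

Lemma multiplicative_prod (K : finType) (q : pred K) (F : K -> 'I_r -> C) :
  (forall k, q k -> multiplicative (F k)) -> multiplicative (fun i => \prod_(k | q k) F k i).
Proof.
move=> hF; split=> [i|i j l E|i j E].
- by rewrite prodf_seq_neq0; apply/allP => k _; apply/implyP => /hF[].
- by rewrite -big_split; apply: eq_bigr => k /hF[_ + _] /=; apply.
- by rewrite -big_split big1 // => k /hF[_ _] /=; apply.
Qed.

End TorusElements.

Lemma horner_mmap (C : idomainType) (n : nat) (v : 'I_n -> {poly C}) (p : mpoly.mpoly n C) (z : C) :
  (mpoly.mmap (@polyC C) v p).[z] = mpoly.meval (fun i => (v i).[z]) p.
Proof.
rewrite mpoly.mevalE /mpoly.mmap horner_sum; apply: eq_bigr => k _.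
rewrite hornerM hornerC /mpoly.mmap1 horner_prod; congr (_ * _).
by apply: eq_bigr => i _; rewrite horner_exp.
Qed.

Lemma poly_zero_off0 (C : numDomainType) (q : {poly C}) :
  (forall z, z != 0 -> q.[z] = 0) -> q.[0] = 0.
Proof.
move=> hq; suff -> : q = 0 by rewrite horner0.
apply: (@roots_geq_poly_eq0 _ q [seq i.+1%:R | i <- iota 0 (size q)]).
- by apply/allP => _ /mapP[i _ ->]; apply/rootP/hq; rewrite pnatr_eq0.
- rewrite map_inj_uniq ?iota_uniq // => i j /eqP.
  by rewrite eqr_nat => /eqP[].
- by rewrite size_map size_iota.
Qed.

Section Limit.
Variables (C : numClosedFieldType) (n' : nat).
Local Notation N := n'.+1.
Variable c : struct_const C N.
Implicit Types (x y z : 'rV[C]_N).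
Variables (h : 'M[C]_N) (r : nat) (rho : 'I_r -> 'rV[rat]_r)
  (Q0 : 'M[C]_N) (Q : 'I_r -> 'M[C]_N) (t : 'I_r -> 'rV[C]_N) (b n m : 'M[C]_N).
Hypothesis st : ideal_setting c h rho Q0 Q t b n m.
Let lie := is_lie st.
Let rs := is_roots st.
Local Notation pos := (pos_root Q n).
Local Notation I := (ideal_root Q m).
Local Notation gen := (generator rho pos I).
Let core := root_span Q gen.

Lemma contracted_limit (S : 'rV[C]_N -> Prop) (lam : 'I_r -> int) x :
  B_stable c h n S -> zariski_closed_in (mbullet c b n m) S ->
  (forall x, S x -> mbullet c b n m x) ->
  additive_deg rho lam -> (forall i, gen i -> lam i = 0) ->
  S x -> (forall i, [&& I i, ~~ gen i & lam i <= 0] -> x *m Q i = 0) -> S (x *m core).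
Proof.
move=> SB [Pz SE] Sm ladd lgen Sx xbad.
have [deg [nu hdeg]] := degree_exists st.
have [xm xg] := (mbulletP st hdeg x).1 (Sm _ Sx).
have [x0 xI] := (idealP st x).1 xm.
have coreQ i : x *m core *m Q i = if gen i then x *m Q i else 0 := coreQ st x i.
have coreQ0 : x *m core *m Q0 = 0 := coreQ0 st x.
apply/SE; split.
  apply/(mbulletP st hdeg); split; last by move=> i gi; rewrite coreQ gi xg.
  apply/(idealP st); split=> // i nI; rewrite coreQ; case: ifP => // gi.
  by rewrite (generatorI gi) in nI.
move=> p Pp.
(* The absolute value only provides a natural exponent: [lam] is nonnegative wherever [x] has a
   nonzero component. At 0 just the components with [lam i = 0] survive, and these belong to
   generators. *)
pose v j : {poly C} := \sum_i ((x *m Q i) 0 j)%:P * 'X^`|lam i|.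
pose q := mpoly.mmap (@polyC C) v p.
have qE (s : C) y : (forall j, (v j).[s] = y 0 j) -> q.[s] = poly_eval p y.
  by move=> vE; rewrite horner_mmap /poly_eval; apply: mpoly.meval_eq.
rewrite -(qE 0) => [|j]; last first.
  rewrite horner_sum (root_decomp rs (x *m core)) coreQ0 add0r summxE.
  apply: eq_bigr => i _; rewrite hornerM hornerC hornerXn coreQ.
  case: ifP => [gi|/negbT ngi]; first by rewrite lgen // expr0 mulr1.
  rewrite [RHS]mxE; have [Ii|/xI ->] := boolP (I i); last by rewrite mxE mul0r.
  have [li|li] := lerP (lam i) 0; first by rewrite xbad ?Ii ?ngi // mxE mul0r.
  by rewrite expr0n absz_eq0 gt_eqF // mulr0.
apply: poly_zero_off0 => z z0.
have mult := multiplicative_exprz z0 ladd.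
have /SE[_ /(_ p Pp) <-] : S (x *m torus_mx Q0 Q (fun i => z ^ lam i)).
  by apply: SB => //; apply: BG_torus; apply: (torus_mx_elt lie rs).
apply: qE => j; rewrite horner_sum (root_decomp rs (x *m torus_mx _ _ _)) (torus_mxQ0 rs) x0 add0r.
rewrite summxE; apply: eq_bigr => i _; rewrite hornerM hornerC hornerXn (torus_mxQ rs) [RHS]mxE mulrC.
have [->|xi0] := eqVneq (x *m Q i) 0; first by rewrite mxE !mulr0.
congr (_ * _); suff {2}-> : lam i = `|lam i|%N by [].
rewrite gez0_abs //; have [gi|ngi] := boolP (gen i); first by rewrite lgen.
have Ii : I i by apply: contraNT xi0 => /xI ->.
by rewrite leNgt; apply: contra xi0 => li; rewrite xbad // Ii ngi ltW.
Qed.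

Lemma core_mem (S : 'rV[C]_N -> Prop) :
  (forall x, S x -> mbullet c b n m x) -> (exists x, S x) -> B_stable c h n S ->
  zariski_closed_in (mbullet c b n m) S ->
  exists2 x, S x & x = x *m core.
Proof.
move=> Sm [x Sx] SB Sz; have [deg [nu hdeg]] := degree_exists st.
have [lam [ladd lgen lsurj]] := contracting_degree st hdeg.
have [x' Sx' h'] := elimination st hdeg Sm SB lsurj Sx.
exists (x' *m core); first exact: contracted_limit SB Sz Sm ladd lgen Sx' h'.
by rewrite [RHS](root_span_id st) // submxMl.
Qed.

(** For each generator [i], [generator_solve] gives a rational functional equal to 1 at [i] and 0 at
    the other generators. A multiple [D] of it is integral; the one-parameter subgroup, evaluated at
    a [D]-th root of the ratio [k i], corrects the component at [i] alone. The product over all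
    generators carries one element to the other. *)
Lemma core_transitive x y : mbullet c b n m x -> mbullet c b n m y ->
  exists psi, multiplicative rho psi /\
    x *m core *m torus_mx Q0 Q psi = y *m core.
Proof.
have [deg [nu hdeg]] := degree_exists st.
move=> /(mbulletP st hdeg)[xm xg] /(mbulletP st hdeg)[ym yg].
have Hn := is_nilrad st; have hb := is_cartan_borel st.
have padd := pos_root_add rs Hn.
have popp := pos_root_opp rs hb Hn (is_borel_cap st).
have ptot := pos_root_total lie rs (is_borel st) hb Hn (is_borel_sum st) (is_borel_cap st).
have /choice[k kE] : forall i, exists k : C, gen i -> k != 0 /\ y *m Q i = k *: (x *m Q i).
  move=> i; have [gi|] := boolP (gen i); last by exists 0.
  have [kx xE] : exists k, x *m Q i = k *: root_vec Q i.
    by apply: (root_vecE rs); rewrite (rootQQ rs) eqxx.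
  have [ky yE] : exists k, y *m Q i = k *: root_vec Q i.
    by apply: (root_vecE rs); rewrite (rootQQ rs) eqxx.
  have kx0 : kx != 0 by apply: contraNneq (xg i gi) => kx0; rewrite xE kx0 scale0r.
  have ky0 : ky != 0 by apply: contraNneq (yg i gi) => ky0; rewrite yE ky0 scale0r.
  exists (ky / kx) => _; rewrite mulf_neq0 ?invr_eq0 //; split=> //.
  by rewrite xE scalerA divfK.
have /choice[F FE] : forall i, exists F : 'I_r -> C, gen i ->
    multiplicative rho F /\ forall j, gen j -> F j = if j == i then k i else 1.
  move=> i; have [gi|] := boolP (gen i); last by exists (fun=> 0).
  have [cf [_ cE]] := generator_solve (rs_neg rs) (rs_sub rs) padd popp ptot
    (ideal_root_pos st) (ideal_rootU st) (fun j => (j == i)%:R).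
  have [D D0 [lam [ladd lE]]] := int_functional rho (\sum_j cf j *: (rho j)^T).
  have lgen j : gen j -> lam j = if j == i then D%:Z else 0.
    move=> gj; apply/eqP; rewrite -(eqr_int rat) -lE.
    have -> : pairing (rho j) (\sum_l cf l *: (rho l)^T) = (j == i)%:R.
      rewrite -cE // /pairing mulmx_sumr summxE; apply: eq_bigr => l _.
      by rewrite -[LHS]/(pairing (rho j) _) pairingZr dotC.
    by case: (j == i); rewrite ?mulr1 ?mulr0.
  have [k0 _] := kE i gi.
  have z0 : D.-root (k i) != 0 by rewrite rootC_eq0.
  exists (fun j => D.-root (k i) ^ lam j) => _; split; first exact: multiplicative_exprz.
  move=> j gj; rewrite lgen //; case: eqP => _ //.
  by rewrite -exprnP rootCK.
exists (fun j => \prod_(i | gen i) F i j); split.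
  by apply: multiplicative_prod => i gi; have [] := FE i gi.
apply: (root_eqP rs) => [|j]; first by rewrite (torus_mxQ0 rs) !(coreQ0 st).
rewrite (torus_mxQ rs) !(coreQ st); case: ifP => gj; last by rewrite scaler0.
have [_ ->] := kE j gj; congr (_ *: _); rewrite (bigD1 j) //= big1 ?mulr1.
  by have [_ ->] := FE j gj; rewrite ?eqxx.
by move=> i /andP[gi ij]; have [_ ->] := FE i gi; rewrite // eq_sym (negPf ij).
Qed.

End Limit.

(** * Conclusion: both subsets meet the same torus orbit *)

Section Intersection.
Variables (C : numClosedFieldType) (N : nat) (c : struct_const C N) (b h n m : 'M[C]_N).

Lemma closed_stable_meet :
  is_lie_algebra c -> semisimple c ->
  borel_subalg c b -> cartan_subalg c h -> (h <= b)%MS ->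
  nilradical c b n -> (h + n == b)%MS -> (h :&: n <= (0 : 'M[C]_N))%MS ->
  ideal_of c m b -> (m <= n)%MS ->
  forall S1 S2 : 'rV[C]_N -> Prop,
    (forall x, S1 x -> mbullet c b n m x) ->
    (forall x, S2 x -> mbullet c b n m x) ->
    (exists x, S1 x) -> (exists x, S2 x) ->
    B_stable c h n S1 -> B_stable c h n S2 ->
    zariski_closed_in (mbullet c b n m) S1 ->
    zariski_closed_in (mbullet c b n m) S2 ->
    exists x, S1 x /\ S2 x.
Proof.
case: N c b h n m => [|n'] c' b' h' nn mm lie ss Hb Hh hb Hn hnb hn0 Hm mn S1 S2 S1m S2m e1 e2 B1 B2 Z1 Z2.
  (* In dimension 0 there is only one vector; all that precedes is stated for matrices of positive
     size. *)
  by case: e1 e2 => [x S1x] [y S2y]; exists x; rewrite {2}(thinmx0 x) -(thinmx0 y).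
have [ws [P cs]] := cartan_setting_exists lie Hh.
have nd := killing_nondeg cs ss.
have [r [rho [Q0 [Q [t rs]]]]] := root_setting_exists cs nd.
have st : ideal_setting c' h' rho Q0 Q t b' nn mm by split.
have [x S1x xE] := core_mem st S1m e1 B1 Z1.
have [y S2y yE] := core_mem st S2m e2 B2 Z2.
have [psi [mult E]] := core_transitive st (S1m _ S1x) (S2m _ S2y).
exists y; split=> //; rewrite yE -E -xE.
by apply: B1 => //; apply: BG_torus; apply: (torus_mx_elt lie rs).
Qed.

End Intersection.

Theorem theorem3p2 (R : realType) (N : nat) (c : struct_const R[i] N)
  (b h n m : 'M[R[i]]_N) :
  is_lie_algebra c -> semisimple c ->
  borel_subalg c b -> cartan_subalg c h -> (h <= b)%MS ->
  nilradical c b n -> (h + n == b)%MS -> (h :&: n <= (0 : 'M[R[i]]_N))%MS ->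
  ideal_of c m b -> (m <= n)%MS ->
  forall S1 S2 : 'rV[R[i]]_N -> Prop,
    (forall x, S1 x -> mbullet c b n m x) ->
    (forall x, S2 x -> mbullet c b n m x) ->
    (exists x, S1 x) -> (exists x, S2 x) ->
    B_stable c h n S1 -> B_stable c h n S2 ->
    zariski_closed_in (mbullet c b n m) S1 ->
    zariski_closed_in (mbullet c b n m) S2 ->
    exists x, S1 x /\ S2 x.
Proof. exact: closed_stable_meet. Qed.
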